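(* Let $\mathbf{u}=u_r\mathbf{e}_r+u_\theta\mathbf{e}_\theta+u_z\mathbf{e}_z$ be an axially symmetric smooth solution of the steady Navier-Stokes equations $(\mathbf{u}\cdot\nabla)\mathbf{u}+\nabla p=\Delta\mathbf{u}$, $\operatorname{div}\mathbf{u}=0$ in $\mathbb{R}^3$ with $\lim_{|\mathbf{x}|\to\infty}\mathbf{u}(\mathbf{x})=0$, and let $\Gamma=ru_\theta$. If one of the following conditions holds: (i) $\lim_{|\mathbf{x}|\to\infty}\Gamma(\mathbf{x})=0$; (ii) $\Gamma\in L^q(\mathbb{R}^3)$ for some $q\in[2,\infty)$; then $\mathbf{u}\equiv 0$.
   Context: Cylindrical coordinates: $r=\sqrt{x_1^2+x_2^2}$, $\theta=\arctan(x_2/x_1)$, $z=x_3$, with $\mathbf{e}_r=(\cos\theta,\sin\theta,0)$, $\mathbf{e}_\theta=(-\sin\theta,\cos\theta,0)$, $\mathbf{e}_z=(0,0,1)$. A vector field $\mathbf{u}=u_r\mathbf{e}_r+u_\theta\mathbf{e}_\theta+u_z\mathbf{e}_z$ is axially symmetric if $u_r,u_\theta,u_z$ do not depend on $\theta$. The scalar function $p$ is the associated pressure. *)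

(* Defs.v *)
From HB Require Import structures.
From mathcomp Require Import all_boot all_order all_algebra.
From mathcomp Require Import all_classical all_reals all_analysis.
From mathcomp Require Import ring.

Set Implicit Arguments.
Unset Strict Implicit.
Unset Printing Implicit Defensive.

Import Order.TTheory GRing.Theory Num.Theory.
Import numFieldNormedType.Exports.

Local Open Scope classical_set_scope.
Local Open Scope ring_scope.

(* Points and vectors of R^3 are row vectors; the coordinates x_1, x_2, x_3 are
   x 0 0, x 0 1, x 0 2. *)
Definition vec3 {R : realType} (a b c : R) : 'rV[R]_3 :=
  \row_(i < 3) [:: a; b; c]`_i.

Definition dot3 {R : realType} (v w : 'rV[R]_3) : R :=
  \sum_(i < 3) v 0 i * w 0 i.

(* The library norm on 'rV[R]_3 is the max norm, hence this one. *)
Definition enorm {R : realType} (v : 'rV[R]_3) : R := Num.sqrt (dot3 v v).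

(* The filter |x| -> oo on R^3. *)
Definition at_infty (R : realType) : set_system 'rV[R]_3 :=
  filter_from [set: R] (fun M => [set x | M < enorm x]).
Arguments at_infty R : clear implicits.

(* 'D_v f x is a total function: a partial derivative is meaningful only where
   it is known to exist, which [smooth] guarantees below. *)
Definition partial {R : realType} (i : 'I_3) (f : 'rV[R]_3 -> R)
    : 'rV[R]_3 -> R :=
  fun x => 'D_(delta_mx 0 i) f x.

Definition partials {R : realType} (s : seq 'I_3) (f : 'rV[R]_3 -> R)
    : 'rV[R]_3 -> R :=
  foldr partial f s.

(* C^oo: the partial derivatives of all orders exist and are continuous. *)
Definition smooth {R : realType} (f : 'rV[R]_3 -> R) : Prop :=
  forall s : seq 'I_3,
    continuous (partials s f) /\
    forall (i : 'I_3) (x : 'rV[R]_3),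
      derivable (partials s f) x (delta_mx 0 i).

Definition component {R : realType} (u : 'rV[R]_3 -> 'rV[R]_3) (i : 'I_3)
    : 'rV[R]_3 -> R :=
  fun x => u x 0 i.

Definition smooth_field {R : realType} (u : 'rV[R]_3 -> 'rV[R]_3) : Prop :=
  forall i : 'I_3, smooth (component u i).

Definition divergence {R : realType} (u : 'rV[R]_3 -> 'rV[R]_3)
    (x : 'rV[R]_3) : R :=
  \sum_(i < 3) partial i (component u i) x.

Definition gradient {R : realType} (p : 'rV[R]_3 -> R) (x : 'rV[R]_3)
    : 'rV[R]_3 :=
  \row_(i < 3) partial i p x.

Definition laplacian {R : realType} (u : 'rV[R]_3 -> 'rV[R]_3)
    (x : 'rV[R]_3) : 'rV[R]_3 :=
  \row_(i < 3) \sum_(j < 3) partial j (partial j (component u i)) x.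

(* (u . nabla) u *)
Definition convection {R : realType} (u : 'rV[R]_3 -> 'rV[R]_3)
    (x : 'rV[R]_3) : 'rV[R]_3 :=
  \row_(i < 3) \sum_(j < 3) u x 0 j * partial j (component u i) x.

Definition steady_NS {R : realType} (u : 'rV[R]_3 -> 'rV[R]_3)
    (p : 'rV[R]_3 -> R) : Prop :=
  forall x : 'rV[R]_3,
    convection u x + gradient p x = laplacian u x /\ divergence u x = 0.

Definition radius {R : realType} (x : 'rV[R]_3) : R :=
  Num.sqrt (x 0 0 ^+ 2 + x 0 1 ^+ 2).

Definition cyl {R : realType} (r theta z : R) : 'rV[R]_3 :=
  vec3 (r * cos theta) (r * sin theta) z.

(* The cylindrical frame at x, with cos theta = x_1 / r and sin theta = x_2 / r
   (see [e_r_cyl] and [e_theta_cyl]). It is not defined on the axis r = 0, where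
   division by zero makes [e_r] and [e_theta] vanish. *)
Definition e_r {R : realType} (x : 'rV[R]_3) : 'rV[R]_3 :=
  vec3 (x 0 0 / radius x) (x 0 1 / radius x) 0.

Definition e_theta {R : realType} (x : 'rV[R]_3) : 'rV[R]_3 :=
  vec3 (- (x 0 1 / radius x)) (x 0 0 / radius x) 0.

Definition e_z {R : realType} : 'rV[R]_3 := vec3 0 0 1.

Definition u_r {R : realType} (u : 'rV[R]_3 -> 'rV[R]_3) (x : 'rV[R]_3) : R :=
  dot3 (u x) (e_r x).

Definition u_theta {R : realType} (u : 'rV[R]_3 -> 'rV[R]_3) (x : 'rV[R]_3)
    : R :=
  dot3 (u x) (e_theta x).

Definition u_z {R : realType} (u : 'rV[R]_3 -> 'rV[R]_3) (x : 'rV[R]_3) : R :=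
  dot3 (u x) e_z.

Definition indep_theta {R : realType} (f : 'rV[R]_3 -> R) : Prop :=
  forall r theta theta' z : R,
    0 < r -> f (cyl r theta z) = f (cyl r theta' z).

Definition axisymmetric {R : realType} (u : 'rV[R]_3 -> 'rV[R]_3) : Prop :=
  [/\ indep_theta (u_r u), indep_theta (u_theta u) & indep_theta (u_z u)].

Definition Gamma {R : realType} (u : 'rV[R]_3 -> 'rV[R]_3) (x : 'rV[R]_3)
    : R :=
  radius x * u_theta u x.

Definition lebesgue3 (R : realType) :=
  ((@lebesgue_measure R \x @lebesgue_measure R)
     \x @lebesgue_measure R)%E.
Arguments lebesgue3 R : clear implicits.

(* f \in L^q(R^3): the library has no measure on row vectors, so f is read on
   R * R * R through the coordinates. *)
Definition Lq3 {R : realType} (q : R) (f : 'rV[R]_3 -> R) : Prop :=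
  (fun t : R * R * R => f (vec3 t.1.1 t.1.2 t.2)) \in Lfun (lebesgue3 R) q%:E.

Section sanity.
Context {R : realType}.
Implicit Types (r theta z : R) (x : 'rV[R]_3).

Global Instance at_infty_filter : ProperFilter (at_infty R).
Proof.
apply: filter_from_proper; last first.
  move=> M _; exists (vec3 (`|M| + 1) 0 0); rewrite /= /enorm /dot3.
  rewrite !big_ord_recl big_ord0 !mxE /= !mulr0 !addr0 -expr2 sqrtr_sqr.
  by rewrite ger0_norm ?addr_ge0// (le_lt_trans (ler_norm M))// ltrDl.
apply: filter_from_filter; first by exists 0.
move=> M N _ _; exists (Num.max M N) => // x /=.
by rewrite gt_max => /andP[].
Qed.

Lemma radius_cyl r theta z : 0 < r -> radius (cyl r theta z) = r.
Proof.
move=> r0; rewrite /radius !mxE /= !exprMn -mulrDr cos2Dsin2 mulr1.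
by rewrite sqrtr_sqr gtr0_norm.
Qed.

Lemma e_r_cyl r theta z : 0 < r ->
  e_r (cyl r theta z) = vec3 (cos theta) (sin theta) 0.
Proof.
move=> r0; rewrite /e_r radius_cyl// !mxE /= -!(mulrC (r^-1)).
by rewrite !mulKf// gt_eqF.
Qed.

Lemma e_theta_cyl r theta z : 0 < r ->
  e_theta (cyl r theta z) = vec3 (- sin theta) (cos theta) 0.
Proof.
move=> r0; rewrite /e_theta radius_cyl// !mxE /= -!(mulrC (r^-1)).
by rewrite !mulKf// gt_eqF.
Qed.

Lemma frame_decomposition (u : 'rV[R]_3 -> 'rV[R]_3) x : 0 < radius x ->
  u x = u_r u x *: e_r x + u_theta u x *: e_theta x + u_z u x *: e_z.
Proof.
move=> r0; have rN0 : radius x != 0 by rewrite gt_eqF.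
have e1 : (x 0 0 / radius x) ^+ 2 + (x 0 1 / radius x) ^+ 2 = 1.
  rewrite !exprMn -mulrDl -[X in X * _]sqr_sqrtr ?addr_ge0 ?sqr_ge0//.
  by rewrite -exprMn mulfV// expr1n.
rewrite /u_r /u_theta /u_z /dot3.
rewrite !big_ord_recl !big_ord0 !mxE /= !mulr0 !addr0 !mulr1 !add0r.
set c := x 0 0 / _ in e1 *; set s := x 0 1 / _ in e1 *.
rewrite (_ : lift ord0 ord0 = 1 :> 'I_3); last exact/val_inj.
rewrite (_ : lift ord0 (lift ord0 ord0) = 2 :> 'I_3); last exact/val_inj.
rewrite (_ : ord0 = 0 :> 'I_3)//.
apply/rowP => i; rewrite !mxE -/c -/s.
rewrite -[LHS]mulr1 -{1}e1.
case: i => -[|[|[|//]]] hi /=.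
- by rewrite (_ : Ordinal hi = 0); [ring|exact/val_inj].
- by rewrite (_ : Ordinal hi = 1); [ring|exact/val_inj].
- rewrite (_ : Ordinal hi = 2); last exact/val_inj.
  by rewrite e1 /= !mulr0 !add0r !mulr1.
Qed.

End sanity.

(* Main.v *)
(* The function Gamma is annihilated by Delta - u.grad - (2/r) d_r, vanishes on
   the axis and has bounded drift. In case (i) the maximum principle, with a
   small multiple of exp (k x_3) as barrier, gives Gamma = 0. In case (ii) the
   equation is tested with a convex function of (Gamma - d)^+, which vanishes
   near the axis, times a cut-off at distance N: since the drifts u and e_r / r
   are divergence free off the axis, they only contribute terms containing
   derivatives of the cut-off, of size 1/N times the integral of
   ((Gamma - d)^+)^2, which Gamma^q controls. As N -> oo, (Gamma - d)^+ has
   gradient zero, hence vanishes, for every d > 0.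
   Without swirl the vorticity is w e_theta. Bernstein's method applied to
   h^4 |w|^2 + M h^2 |u|^2, h a cut-off around a distant point, shows that w
   tends to 0 at infinity; then w/r, which satisfies a maximum principle (it
   solves a drift-diffusion equation for the Laplacian of R^5), is zero. So each
   component of u is harmonic and vanishes at infinity, hence u = 0. *)

(* Cylindrical quantities are singular on the axis, so all equations are kept in Cartesian
   components, with axial symmetry in the infinitesimal form [rot a = - b], [rot b = a],
   [rot c = 0]. The term (2/r) d_r Gamma becomes twice the third vorticity component, which is
   smooth. In case (ii) the test function must be C^2, strictly convex where positive, and at most
   quadratic, so that every q >= 2 is covered: the squared positive part is not C^2 and the cube
   grows too fast, whence t^3 / (1 + t). Bernstein's method closes without a bound on grad u
   because, without swirl, the stretching term has size |omega_theta u_r / r| and |omega| <= r |grad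
   omega|: it is at most |u| |grad omega|. The velocity part supplies |grad u|^2, which pays for the
   multiples of |omega|^2 left by the cut-off; its own term u . lap u is paid for by |grad omega|^2,
   since lap u = - curl omega. The quotient w/r is singular on the axis; what is maximised is (w -
   eta)/r plus a barrier, on a set w >= eta that avoids both the axis and infinity. *)
Require Import Defs.
From HB Require Import structures.
From mathcomp Require Import all_boot all_order all_algebra.
From mathcomp Require Import all_classical all_reals all_analysis.
From mathcomp Require Import measurable_realfun.
From mathcomp Require Import ring lra.

Import Order.TTheory GRing.Theory Num.Theory.
Import numFieldNormedType.Exports.

Local Open Scope classical_set_scope.
Local Open Scope ring_scope.

(** * Smooth functions and second-order tests *)

(* A sealed copy of [partial]: the body of [derive] must not be unfolded when
   terms such as [pd 0 f x] and [pd 1 f y] are compared. *)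
Lemma pd_key : {pd : forall R : realType, 'I_3 -> ('rV[R]_3 -> R) ->
  'rV[R]_3 -> R | pd = @partial}.
Proof. by exists (@partial). Qed.

Definition pd {R : realType} : 'I_3 -> ('rV[R]_3 -> R) -> 'rV[R]_3 -> R :=
  sval pd_key R.

Lemma pdE {R : realType} : pd = @partial R.
Proof. by rewrite /pd (svalP pd_key). Qed.

Section smooth_calculus.
Context {R : realType}.
Local Notation V := 'rV[R]_3.
Implicit Types (f g : V -> R) (x : V) (i j : 'I_3).

(* A weakening of [smooth] that also covers the truncated functions used in the
   integral estimate. *)
Fixpoint Cn (n : nat) f : Prop :=
  [/\ continuous f, forall i x, derivable f x (delta_mx 0 i) &
   if n is n'.+1 then forall i, Cn n' (pd i f) else True].

Lemma partials_rcons s i f : partials (rcons s i) f = partials s (pd i f).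
Proof. by rewrite pdE /partials foldr_rcons. Qed.

Lemma smooth_pd {i f} : smooth f -> smooth (pd i f).
Proof. by move=> sf s; rewrite -partials_rcons; exact: sf. Qed.

Lemma smooth_cont {f} : smooth f -> continuous f.
Proof. by move=> /(_ [::])[]. Qed.

Lemma smoothP f : smooth f <-> forall n, Cn n f.
Proof.
split.
  move=> sf n; elim: n f sf => [|n IH] f sf /=; have [cf df] := sf [::];
    split => //.
  by move=> i; apply: IH; exact: smooth_pd.
move=> cf s; elim/last_ind: s f cf => [|s i IH] f cf.
  by have [] := cf 0%N.
by rewrite partials_rcons; apply: IH => n; have [_ _] := cf n.+1; exact.
Qed.

Lemma smooth_Cn {f} n : smooth f -> Cn n f.
Proof. by move=> /smoothP. Qed.

Lemma Cn_cont {n f} : Cn n f -> continuous f.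
Proof. by case: n => [|n] []. Qed.

Lemma Cn_derivable {n f} : Cn n f -> forall i x, derivable f x (delta_mx 0 i).
Proof. by case: n => [|n] []. Qed.

Lemma Cn_pd {n f} i : Cn n.+1 f -> Cn n (pd i f).
Proof. by move=> [_ _ +]; exact. Qed.

Lemma Cn_pred {n f} : Cn n.+1 f -> Cn n f.
Proof.
elim: n f => [|n IH] f [cf df pf]; split => // i.
exact/IH/pf.
Qed.

Lemma pd_cst (a : R) i : pd i (fun=> a) = (fun=> 0).
Proof. by apply/funext => x; rewrite !pdE /partial derive_cst. Qed.

Lemma pdD_Cn {m n f g} i : Cn m f -> Cn n g ->
  pd i (fun x => f x + g x) = fun x => pd i f x + pd i g x.
Proof.
move=> /Cn_derivable df /Cn_derivable dg; apply/funext => x; rewrite !pdE /partial.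
exact: (deriveD (df i x) (dg i x)).
Qed.

Lemma pdM_Cn {m n f g} i : Cn m f -> Cn n g ->
  pd i (fun x => f x * g x) =
  fun x => pd i f x * g x + f x * pd i g x.
Proof.
move=> /Cn_derivable df /Cn_derivable dg; apply/funext => x; rewrite !pdE /partial.
by rewrite (deriveM (df i x) (dg i x)) addrC mulrC.
Qed.

Lemma CnD {n f g} : Cn n f -> Cn n g -> Cn n (fun x => f x + g x).
Proof.
elim: n f g => [|n IH] f g cf cg.
  split => // [x|i x].
    exact: (continuousD (Cn_cont cf x) (Cn_cont cg x)).
  by apply: derivableD; [exact: (Cn_derivable cf)|exact: (Cn_derivable cg)].
have cfg := IH _ _ (Cn_pred cf) (Cn_pred cg).
split => [||i]; [exact: Cn_cont cfg|exact: Cn_derivable cfg|rewrite (pdD_Cn i cf cg)].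
exact: IH (Cn_pd i cf) (Cn_pd i cg).
Qed.

Lemma CnM {n f g} : Cn n f -> Cn n g -> Cn n (fun x => f x * g x).
Proof.
elim: n f g => [|n IH] f g cf cg.
  split => // [x|i x].
    exact: (continuousM (Cn_cont cf x) (Cn_cont cg x)).
  by apply: derivableM; [exact: (Cn_derivable cf)|exact: (Cn_derivable cg)].
have cfg := IH _ _ (Cn_pred cf) (Cn_pred cg).
split => [||i]; [exact: Cn_cont cfg|exact: Cn_derivable cfg|rewrite (pdM_Cn i cf cg)].
by apply: CnD; apply: IH; try exact: Cn_pd; exact: Cn_pred.
Qed.

Lemma smooth_cst (a : R) : smooth (fun=> a).
Proof.
apply/smoothP => n; elim: n a => [|n IH] a /=; split => //;
  try exact: cst_continuous.
by move=> i; rewrite pd_cst.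
Qed.

Lemma smoothD {f g} : smooth f -> smooth g -> smooth (fun x => f x + g x).
Proof. by move=> /smoothP sf /smoothP sg; apply/smoothP => n; exact: CnD. Qed.

Lemma smoothM {f g} : smooth f -> smooth g -> smooth (fun x => f x * g x).
Proof. by move=> /smoothP sf /smoothP sg; apply/smoothP => n; exact: CnM. Qed.

Lemma smoothN {f} : smooth f -> smooth (fun x => - f x).
Proof.
move=> sf; rewrite (_ : (fun x => - f x) = fun x => -1 * f x).
  exact: smoothM (smooth_cst _) sf.
by apply/funext => x; rewrite mulN1r.
Qed.

Lemma smoothB {f g} : smooth f -> smooth g -> smooth (fun x => f x - g x).
Proof. by move=> sf sg; exact: (smoothD sf (smoothN sg)). Qed.

Lemma smoothX {f} n : smooth f -> smooth (fun x => f x ^+ n).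
Proof.
move=> sf; elim: n => [|n IH]; first exact: smooth_cst.
under eq_fun do rewrite exprS; exact: smoothM.
Qed.

Lemma pdD i {f g} : smooth f -> smooth g ->
  pd i (fun x => f x + g x) = fun x => pd i f x + pd i g x.
Proof. by move=> sf sg; exact: (pdD_Cn i (smooth_Cn 0 sf) (smooth_Cn 0 sg)). Qed.

Lemma pdM i {f g} : smooth f -> smooth g ->
  pd i (fun x => f x * g x) =
  fun x => pd i f x * g x + f x * pd i g x.
Proof. by move=> sf sg; exact: (pdM_Cn i (smooth_Cn 0 sf) (smooth_Cn 0 sg)). Qed.

Lemma pdN i {f} : smooth f ->
  pd i (fun x => - f x) = fun x => - pd i f x.
Proof.
move=> sf; apply/funext => x; rewrite !pdE /partial.
by have [_ df] := sf [::]; exact: (deriveN (df i x)).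
Qed.

Lemma pdB i {f g} : smooth f -> smooth g ->
  pd i (fun x => f x - g x) = fun x => pd i f x - pd i g x.
Proof. by move=> sf sg; rewrite (pdD i sf (smoothN sg)) (pdN i sg). Qed.

Lemma pdZ i (a : R) {f} : smooth f ->
  pd i (fun x => a * f x) = fun x => a * pd i f x.
Proof.
move=> sf; rewrite (pdM i (smooth_cst a) sf) pd_cst.
by apply/funext => x; rewrite mul0r add0r.
Qed.

Lemma line_coord x i (t : R) j :
  (x + t *: delta_mx 0 i) 0 j = x 0 j + t * (i == j)%:R.
Proof. by rewrite !mxE eqxx /= (eq_sym j). Qed.

Lemma is_derive_coord i j x :
  is_derive x (delta_mx 0 i) (fun y : V => y 0 j) ((i == j)%:R : R).
Proof.
have h : (fun t : R => t^-1 *: ((fun y : V => y 0 j) (t *: delta_mx 0 i + x) - x 0 j))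
   @ 0^' --> ((i == j)%:R : R).
  apply: (@cvg_trans _ ((fun=> (i == j)%:R : R) @ (0 : R)^')); last exact: cvg_cst.
  apply: near_eq_cvg; near=> t.
  rewrite [_ + x]addrC line_coord addrAC subrr add0r.
  rewrite /GRing.scale /= mulrA mulVf ?mul1r//.
  by near: t; exact: nbhs_dnbhs_neq.
apply: DeriveDef; first by apply/cvg_ex; eexists; exact: h.
exact: (cvg_lim _ h).
Unshelve. all: by end_near. Qed.

Lemma pd_coord i j :
  pd i (fun y : V => y 0 j) = fun=> ((i == j)%:R : R).
Proof. by apply/funext => x; rewrite !pdE /partial; case: (is_derive_coord i j x). Qed.

Lemma smooth_coord j : smooth (fun y : V => (y 0 j : R)).
Proof.
apply/smoothP; case=> [|n]; split => //; try exact: coord_continuous;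
  try by move=> i x; case: (is_derive_coord i j x).
by move=> i; rewrite pd_coord; exact: smooth_Cn (smooth_cst _).
Qed.

Lemma line_derive i f x (t : R) : (forall y, derivable f y (delta_mx 0 i)) ->
  is_derive t 1 (fun s => f (x + s *: delta_mx 0 i))
    (pd i f (x + t *: delta_mx 0 i)).
Proof.
move=> /(_ (x + t *: delta_mx 0 i)) df.
have E : (fun h : R => h^-1 *: (((fun s => f (x + s *: delta_mx 0 i)) \o shift t) (h *: 1)
     - f (x + t *: delta_mx 0 i))) =
   (fun h : R => h^-1 *: ((f \o shift (x + t *: delta_mx 0 i)) (h *: delta_mx 0 i)
     - f (x + t *: delta_mx 0 i))).
  apply/funext => h; congr (_ *: (_ - _)); rewrite /=; congr (f _).
  by rewrite [h%:A]mulr1 scalerDl addrA addrAC addrC addrA.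
by apply: DeriveDef; rewrite ?pdE /derivable /derive /partial E.
Qed.

Lemma line_cont f x (v : V) : continuous f ->
  continuous (fun s : R => f (x + s *: v)).
Proof.
move=> cf t; apply: (@cvg_comp _ _ _ (fun s : R => x + s *: v) f); last exact: cf.
by apply: cvgD; [exact: cvg_cst|apply: cvgZ; [exact: cvg_id|exact: cvg_cst]].
Qed.

Lemma line_MVT_gt0 i f x (h : R) : Cn 0 f -> 0 < h ->
  exists2 s, 0 < s < h &
   f (x + h *: delta_mx 0 i) - f x = pd i f (x + s *: delta_mx 0 i) * h.
Proof.
move=> [cf df _] h0; have := line_cont f x (delta_mx 0 i) cf.
set g := fun s => _ => cg.
have dg (t : R) : is_derive t 1 g (pd i f (x + t *: delta_mx 0 i)).
  exact: line_derive.
have g0 : f x = g 0 by rewrite /g scale0r addr0.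
have [s + E] := MVT h0 (fun t _ => dg t) (continuous_subspaceT cg).
by rewrite in_itv/= g0 -/(g h) => sh; exists s => //; rewrite E subr0.
Qed.

Lemma line_MVT i f x (h : R) : Cn 0 f ->
  exists2 s, `|s| <= `|h| &
   f (x + h *: delta_mx 0 i) - f x = pd i f (x + s *: delta_mx 0 i) * h.
Proof.
move=> cf; have [h0|h0|<-] := ltgtP 0 h.
- have [s /andP[s0 sh] E] := line_MVT_gt0 i f x h cf h0.
  by exists s => //; rewrite !gtr0_norm// ltW.
- have h0' : 0 < - h by rewrite oppr_gt0.
  have [s /andP[s0 sh] E] :=
    line_MVT_gt0 i f (x + h *: delta_mx 0 i) (- h) cf h0'.
  exists (h + s).
    rewrite (ltr0_norm h0) ler0_norm ?opprD; first by rewrite gerDl oppr_le0 ltW.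
    by rewrite addrC -lerBrDr sub0r ltW.
  apply: oppr_inj; move: E; rewrite scaleNr addrK opprB => ->.
  by rewrite mulrN -addrA -scalerDl.
- by exists 0 => //; rewrite !scale0r addr0 subrr mulr0.
Qed.

End smooth_calculus.

Section pointwise_tests.
Context {R : realType}.
Local Notation V := 'rV[R]_3.
Implicit Types (f g : V -> R) (x : V) (i j : 'I_3).

Lemma near_box (P : set V) x : (\forall y \near x, P y) ->
  exists2 d : R, 0 < d & forall y : V, (forall k, `|y 0 k - x 0 k| < d) -> P y.
Proof.
move=> /nbhs_ballP[d d0 dP]; exists d => // y yd; apply: dP; split => // i j.
by rewrite ord1 -ball_normE /= distrC.
Qed.

Lemma cont_box f x (e : R) : continuous f -> 0 < e ->
  exists2 d : R, 0 < d &
    forall y : V, (forall k, `|y 0 k - x 0 k| < d) -> `|f y - f x| < e.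
Proof.
move=> cf e0; have := cf x => /cvgrPdist_lt/(_ _ e0)/near_box[d d0 dP].
by exists d => // y /dP; rewrite distrC.
Qed.

Lemma near_line (P : set V) x i : (\forall y \near x, P y) ->
  exists2 d : R, 0 < d & forall t, `|t| < d -> P (x + t *: delta_mx 0 i).
Proof.
move=> /near_box[d d0 dP]; exists d => // t td; apply: dP => k.
rewrite line_coord [x 0 k + _]addrC addrK normrM.
by case: (i == k); rewrite ?normr1 ?mulr1// normr0 mulr0.
Qed.

(** Mean value theorem in direction [i] for the difference of [f] along two parallel lines, then in
    direction [j]. The left side is symmetric in [i] and [j] while the right side is not: this is
    what gives [pdC]. *)
Lemma square_increment f x i j (h : R) : Cn 1 f -> 0 < h ->
  exists s t : R, [/\ `|s| <= h, `|t| <= h &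
    f (x + h *: delta_mx 0 j + h *: delta_mx 0 i) - f (x + h *: delta_mx 0 i)
    - (f (x + h *: delta_mx 0 j) - f x)
    = pd j (pd i f) (x + s *: delta_mx 0 i + t *: delta_mx 0 j)
      * h * h].
Proof.
move=> cf h0; have df := Cn_derivable cf.
pose g s := f (x + h *: delta_mx 0 j + s *: delta_mx 0 i)
            - f (x + s *: delta_mx 0 i).
have cg : continuous g.
  move=> s; exact: (continuousB (line_cont f _ _ (Cn_cont cf) s)
                     (line_cont f _ _ (Cn_cont cf) s)).
have dg (s : R) : s \in `]0, h[ -> is_derive s (1 : R) g
    (pd i f (x + h *: delta_mx 0 j + s *: delta_mx 0 i)
     - pd i f (x + s *: delta_mx 0 i)).
  by move=> _; apply: is_deriveB; apply: line_derive => y; exact: df.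
have [s + E] := MVT h0 dg (continuous_subspaceT cg).
rewrite in_itv /= => /andP[s0 sh].
have [t th E'] := line_MVT j (pd i f) (x + s *: delta_mx 0 i) h
  (Cn_pd i cf).
exists s, t; split; [by rewrite gtr0_norm// ltW|by rewrite -(gtr0_norm h0)|].
move: E; rewrite /g scale0r !addr0 subr0 => ->.
by rewrite [x + _ + s *: _]addrAC E'.
Qed.

Lemma pdC i j {f} : Cn 2 f ->
  pd i (pd j f) = pd j (pd i f).
Proof.
move=> cf; apply/funext => x; apply/eqP; rewrite -subr_eq0 -normr_le0.
apply/ler_addgt0Pl => e e0; rewrite addr0.
have e2 : 0 < e / 2 by rewrite divr_gt0.
have [d1 d10 H1] := cont_box _ x _ (Cn_cont (Cn_pd i (Cn_pd j cf))) e2.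
have [d2 d20 H2] := cont_box _ x _ (Cn_cont (Cn_pd j (Cn_pd i cf))) e2.
(* The mean value points lie within [2 * h] of [x] in each coordinate, hence the 4. *)
pose h := Num.min d1 d2 / 4.
have h0 : 0 < h by rewrite divr_gt0// lt_min d10.
have hd : 2 * h < d1 /\ 2 * h < d2.
  have : Num.min d1 d2 <= d1 /\ Num.min d1 d2 <= d2 by rewrite !ge_min !lexx orbT.
  have : 0 < Num.min d1 d2 by rewrite lt_min d10.
  by rewrite /h => ? [? ?]; split; lra.
have [s [t [sh th E]]] := square_increment f x i j h (Cn_pred cf) h0.
have [s' [t' [sh' th' E']]] := square_increment f x j i h (Cn_pred cf) h0.
have bx (a b : R) (k l : 'I_3) : `|a| <= h -> `|b| <= h -> forall m,
   `|(x + a *: delta_mx 0 k + b *: delta_mx 0 l) 0 m - x 0 m| <= 2 * h.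
  move=> ah bh m; rewrite !line_coord -[x 0 m + _ + _]addrA [x 0 m + _]addrC addrK.
  rewrite (le_trans (ler_normD _ _))// mulr_natl mulr2n lerD// normrM.
    by case: (k == m); rewrite ?normr1 ?mulr1// normr0 mulr0 ltW.
  by case: (l == m); rewrite ?normr1 ?mulr1// normr0 mulr0 ltW.
have A1 := H1 _ (fun m => le_lt_trans (bx _ _ j i sh' th' m) hd.1).
have A2 := H2 _ (fun m => le_lt_trans (bx _ _ i j sh th m) hd.2).
suff EE : pd j (pd i f) (x + s *: delta_mx 0 i + t *: delta_mx 0 j) =
  pd i (pd j f) (x + s' *: delta_mx 0 j + t' *: delta_mx 0 i).
  move: A1 A2; rewrite EE; move: (pd i _ x) (pd j _ x) (pd i _ _).
  move=> a b c; rewrite !ltr_norml => /andP[p1 p2] /andP[q1 q2].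
  by rewrite ler_norml; clear -p1 p2 q1 q2; apply/andP; split; lra.
have hN0 := lt0r_neq0 h0.
move: E E'; rewrite [x + h *: delta_mx 0 j + h *: delta_mx 0 i]addrAC.
move: (f _) (f _) (f _) (f _) => a b c d; move: (pd _ _ _) (pd _ _ _).
by move=> A B; clear -hN0 => E E'; apply: (mulIf hN0); apply: (mulIf hN0);
  rewrite -E -E'; ring.
Qed.

(** If the second derivative were positive at [x], two mean value steps would make [f] increase
    strictly to the right of [x]. A single line is considered because in the half-plane argument the
    maximum is only known in two of the three directions. *)
Lemma line_max f x i (d : R) : Cn 2 f -> 0 < d ->
  (forall t : R, `|t| < d -> f (x + t *: delta_mx 0 i) <= f x) ->
  pd i f x = 0 /\ pd i (pd i f) x <= 0.
Proof.
move=> cf d0 fmax.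
pose g t := f (x + t *: delta_mx 0 i).
have dg (t : R) : is_derive t (1 : R) g (pd i f (x + t *: delta_mx 0 i)).
  by apply: line_derive => y; exact: (Cn_derivable cf).
have gx : g 0 = f x by rewrite /g scale0r addr0.
have z : (0 : R) \in `]-d, d[ by rewrite in_itv /= oppr_lt0 d0.
have g'0 : is_derive (0 : R) (1 : R) g 0.
  apply: (@derive1_at_max _ g (- d) d) => //; first by clear -d0; lra.
  by move=> t; rewrite in_itv /= -ltr_norml gx; exact: fmax.
have p0 : pd i f x = 0.
  by have [_ <-] := g'0; have [_ ->] := dg 0; rewrite scale0r addr0.
split => //; rewrite leNgt; apply/negP => p2.
have [d' d'0 dP] := near_line _ x i (cvgr_gt _ (Cn_cont (Cn_pd i (Cn_pd i cf)) x) _ p2).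
pose h := Num.min d d' / 2.
have h0 : 0 < h by rewrite divr_gt0// lt_min d0.
have hd : h < d /\ h < d'.
  have : Num.min d d' <= d /\ Num.min d d' <= d' by rewrite !ge_min !lexx orbT.
  have : 0 < Num.min d d' by rewrite lt_min d0.
  by rewrite /h => ? [? ?]; split; lra.
have [s /andP[s0 sh] E] := line_MVT_gt0 i f x h (Cn_pred (Cn_pred cf)) h0.
have [t /andP[t0 ts] E'] := line_MVT_gt0 i (pd i f) x s
   (Cn_pred (Cn_pd i cf)) s0.
have := fmax h; rewrite gtr0_norm// => /(_ hd.1).
apply/negP; rewrite -ltNge -subr_gt0 E mulr_gt0//.
move: E'.
rewrite p0.
rewrite subr0.
move=> ->.
apply: mulr_gt0; last by [].
apply: dP.
by rewrite gtr0_norm// (lt_trans ts)// (lt_trans sh)// hd.2.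
Qed.

End pointwise_tests.

(** * Rotations about the axis *)

Section rotations.
Context {R : realType}.
Local Notation V := 'rV[R]_3.
Local Notation radius := Defs.radius.
Implicit Types (f g : V -> R) (x : V) (i j : 'I_3).

Lemma vec3E (a b c : R) : [/\ vec3 a b c 0 0 = a, vec3 a b c 0 1 = b &
  vec3 a b c 0 2 = c].
Proof. by rewrite !mxE. Qed.

Lemma vec3_eta x : x = vec3 (x 0 0) (x 0 1) (x 0 2).
Proof.
apply/rowP => -[[|[|[|//]]] hi]; rewrite !mxE /=; congr (x _ _); exact/val_inj.
Qed.

Lemma vec3_shift x (a b : R) :
  vec3 (x 0 0 + a) (x 0 1 + b) (x 0 2)
  = x + b *: delta_mx 0 1 + a *: delta_mx 0 0.
Proof.
apply/rowP => -[[|[|[|//]]] hi]; rewrite !mxE /=;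
  rewrite ?mulr0 ?mulr1 ?addr0; congr (x _ _ + _) || congr (x _ _);
  exact/val_inj.
Qed.

Lemma sum3 (F : 'I_3 -> R) : \sum_(i < 3) F i = F 0 + F 1 + F 2.
Proof.
rewrite !big_ord_recl big_ord0 addr0 addrA; congr (F _ + F _ + F _); exact/val_inj.
Qed.

(* The mean value theorem on the two legs of the increment along the curve. *)
Lemma is_derive_curve f x (X Y : R -> R) (dX dY : R) : Cn 1 f ->
  is_derive (0 : R) (1 : R) X dX -> is_derive (0 : R) (1 : R) Y dY ->
  X 0 = x 0 0 -> Y 0 = x 0 1 ->
  is_derive (0 : R) (1 : R) (fun t => f (vec3 (X t) (Y t) (x 0 2)))
    (pd 0 f x * dX + pd 1 f x * dY).
Proof.
move=> cf hX hY X0 Y0.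
pose A t := X t - X 0; pose B t := Y t - Y 0.
have A0 : A t @[t --> (0 : R)] --> (0 : R).
  rewrite -[X in _ --> X](subrr (X 0)); apply: cvgB; last exact: cvg_cst.
  have [/derivable1_diffP/differentiable_continuous cZ _] := hX; exact: cZ.
have B0 : B t @[t --> (0 : R)] --> (0 : R).
  rewrite -[X in _ --> X](subrr (Y 0)); apply: cvgB; last exact: cvg_cst.
  have [/derivable1_diffP/differentiable_continuous cZ _] := hY; exact: cZ.
have /choice[s hs] t : exists s : R, `|s| <= `|A t| /\
   f (x + B t *: delta_mx 0 1 + A t *: delta_mx 0 0) - f (x + B t *: delta_mx 0 1) =
    pd 0 f (x + B t *: delta_mx 0 1 + s *: delta_mx 0 0) * A t.
  by have [s ? ?] := line_MVT 0 f (x + B t *: delta_mx 0 1) (A t) (Cn_pred cf); exists s.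
have /choice[s' hs'] t : exists s : R, `|s| <= `|B t| /\
   f (x + B t *: delta_mx 0 1) - f x =
    pd 1 f (x + s *: delta_mx 0 1) * B t.
  by have [s'' ? ?] := line_MVT 1 f x (B t) (Cn_pred cf); exists s''.
have sq (a b : R -> R) : (forall t, `|a t| <= `|b t|) ->
    b t @[t --> (0 : R)] --> (0 : R) -> a t @[t --> (0 : R)] --> (0 : R).
  move=> ab b0; apply/norm_cvg0P; apply: (@squeeze_cvgr _ _ _ _ (fun=> 0) (fun t => `|b t|)).
  - by apply: nearW => t; rewrite normr_ge0 ab.
  - exact: cvg_cst.
  - exact/norm_cvg0P.
have s0 := sq s A (fun t => (hs t).1) A0.
have s'0 := sq s' B (fun t => (hs' t).1) B0.
have E t : pd 0 f (x + B t *: delta_mx 0 1 + s t *: delta_mx 0 0) * A t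
   + pd 1 f (x + s' t *: delta_mx 0 1) * B t
   = f (vec3 (X t) (Y t) (x 0 2)) - f x.
  have [_ <-] := hs t; have [_ <-] := hs' t; rewrite -vec3_shift.
  rewrite {1}/A {1}/B -X0 -Y0 [X 0 + _]addrC subrK [Y 0 + _]addrC subrK.
  by rewrite addrA subrK.
have dq (Z : R -> R) dZ : is_derive (0 : R) (1 : R) Z dZ ->
    t^-1 * (Z t - Z 0) @[t --> (0 : R)^'] --> dZ.
  move=> [+ <-] => /cvg_ex[l hl]; rewrite /derive.
  have -> : (fun t => t^-1 * (Z t - Z 0)) = (fun h : R => h^-1 *: ((Z \o shift 0) (h *: 1) - Z 0)).
    by apply/funext => h /=; rewrite addr0 [h *: 1]mulr1.
  by rewrite (cvg_lim _ hl).
have lc (i : 'I_3) (p : R -> V) : p t @[t --> (0 : R)] --> x ->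
    pd i f (p t) @[t --> (0 : R)^'] --> pd i f x.
  move=> px; apply: (@cvg_comp _ _ _ p (pd i f)); last exact: (Cn_cont (Cn_pd i cf) x).
  by apply: cvg_trans px; apply: cvg_app; exact: nbhs_dnbhs.
have zx (a : R -> R) (v : V) : a t @[t --> (0 : R)] --> (0 : R) -> a t *: v @[t --> (0 : R)] --> (0 : V).
  by move=> a0; rewrite -(scale0r v); apply: cvgZ => //; exact: cvg_cst.
have p1 : x + B t *: delta_mx 0 1 + s t *: delta_mx 0 0 @[t --> (0 : R)] --> x.
  by rewrite -{2}[x]addr0 -[X in _ --> X]addr0; apply: cvgD; [apply: cvgD; [exact: cvg_cst|exact: zx]|exact: zx].
have p2 : x + s' t *: delta_mx 0 1 @[t --> (0 : R)] --> x.
  by rewrite -{2}[x]addr0; apply: cvgD; [exact: cvg_cst|exact: zx].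
have L := cvgD (cvgM (lc 0 _ p1) (dq _ _ hX)) (cvgM (lc 1 _ p2) (dq _ _ hY)).
set F := fun t => _.
have F0 : F 0 = f x by rewrite /F X0 Y0 -vec3_eta.
have L' : (fun h : R => h^-1 *: ((F \o shift 0) (h *: 1) - F 0)) @ (0 : R)^' -->
    pd 0 f x * dX + pd 1 f x * dY.
  apply: cvg_trans (L _ _ _); apply: near_eq_cvg; near=> t.
  rewrite [LHS](_ : _ = pd 0 f (x + B t *: delta_mx 0 1 + s t *: delta_mx 0 0) * (t^-1 * A t) + pd 1 f (x + s' t *: delta_mx 0 1) * (t^-1 * B t))//.
  by rewrite ![_ * (t^-1 * _)]mulrCA -mulrDr E F0 /= addr0 [t *: 1]mulr1.
by apply: DeriveDef; [apply/cvg_ex; eexists; exact: L'|exact: (cvg_lim _ L')].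
Unshelve. all: by end_near. Qed.

Lemma radius_gt0 x : (0 < radius x) = (x 0 0 ^+ 2 + x 0 1 ^+ 2 != 0).
Proof. by rewrite sqrtr_gt0 lt0r addr_ge0 ?sqr_ge0// andbT. Qed.

Lemma radius_sqr x : radius x ^+ 2 = x 0 0 ^+ 2 + x 0 1 ^+ 2.
Proof. by rewrite sqr_sqrtr// addr_ge0 ?sqr_ge0. Qed.

Lemma polar x : 0 < radius x -> exists theta, x = cyl (radius x) theta (x 0 2).
Proof.
move=> r0; set r := radius x in r0 *.
have rN0 := lt0r_neq0 r0.
have e1 : (x 0 0 / r) ^+ 2 + (x 0 1 / r) ^+ 2 = 1.
  by rewrite !expr_div_n -mulrDl -radius_sqr mulfV// sqrf_eq0.
have h1 : -1 <= x 0 0 / r <= 1.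
  by rewrite -ler_norml -(@ler_pXn2r _ 2) ?nnegrE// expr1n real_normK ?num_real// -e1 lerDl sqr_ge0.
have cosE : cos (acos (x 0 0 / r)) = x 0 0 / r by rewrite acosK// in_itv.
have sinE : sin (acos (x 0 0 / r)) = `|x 0 1 / r|.
  by rewrite sin_acos// -e1 addrAC subrr add0r sqrtr_sqr.
have [y0|y0] := leP 0 (x 0 1).
  exists (acos (x 0 0 / r)); rewrite /cyl cosE sinE ger0_norm; last first.
    by rewrite divr_ge0// ltW.
  by rewrite !mulrA ![r * _]mulrC !mulfK// -vec3_eta.
exists (- acos (x 0 0 / r)); rewrite /cyl cosN sinN cosE sinE ltr0_norm ?opprK.
  by rewrite !mulrA ![r * _]mulrC !mulfK// -vec3_eta.
by rewrite pmulr_llt0// invr_gt0.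
Qed.

(* The infinitesimal generator of the rotations about the axis. *)
Definition rot f x : R := x 0 0 * pd 1 f x - x 0 1 * pd 0 f x.

Lemma indep_theta_rot f x : Cn 1 f -> indep_theta f -> 0 < radius x ->
  rot f x = 0.
Proof.
move=> cf fi r0; have [th xE] := polar x r0.
set r := radius x in r0 xE.
have x0 : x 0 0 = r * cos th by rewrite xE; have [] := vec3E (r * cos th) (r * sin th) (x 0 2).
have x1 : x 0 1 = r * sin th by rewrite xE; have [] := vec3E (r * cos th) (r * sin th) (x 0 2).
have dX : is_derive (0 : R) (1 : R) (fun t => r * cos (t + th)) (- (r * sin th)).
  apply: is_derive_eq; rewrite /GRing.scale /= add0r; ring.
have dY : is_derive (0 : R) (1 : R) (fun t => r * sin (t + th)) (r * cos th).
  apply: is_derive_eq; rewrite /GRing.scale /= add0r; ring.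
have := @is_derive_curve f x _ _ _ _ cf dX dY; rewrite !add0r -x0 -x1.
move=> /(_ erefl erefl) [_ E].
rewrite (_ : (fun t => _) = fun=> f x) in E; last first.
  by apply/funext => t; rewrite [in RHS]xE; apply: fi.
move: E; rewrite derive_cst /rot => E.
by rewrite [RHS]E; ring.
Qed.

Lemma rot_eq0_indep f : Cn 1 f -> (forall x, rot f x = 0) ->
  forall r th th' z, f (cyl r th z) = f (cyl r th' z).
Proof.
move=> cf f0 r th th' z; pose F t := f (cyl r t z).
have dF (t : R) : is_derive t (1 : R) F 0.
  have dX : is_derive (0 : R) (1 : R) (fun s => r * cos (s + t)) (- (r * sin t)).
    apply: is_derive_eq; rewrite /GRing.scale /= add0r; ring.
  have dY : is_derive (0 : R) (1 : R) (fun s => r * sin (s + t)) (r * cos t).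
    apply: is_derive_eq; rewrite /GRing.scale /= add0r; ring.
  have [X0 X1 X2] := vec3E (r * cos t) (r * sin t) z.
  have := @is_derive_curve f (cyl r t z) _ _ _ _ cf dX dY.
  rewrite /cyl !add0r X0 X1 X2 => /(_ erefl erefl).
  have -> : pd 0 f (cyl r t z) * - (r * sin t) + pd 1 f (cyl r t z) * (r * cos t) = 0.
    by rewrite -[RHS](f0 (cyl r t z)) /rot /cyl X0 X1; ring.
  rewrite -/(cyl _ _ _) (_ : (fun s => f _) = fun s => F (s + t)) // => -[dG E].
  have Q : (fun h : R => h^-1 *: (((fun s => F (s + t)) \o shift 0) (h *: 1) - F (0 + t)))
    = (fun h : R => h^-1 *: ((F \o shift t) (h *: 1) - F t)).
    by apply/funext => h; rewrite /= addr0 add0r.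
  rewrite /derivable Q in dG; rewrite /derive Q in E.
  by apply: DeriveDef.
have cF : continuous F.
  by move=> t; have [/derivable1_diffP/differentiable_continuous] := dF t.
have [tt|tt|->//] := ltgtP th th'.
  have [s _] := MVT tt (fun t _ => dF t) (continuous_subspaceT cF).
  by rewrite mul0r => /subr0_eq.
have [s _] := MVT tt (fun t _ => dF t) (continuous_subspaceT cF).
by rewrite mul0r => /subr0_eq.
Qed.

(** Axial symmetry says nothing on the axis, where the frame is not defined. Identities between
    Cartesian quantities are obtained off the axis and pass to it by continuity. *)
Lemma off_axis_eq0 f : continuous f -> (forall x, 0 < radius x -> f x = 0) ->
  forall x, f x = 0.
Proof.
move=> cf f0 x; have [r0|] := boolP (0 < radius x); first exact: f0.
rewrite radius_gt0 negbK => r0.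
apply/eqP; rewrite -normr_le0; apply/ler_addgt0Pl => e e0; rewrite addr0.
have [d d0 dP] := cont_box _ x _ cf e0.
pose y := x + (d / 2) *: delta_mx 0 0.
have yd k : `|y 0 k - x 0 k| < d.
  rewrite line_coord [x 0 k + _]addrC addrK normrM gtr0_norm ?divr_gt0//.
  by case: (_ == _); rewrite ?normr0 ?mulr0// normr1 mulr1 ltr_pdivrMr// mulr_natr mulr2n ltrDl.
rewrite ltW// -normrN -sub0r -(f0 y); first exact: dP.
move: r0; rewrite paddr_eq0 ?sqr_ge0// !sqrf_eq0 => /andP[/eqP x0 /eqP x1].
rewrite radius_gt0 !line_coord x0 x1 /= mulr1 mulr0 !add0r expr0n addr0 sqrf_eq0.
by rewrite mulf_neq0// gt_eqF// invr_gt0.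
Qed.

Lemma partials_eq0_cst f : Cn 0 f -> (forall i x, pd i f x = 0) ->
  forall x, f x = f 0.
Proof.
move=> cf f0 x.
have st i y (t : R) : f (y + t *: delta_mx 0 i) = f y.
  by have [s _] := line_MVT i f y t cf; rewrite f0 mul0r => /subr0_eq.
have -> : x = 0 + x 0 0 *: delta_mx 0 0 + x 0 1 *: delta_mx 0 1 + x 0 2 *: delta_mx 0 2.
  apply/rowP => -[[|[|[|//]]] hi]; rewrite !mxE /= ?mulr0 ?mulr1 ?addr0 ?add0r;
  congr (x _ _); exact/val_inj.
by rewrite !st.
Qed.
End rotations.

(** * Axially symmetric flows *)

Ltac smth := cbv beta; lazymatch goal with
  | |- smooth (fun x => GRing.add (@?f x) (@?g x)) => refine (smoothD (f:=f) (g:=g) _ _); smth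
  | |- smooth (fun x => GRing.mul (@?f x) (@?g x)) => refine (smoothM (f:=f) (g:=g) _ _); smth
  | |- smooth (fun x => GRing.opp (@?f x)) => refine (smoothN (f:=f) _); smth
  | |- smooth (fun x => GRing.exp (@?f x) ?n) => refine (smoothX (f:=f) n _); smth
  | |- smooth (fun x => fun_of_matrix x _ _) => exact: smooth_coord
  | |- smooth (fun _ => ?a) => exact: (smooth_cst a)
  | |- smooth (pd _ _) => apply: smooth_pd; smth
  | |- smooth (fun x => pd ?i ?f x) => refine (smooth_pd (i:=i) (f:=f) _); smth
  | H : smooth ?f |- smooth ?f => exact H
  | |- smooth (fun x => ?f x) => change (smooth f); smth
  | |- _ => idtac
  end.

(** * Commutation of differential operators with rotations *)

Section differential_operators.
Context {R : realType}.
Local Notation V := 'rV[R]_3.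
Implicit Types (f g : V -> R) (x : V) (i j : 'I_3).

Definition lap f x : R :=
  pd 0 (pd 0 f) x + pd 1 (pd 1 f) x
  + pd 2 (pd 2 f) x.

Definition dotgrad f g x : R :=
  pd 0 f x * pd 0 g x + pd 1 f x * pd 1 g x
  + pd 2 f x * pd 2 g x.

Lemma pd_comm i j f : smooth f ->
  pd i (pd j f) = pd j (pd i f).
Proof. by move=> sf; exact: pdC (smooth_Cn 2 sf). Qed.

Lemma smooth_rot f : smooth f -> smooth (rot f).
Proof. by move=> sf; rewrite /rot; smth. Qed.

Lemma smooth_lap f : smooth f -> smooth (lap f).
Proof. by move=> sf; rewrite /lap; smth. Qed.

Lemma pd_rot i f : smooth f ->
  pd i (rot f) = fun x => rot (pd i f) x
    + (0 == i)%:R * pd 1 f x - (1 == i)%:R * pd 0 f x.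
Proof.
move=> sf; rewrite /rot (pdB i); try smth.
rewrite !(pdM i) ?pd_coord; try smth.
apply/funext => x; rewrite (pd_comm i 1)// (pd_comm i 0)//.
rewrite ![(i == _)]eq_sym.
move: (pd _ _ _) (pd _ _ _) (pd _ _ _) (pd _ _ _) => *.
ring.
Qed.

Lemma rotD f g x : smooth f -> smooth g ->
  rot (fun y => f y + g y) x = rot f x + rot g x.
Proof. by move=> sf sg; rewrite /rot !(pdD _ sf sg); ring. Qed.

Lemma rotM f g x : smooth f -> smooth g ->
  rot (fun y => f y * g y) x = rot f x * g x + f x * rot g x.
Proof. by move=> sf sg; rewrite /rot !(pdM _ sf sg); ring. Qed.

Lemma lapD f g x : smooth f -> smooth g ->
  lap (fun y => f y + g y) x = lap f x + lap g x.
Proof.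
move=> sf sg; rewrite /lap !(pdD _ sf sg).
rewrite !(pdD _ (smooth_pd sf) (smooth_pd sg)); ring.
Qed.

Lemma lapM f g x : smooth f -> smooth g ->
  lap (fun y => f y * g y) x =
  lap f x * g x + 2 * dotgrad f g x + f x * lap g x.
Proof.
move=> sf sg; rewrite /lap !(pdM _ sf sg).
have E i : pd i (fun y => pd i f y * g y + f y * pd i g y) x
  = pd i (pd i f) x * g x + 2 * (pd i f x * pd i g x)
    + f x * pd i (pd i g) x.
  rewrite (pdD i (smoothM (smooth_pd sf) sg)
             (smoothM sf (smooth_pd sg))).
  rewrite (pdM i (smooth_pd sf) sg) (pdM i sf (smooth_pd sg)).
  ring.
rewrite !E /dotgrad; ring.
Qed.


Lemma rotN f x : smooth f -> rot (fun y => - f y) x = - rot f x.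
Proof. by move=> sf; rewrite /rot !(pdN _ sf); ring. Qed.

Lemma lapN f x : smooth f -> lap (fun y => - f y) x = - lap f x.
Proof.
move=> sf; rewrite /lap !(pdN _ sf) !(pdN _ (smooth_pd sf)); ring.
Qed.

Lemma rot_pd i f x : smooth f ->
  rot (pd i f) x = pd i (rot f) x
    - (0 == i)%:R * pd 1 f x + (1 == i)%:R * pd 0 f x.
Proof. by move=> sf; rewrite pd_rot//; ring. Qed.

Lemma rot_pd2 i f x : smooth f ->
  rot (pd i (pd i f)) x = pd i (pd i (rot f)) x
    - 2 * ((0 == i)%:R * pd 1 (pd i f) x) + 2 * ((1 == i)%:R * pd 0 (pd i f) x).
Proof.
move=> sf; have sr := smooth_rot _ sf.
rewrite rot_pd; last smth.
rewrite (_ : rot (pd i f) = fun y => pd i (rot f) y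
    + ((- (0 == i)%:R) * pd 1 f y + (1 == i)%:R * pd 0 f y)); last first.
  by apply/funext => y; rewrite rot_pd//; ring.
have s0 : smooth (fun y => (- (0 == i)%:R) * pd 1 f y) by smth.
have s1 : smooth (fun y => (1 == i)%:R * pd 0 f y) by smth.
rewrite (pdD i (smooth_pd sr) (smoothD s0 s1)) (pdD i s0 s1).
rewrite (pdZ i _ (smooth_pd sf)) (pdZ i _ (smooth_pd sf)).
rewrite (pd_comm i 1)// (pd_comm i 0)//; ring.
Qed.

(** The commutators of [rot] with the second derivatives in directions 0 and 1 are opposite
    multiples of the mixed derivative, so they cancel in the sum. *)
Lemma rot_lap f x : smooth f -> rot (lap f) x = lap (rot f) x.
Proof.
move=> sf; rewrite {1}/lap rotD; [|smth|smth].
rewrite rotD; [|smth|smth].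
rewrite !rot_pd2// (pd_comm 1 0)// /lap /=; ring.
Qed.

End differential_operators.

Section axisymmetric_flow.
Context {R : realType}.
Local Notation V := 'rV[R]_3.
Implicit Types (f g : V -> R) (x : V) (i j : 'I_3).

Definition advect (a b c : V -> R) f x : R :=
  a x * pd 0 f x + b x * pd 1 f x + c x * pd 2 f x.

(* [a], [b], [c] are the Cartesian components of the velocity; axial symmetry is
   stated through the generator [rot] of the rotations. *)
Record axiflow (a b c p : V -> R) : Prop := Axiflow {
  flow_smooth : [/\ smooth a, smooth b, smooth c & smooth p];
  flow_div : forall x, pd 0 a x + pd 1 b x + pd 2 c x = 0;
  flow_NS : forall x, [/\ advect a b c a x + pd 0 p x = lap a x,
    advect a b c b x + pd 1 p x = lap b x & advect a b c c x + pd 2 p x = lap c x];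
  flow_rot : forall x, [/\ rot a x = - b x, rot b x = a x & rot c x = 0] }.

Lemma ord3E (i : 'I_3) : [\/ i = 0, i = 1 | i = 2].
Proof.
by case: i => -[|[|[|//]]] hi; [constructor 1|constructor 2|constructor 3];
  exact/val_inj.
Qed.

Variables a b c p : V -> R.
Hypothesis H : axiflow a b c p.
Local Notation conv := (advect a b c).

Lemma smooth_conv f : smooth f -> smooth (conv f).
Proof. by have [[sa sb sc _] _ _ _] := H => sf; rewrite /advect; smth. Qed.

(** Both (a, b) and the horizontal gradient of [f] turn with the rotation; the terms this produces
    cancel in their scalar product. *)
Lemma rot_conv f x : smooth f -> rot (conv f) x = conv (rot f) x.
Proof.
have [[sa sb sc _] _ _ Hr] := H; have [rota rotb rotc] := Hr x; move=> sf.
clear Hr; rewrite {1}/advect.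
have sM g i : smooth g -> smooth (fun y => g y * pd i f y) by move=> ?; smth.
rewrite !rotD; try smth.
rewrite !rotM; try smth.
rewrite !rot_pd// rota rotb rotc /advect /=; ring.
Qed.

(** Axial symmetry is assumed of the velocity only; the pressure inherits it. The momentum equation
    expresses grad p through the velocity and commutes with rotations, so [rot p] has zero gradient;
    it is therefore constant, and [rot] vanishes at the origin. *)
Lemma rot_p x : rot p x = 0.
Proof.
have [[sa sb sc sp] _ NS Hr] := H.
have E0 : pd 0 p = fun y => lap a y + - conv a y.
  by apply/funext => y; have [<- _ _] := NS y; ring.
have E1 : pd 1 p = fun y => lap b y + - conv b y.
  by apply/funext => y; have [_ <- _] := NS y; ring.
have E2 : pd 2 p = fun y => lap c y + - conv c y.
  by apply/funext => y; have [_ _ <-] := NS y; ring.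
have ra : rot a = fun y => - b y by apply/funext => y; have [] := Hr y.
have rb : rot b = a by apply/funext => y; have [] := Hr y.
have rc : rot c = fun=> 0 by apply/funext => y; have [] := Hr y.
clear NS Hr.
have rr f x' : smooth f ->
    rot (fun y => lap f y + - conv f y) x' = lap (rot f) x' - conv (rot f) x'.
  move=> sf; have sl := smooth_lap _ sf; have sv := smooth_conv _ sf.
  by rewrite (rotD _ _ _ sl (smoothN sv)) (rotN _ _ sv) rot_lap// rot_conv.
have cN f y : smooth f -> conv (fun z => - f z) y = - conv f y.
  by move=> sf; rewrite /advect !(pdN _ sf); ring.
rewrite (partials_eq0_cst _ (smooth_Cn 0 (smooth_rot _ sp))).
  by rewrite /rot !mxE; ring.
move=> i y; rewrite pd_rot//; have [->|->|->] := ord3E i.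
- by rewrite {1}E0 E1 rr// ra lapN// cN//=; ring.
- by rewrite {1}E1 E0 rr// rb /=; ring.
- rewrite E2 rr// rc /= /lap /advect !pd_cst; ring.
Qed.

(** The function Gamma = r u_theta in Cartesian form, smooth across the axis. *)
Definition swirl x : R := x 0 0 * b x - x 0 1 * a x.

Definition vort0 x : R := pd 1 c x - pd 2 b x.
Definition vort1 x : R := pd 2 a x - pd 0 c x.
Definition vort2 x : R := pd 0 b x - pd 1 a x.

Lemma smooth_swirl : smooth swirl.
Proof. by have [[sa sb _ _] _ _ _] := H; rewrite /swirl; smth. Qed.

Lemma smooth_vort : [/\ smooth vort0, smooth vort1 & smooth vort2].
Proof.
have [[sa sb sc _] _ _ _] := H.
by rewrite /vort0 /vort1 /vort2; split; smth.
Qed.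

Lemma pd_swirl i : pd i swirl = fun x =>
  (i == 0)%:R * b x + x 0 0 * pd i b x
  - ((i == 1)%:R * a x + x 0 1 * pd i a x).
Proof.
have [[sa sb _ _] _ _ _] := H; rewrite /swirl pdB; [|smth|smth].
by rewrite !pdM; try smth; rewrite !pd_coord.
Qed.

(** The combination of the first two momentum equations with weights - x_2 and x_1, in which the
    pressure contributes [rot p = 0]. The term [2 * vort2] stands for (2/r) d_r Gamma, without a
    singular coefficient. *)
Lemma swirl_eq x : lap swirl x - 2 * vort2 x = conv swirl x.
Proof.
have [[sa sb sc sp] _ NS _] := H; have [NSa NSb _] := NS x.
have rp := rot_p x; clear NS.
have E : swirl = fun y => y 0 0 * b y + - (y 0 1 * a y) by [].
rewrite {1}E lapD; [|smth|smth].
rewrite lapN; last smth.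
rewrite !lapM; try smth.
have l0 j : lap (fun y : V => (y 0 j : R)) x = 0.
  by rewrite /lap !pd_coord !pd_cst !addr0.
rewrite !l0 -NSa -NSb /dotgrad !pd_coord /advect !pd_swirl /vort2 /=.
by apply: subr0_eq; rewrite -[RHS]rp /rot; ring.
Qed.

(** The relation omega_z = (1/r) d_r (r u_theta), cleared of denominators. It recovers the singular
    term of [swirl_eq] off the axis. *)
Lemma swirl_vort2 x :
  (x 0 0 ^+ 2 + x 0 1 ^+ 2) * vort2 x
  = x 0 0 * pd 0 swirl x + x 0 1 * pd 1 swirl x.
Proof.
have [_ _ _ Hr] := H; have [] := Hr x; rewrite !pd_swirl /vort2 /rot /=.
move=> E1 E2 _; apply: subr0_eq.
have -> : b x = - (x 0 0 * pd 1 a x - x 0 1 * pd 0 a x) by rewrite E1 opprK.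
rewrite -E2; ring.
Qed.

(** The identity lap u = - curl (curl u) for a divergence-free field. *)
Lemma lap_curl x : [/\ lap a x = pd 2 vort1 x - pd 1 vort2 x,
  lap b x = pd 0 vort2 x - pd 2 vort0 x & lap c x = pd 1 vort0 x - pd 0 vort1 x].
Proof.
have [[sa sb sc sp] Hd _ _] := H.
have D i : pd i (pd 0 a) x + pd i (pd 1 b) x + pd i (pd 2 c) x = 0.
  have -> : pd i (pd 0 a) x + pd i (pd 1 b) x + pd i (pd 2 c) x =
    pd i (fun y => pd 0 a y + pd 1 b y + pd 2 c y) x.
    by rewrite pdD; [|smth|smth]; rewrite pdD; [|smth|smth].
  by rewrite (_ : (fun y => _) = fun=> 0) ?pd_cst//; apply/funext.
rewrite /lap /vort0 /vort1 /vort2 !pdB; try smth.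
split; apply: subr0_eq.
- by rewrite -[RHS](D 0) (pd_comm 1 0)// (pd_comm 2 0)//; ring.
- by rewrite -[RHS](D 1) (pd_comm 1 0)// (pd_comm 2 1)//; ring.
- by rewrite -[RHS](D 2) (pd_comm 2 0)// (pd_comm 2 1)//; ring.
Qed.

(* The curl of the momentum equation: the pressure drops out because second
   derivatives commute. *)
Lemma vort_eq x : 
 [/\ lap vort0 x = conv vort0 x - (vort0 x * pd 0 a x + vort1 x * pd 1 a x + vort2 x * pd 2 a x),
    lap vort1 x = conv vort1 x - (vort0 x * pd 0 b x + vort1 x * pd 1 b x + vort2 x * pd 2 b x)
 & lap vort2 x = conv vort2 x - (vort0 x * pd 0 c x + vort1 x * pd 1 c x + vort2 x * pd 2 c x)].
Proof.
have [[sa sb sc sp] Hd NS _] := H; have Hdx := Hd x.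
have sA f : smooth f -> smooth (conv f) by exact: smooth_conv.
have E0 : pd 0 p = fun y => lap a y - conv a y.
  by apply/funext => y; have [<- _ _] := NS y; ring.
have E1 : pd 1 p = fun y => lap b y - conv b y.
  by apply/funext => y; have [_ <- _] := NS y; ring.
have E2 : pd 2 p = fun y => lap c y - conv c y.
  by apply/funext => y; have [_ _ <-] := NS y; ring.
have C i j : pd i (pd j p) x = pd j (pd i p) x by rewrite pd_comm.
clear NS Hd.
have lB f g : smooth f -> smooth g -> lap (fun y => f y - g y) x = lap f x - lap g x.
  by move=> sf sg; rewrite (lapD _ _ _ sf (smoothN sg)) (lapN _ _ sg).
have pl i f : smooth f -> pd i (lap f) x = lap (pd i f) x.
  move=> sf; rewrite /lap !pdD; try smth.
  by rewrite ![pd i (pd _ (pd _ f))]pd_comm ?[pd i (pd _ f)]pd_comm; try smth.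
have pc i f : smooth f -> pd i (conv f) x = conv (pd i f) x
    + (pd i a x * pd 0 f x + pd i b x * pd 1 f x + pd i c x * pd 2 f x).
  move=> sf; rewrite /advect !pdD; try smth.
  rewrite !pdM; try smth.
  by rewrite (pd_comm i 0)// (pd_comm i 1)// (pd_comm i 2)//; ring.
have cB f g : smooth f -> smooth g -> conv (fun y => f y - g y) x = conv f x - conv g x.
  by move=> sf sg; rewrite /advect !(pdB _ sf sg); ring.
have ex i f : smooth f -> pd i (fun y => lap f y - conv f y) x = lap (pd i f) x
   - (conv (pd i f) x + (pd i a x * pd 0 f x + pd i b x * pd 1 f x + pd i c x * pd 2 f x)).
  move=> sf; have sl := smooth_lap _ sf; have sv := sA _ sf.
  by rewrite (pdB _ sl sv) pl// pc.
rewrite /vort0 /vort1 /vort2 !lB ?cB; try smth.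
have C21 := C 2 1; have C20 := C 2 0; have C10 := C 1 0.
move: C21 C20 C10; rewrite {}E0 {}E1 {}E2 !ex// => C21 C20 C10.
rewrite /advect; clear -Hdx C21 C20 C10.
(* The curl of the convection term produces omega_i div u; these products are supplied so that what
   remains is linear arithmetic. *)
have D0 := congr1 (fun t => (pd 1 c x - pd 2 b x) * t) Hdx.
have D1 := congr1 (fun t => (pd 2 a x - pd 0 c x) * t) Hdx.
have D2 := congr1 (fun t => (pd 0 b x - pd 1 a x) * t) Hdx.
rewrite /advect in C21 C20 C10; rewrite /= in D0 D1 D2.
by split; lra.
Qed.

End axisymmetric_flow.

Arguments vort0 {R} b c x.
Arguments vort1 {R} a c x.
Arguments vort2 {R} a b x.

(** * Vorticity of a flow without swirl *)

Section no_swirl.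
Context {R : realType}.
Local Notation V := 'rV[R]_3.
Implicit Types (f g : V -> R) (x : V) (i j : 'I_3).
Variables a b c p : V -> R.
Hypothesis H : axiflow a b c p.
Hypothesis S0 : forall x, swirl a b x = 0.
Local Notation conv := (advect a b c).
Local Notation v0 := (vort0 b c).
Local Notation v1 := (vort1 a c).

Let swirl0 : swirl a b = fun=> 0. Proof. exact/funext. Qed.

Lemma no_swirl_vort2 x : vort2 a b x = 0.
Proof.
have := swirl_eq _ _ _ _ H x; rewrite swirl0 /lap /advect !pd_cst => E.
by apply/eqP; rewrite -(mulrI_eq0 _ (lregP (lt0r_neq0 (ltr0n R 2)))); apply/eqP; lra.
Qed.

(** The left side is [rot c] minus the derivative of the swirl along the axis, and both vanish. With
    [no_swirl_vort2], only the azimuthal component of the vorticity remains. *)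
Lemma vort_tangential x : x 0 0 * v0 x + x 0 1 * v1 x = 0.
Proof.
have [_ _ _ /(_ x)[_ _ rc]] := H.
have := pd_swirl _ _ _ _ H 2; rewrite swirl0 pd_cst => /(congr1 (@^~ x)) /= E.
move: rc E; rewrite /rot /vort0 /vort1 => rc E; clear -rc E; lra.
Qed.

Lemma rot_vort x : rot v0 x = - v1 x /\ rot v1 x = v0 x.
Proof.
have [[sa sb sc sp] _ _ Hr] := H.
have ra : rot a = fun y => - b y by apply/funext => y; have [] := Hr y.
have rb : rot b = a by apply/funext => y; have [] := Hr y.
have rc : rot c = fun=> 0 by apply/funext => y; have [] := Hr y.
have rB f g : smooth f -> smooth g -> rot (fun y => f y - g y) x = rot f x - rot g x.
  by move=> sf sg; rewrite (rotD _ _ _ sf (smoothN sg)) (rotN _ _ sg).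
rewrite /vort0 /vort1 !rB; try smth.
rewrite !rot_pd// ra rb rc !pd_cst (pdN 2 sb) /=; split; ring.
Qed.

Definition stretch0 x : R := v0 x * pd 0 a x + v1 x * pd 1 a x.
Definition stretch1 x : R := v0 x * pd 0 b x + v1 x * pd 1 b x.

Lemma no_swirl_vort_eq x :
  lap v0 x = conv v0 x - stretch0 x /\ lap v1 x = conv v1 x - stretch1 x.
Proof.
have [-> -> _] := vort_eq _ _ _ _ H x.
by rewrite no_swirl_vort2 !mul0r !addr0.
Qed.

Lemma no_swirl_lap_curl x :
  [/\ lap a x = pd 2 v1 x, lap b x = - pd 2 v0 x &
   lap c x = pd 1 v0 x - pd 0 v1 x].
Proof.
have [-> -> ->] := lap_curl _ _ _ _ H x.
have -> : vort2 a b = fun=> 0 by apply/funext => y; exact: no_swirl_vort2.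
by rewrite !pd_cst subr0 sub0r.
Qed.

(** With W = r omega_theta, the stretching vector is W / r^2 times (- b, a): the vorticity is
    azimuthal, and the azimuthal derivatives of the velocity are read off from [rot a = - b] and
    [rot b = a], so that no derivative of u is left. By [rot_vort], in the same way, |omega| = |rot
    omega| <= r |grad omega|. *)
Lemma stretch_bound x : stretch0 x ^+ 2 + stretch1 x ^+ 2 <=
  (a x ^+ 2 + b x ^+ 2) * (dotgrad v0 v0 x + dotgrad v1 v1 x).
Proof.
have [_ _ _ /(_ x)[ra rb _]] := H; have [r0 r1] := rot_vort x.
have t := vort_tangential x.
have g0 f : 0 <= dotgrad f f x by rewrite /dotgrad -!expr2 !addr_ge0 ?sqr_ge0.
have g1 f : rot f x ^+ 2 <= (x 0 0 ^+ 2 + x 0 1 ^+ 2) * dotgrad f f x.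
  rewrite /rot /dotgrad -subr_ge0.
  have -> : (x 0 0 ^+ 2 + x 0 1 ^+ 2) * (pd 0 f x * pd 0 f x + pd 1 f x * pd 1 f x
     + pd 2 f x * pd 2 f x) - (x 0 0 * pd 1 f x - x 0 1 * pd 0 f x) ^+ 2 =
    (x 0 0 * pd 0 f x + x 0 1 * pd 1 f x) ^+ 2 + (x 0 0 ^+ 2 + x 0 1 ^+ 2) * pd 2 f x ^+ 2.
    by ring.
  by apply: addr_ge0; rewrite ?sqr_ge0//; apply: mulr_ge0; rewrite ?addr_ge0 ?sqr_ge0.
have N0 := g1 v0; have N1 := g1 v1.
rewrite r0 r1 in N0 N1.
have := g0 v0; have := g0 v1; move: N0 N1.
move: (dotgrad _ _ x) (dotgrad _ _ x) => G0 G1 N0 N1 G10 G00.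
(* On the axis [rot] vanishes, hence by [rot_vort] so does the vorticity. *)
have [r20|r20] := eqVneq (x 0 0 ^+ 2 + x 0 1 ^+ 2) 0.
  rewrite r20 !mul0r in N0 N1.
  have v0x : v0 x = 0.
    by apply/eqP; rewrite -sqrf_eq0 eq_le N1 sqr_ge0.
  have v1x : v1 x = 0.
    by apply/eqP; rewrite -oppr_eq0 -sqrf_eq0 eq_le N0 sqr_ge0.
  rewrite /stretch0 /stretch1 v0x v1x !mul0r addr0 expr0n addr0.
  by rewrite mulr_ge0 ?addr_ge0 ?sqr_ge0.
set r2 := _ + _ in r20 N0 N1 *.
have r2p : 0 < r2 by rewrite lt0r r20 addr_ge0 ?sqr_ge0.
pose W := x 0 0 * v1 x - x 0 1 * v0 x.
have E0 : r2 * stretch0 x = - W * b x.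
  rewrite mulNr -mulrN -ra /rot /stretch0 /W /r2; apply: subr0_eq.
  by rewrite -[RHS](mulr0 (x 0 0 * pd 0 a x + x 0 1 * pd 1 a x)) -t; ring.
have E1 : r2 * stretch1 x = W * a x.
  rewrite -rb /rot /stretch1 /W /r2; apply: subr0_eq.
  by rewrite -[RHS](mulr0 (x 0 0 * pd 0 b x + x 0 1 * pd 1 b x)) -t; ring.
have W2 : W ^+ 2 <= r2 * (v0 x ^+ 2 + v1 x ^+ 2).
  rewrite -subr_ge0 (_ : _ - _ = (x 0 0 * v0 x + x 0 1 * v1 x) ^+ 2) ?sqr_ge0//.
  by rewrite /W /r2; ring.
rewrite -(ler_pM2l (exprn_gt0 2 r2p)).
have -> : r2 ^+ 2 * (stretch0 x ^+ 2 + stretch1 x ^+ 2) = W ^+ 2 * (a x ^+ 2 + b x ^+ 2).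
  by rewrite mulrDr -!exprMn E0 E1; ring.
rewrite mulrCA [W ^+ 2 * _]mulrC ler_wpM2l ?addr_ge0 ?sqr_ge0//.
apply: (le_trans W2); rewrite [r2 ^+ 2]expr2 -mulrA (ler_wpM2l (ltW r2p))// mulrDr.
by have := lerD N0 N1; rewrite sqrrN [v1 x ^+ 2 + _]addrC.
Qed.

(** On this half-plane [v1] is omega_theta. The second derivative across the half-plane is
    eliminated by rot (rot v1) = - v1. The right side is arranged around v1 - r d_r v1 = - r^2 d_r
    (v1 / r), which shows that the equation for v1 / r has no term of order zero; the factor r^2
    avoids divisions. *)
Lemma halfplane_eq x : x 0 1 = 0 -> 0 < x 0 0 ->
  x 0 0 ^+ 2 * (pd 0 (pd 0 v1) x + pd 2 (pd 2 v1) x) =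
  (v1 x - x 0 0 * pd 0 v1 x) * (1 - x 0 0 * a x)
  + x 0 0 ^+ 2 * (c x * pd 2 v1 x).
Proof.
move=> y0 x0; have xN0 := lt0r_neq0 x0.
have [[sa sb sc sp] _ _ /(_ x)[_ rb _]] := H.
have [sv0 sv1 _] := smooth_vort _ _ _ _ H.
have [_ E] := no_swirl_vort_eq x.
have v00 : v0 x = 0.
  have := vort_tangential x; rewrite y0 mul0r addr0 => /eqP.
  by rewrite mulf_eq0 (negbTE xN0) => /eqP.
have b0 : b x = 0.
  have := S0 x; rewrite /swirl y0 mul0r subr0 => /eqP.
  by rewrite mulf_eq0 (negbTE xN0) => /eqP.
have r1 : rot v1 = v0 by apply/funext => y; have [] := rot_vort y.
have [rr _] := rot_vort x; rewrite -{1}r1 {1}/rot pd_rot// /rot y0 in rr.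
rewrite /= in rr; rewrite /rot y0 mul0r subr0 in rb.
rewrite /lap /advect /stretch1 v00 b0 in E.
have {}rr : x 0 0 * (x 0 0 * pd 1 (pd 1 v1) x - pd 0 v1 x) = - v1 x.
  by rewrite -rr; ring.
transitivity (x 0 0 ^+ 2 * (pd 0 (pd 0 v1) x + pd 1 (pd 1 v1) x + pd 2 (pd 2 v1) x)
  - x 0 0 * (x 0 0 * pd 1 (pd 1 v1) x - pd 0 v1 x) - x 0 0 * pd 0 v1 x).
  by ring.
by rewrite E rr -rb; ring.
Qed.

End no_swirl.

(** * Maximum principles *)

Section maximum_principles.
Context {R : realType}.
Local Notation V := 'rV[R]_3.
Implicit Types (f g : V -> R) (x : V) (i j : 'I_3).

Definition sqn x : R := x 0 0 ^+ 2 + x 0 1 ^+ 2 + x 0 2 ^+ 2.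

Lemma smooth_sqn : smooth sqn.
Proof. by rewrite /sqn; smth. Qed.

Lemma enormE x : enorm x = Num.sqrt (sqn x).
Proof. by rewrite /enorm /dot3 sum3 -!expr2. Qed.

Definition vanishes f : Prop := forall e : R, 0 < e ->
  exists2 M, 0 < M & forall x, M < sqn x -> `|f x| < e.

Lemma cvg_vanishes f : f x @[x --> at_infty R] --> (0 : R) -> vanishes f.
Proof.
move=> /cvgrPdist_lt fM e /fM [M _ MP]; exists (`|M| ^+ 2 + 1).
  by rewrite ltr_wpDl ?sqr_ge0.
move=> x Mx; have := MP x; rewrite /= sub0r normrN; apply.
rewrite enormE (le_lt_trans (ler_norm M))//.
rewrite -[X in X < _](ger0_norm (normr_ge0 M)) -sqrtr_sqr.
have M1 : `|M| ^+ 2 < sqn x by rewrite (lt_trans _ Mx)// ltrDl.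
by rewrite ltr_sqrt// (le_lt_trans _ M1)// sqr_ge0.
Qed.

Lemma vanishesN f : vanishes f -> vanishes (fun x => - f x).
Proof.
by move=> vf e /vf[M M0 MP]; exists M => // x /MP; rewrite normrN.
Qed.

Lemma coord_sqn x i : x 0 i ^+ 2 <= sqn x.
Proof.
have h (a b c : R) : [/\ a ^+ 2 <= a ^+ 2 + b ^+ 2 + c ^+ 2,
    b ^+ 2 <= a ^+ 2 + b ^+ 2 + c ^+ 2 & c ^+ 2 <= a ^+ 2 + b ^+ 2 + c ^+ 2].
  by have := sqr_ge0 a; have := sqr_ge0 b; have := sqr_ge0 c => ? ? ?; split; lra.
by rewrite /sqn; have [h0 h1 h2] := h (x 0 0) (x 0 1) (x 0 2);
  have [->|->|->] := ord3E i.
Qed.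

Lemma closed_sublevel f (M : R) : continuous f -> closed [set x | f x <= M].
Proof.
move=> cf; apply: (@closed_comp _ _ f [set y | y <= M]); last exact: closed_le.
by move=> x _; exact: cf.
Qed.

Lemma compact_sqn (M : R) : compact [set x | sqn x <= M].
Proof.
have cB := @rV_compact R 3 (fun=> `[- (`|M| + 1), `|M| + 1]%classic)
  (fun=> @segment_compact R _ _).
apply: (subclosed_compact _ cB).
  by apply: closed_sublevel; exact: smooth_cont smooth_sqn.
move=> x /= xM i; rewrite in_itv /= -ler_norml.
have h : x 0 i ^+ 2 <= `|M| by rewrite (le_trans (coord_sqn x i))// (le_trans xM)// ler_norm.
rewrite leNgt; apply/negP => h'.
have {}h : `|x 0 i| ^+ 2 <= `|M| by rewrite real_normK ?num_real.
have M0 := normr_ge0 M; clear -h h' M0; move: h h' M0; move: `|M| `|x 0 i| => A B *; nra.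
Qed.

Lemma compact_max f (K : set V) x : compact K -> K x ->
  (forall y, K y -> {for y, continuous f}) ->
  exists2 c, K c & forall y, K y -> f y <= f c.
Proof.
move=> cK Kx cf.
have [|c /set_mem Kc fc] := @compact_EVT_max _ _ f K (ex_intro _ _ Kx) cK.
  by apply: continuous_in_subspaceT => y /set_mem; exact: cf.
by exists c => // y Ky; apply: fc; exact: mem_set.
Qed.

Lemma vanishing_bounded f : continuous f -> vanishes f ->
  exists2 U, 0 < U & forall x, `|f x| <= U.
Proof.
move=> cf /(_ 1 ltr01)[M M0 MP].
have [|y _|c Kc fc] := compact_max (fun x => `|f x|) _ 0 (compact_sqn M).
- by rewrite /= /sqn !mxE expr0n !addr0 ltW.
- apply: (@continuous_comp _ _ _ f); [exact: cf|exact: norm_continuous].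
exists (`|f c| + 1); first by rewrite ltr_wpDl.
move=> x; have [xM|xM] := leP (sqn x) M.
  by rewrite (le_trans (fc x xM))// lerDl.
by rewrite (le_trans (ltW (MP x xM)))// lerDr.
Qed.

Lemma local_max f x : smooth f -> (\forall y \near x, f y <= f x) ->
  forall i, pd i f x = 0 /\ pd i (pd i f) x <= 0.
Proof.
move=> sf fx i; have [d d0 dP] := near_line _ _ i fx.
exact: (line_max _ _ _ d (smooth_Cn 2 sf)).
Qed.

Lemma lap_local_max f x : smooth f -> (\forall y \near x, f y <= f x) ->
  lap f x <= 0.
Proof.
move=> sf /(local_max _ _ sf) fx.
have [[_ h0] [_ h1] [_ h2]] := And3 (fx 0) (fx 1) (fx 2).
by rewrite /lap; clear -h0 h1 h2; lra.
Qed.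

(** The barrier [g] may be unbounded, since only its values in a ball matter. Where [sqn] exceeds M,
    [f] stays below f(x0)/2; the maximum is taken over [sqn <= M + 1], so that a point with f >
    f(x0)/2 is interior. *)
Lemma perturbed_max f g x0 : continuous f -> continuous g -> vanishes f ->
  (forall x, 0 <= g x) -> 0 < f x0 ->
  exists (d : R) c, [/\ 0 < d, 0 < f c &
    \forall y \near c, f y + d * g y <= f c + d * g c].
Proof.
move=> cf cg vf g0 fx0.
have m2 : 0 < f x0 / 2 by rewrite divr_gt0.
have [M M0 MP] := vf _ m2.
have x0M : sqn x0 <= M.
  rewrite leNgt; apply/negP => /MP; rewrite gtr0_norm//.
  by move: fx0; clear; move: (f x0) => m *; lra.
have x0M1 : sqn x0 <= M + 1 by rewrite (le_trans x0M)// lerDl.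
have [G _ GM] := compact_max g _ x0 (compact_sqn (M + 1)) x0M1 (fun y _ => cg y).
(* With this coefficient the barrier is at most f(x0)/4 on the ball, so the maximum point keeps f >=
   3 f(x0)/4. *)
pose d := f x0 / (4 * (g G + 1)).
have G1 : 0 < g G + 1 by rewrite ltr_wpDl.
have d0 : 0 < d by rewrite divr_gt0// mulr_gt0.
have dG : d * g G <= f x0 / 4.
  have <- : d * (g G + 1) = f x0 / 4 by rewrite /d invfM mulrA divfK// lt0r_neq0.
  by rewrite ler_pM2l// lerDl.
have cV : continuous (fun y => f y + d * g y).
  move=> y; apply: (continuousD (cf y)).
  by apply: (continuousM _ (cg y)); exact: cst_continuous.
have [c cM fc] := compact_max (fun y => f y + d * g y) _ x0 (compact_sqn (M + 1)) x0M1 (fun y _ => cV y).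
have fcm : f x0 / 2 < f c.
  have V0 : f x0 + d * g x0 <= f c + d * g c := fc _ x0M1.
  have V1 : d * g c <= d * g G by rewrite ler_pM2l//; exact: GM.
  have V2 : 0 <= d * g x0 by rewrite mulr_ge0// ltW.
  clear -V0 V1 V2 dG fx0; move: V0 V1 V2 dG fx0.
  move: (f x0) (d * _) (d * _) (d * _) (f c) => *; lra.
exists d, c; split => //; first by rewrite (lt_trans m2).
have cM' : sqn c < M + 1.
  rewrite (@le_lt_trans _ _ M) ?ltrDl// leNgt; apply/negP => /MP.
  by move/(le_lt_trans (ler_norm _)); rewrite ltNge (ltW fcm).
have N : \forall y \near c, sqn y < M + 1.
  exact: (cvgr_lt _ (smooth_cont smooth_sqn c) _ cM').
by apply: filterS N => y /ltW yM; exact: fc.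
Qed.

(** The barrier is the square of one coordinate: its Laplacian is positive, against
    [lap_local_max]. *)
Theorem harmonic_vanishing f : smooth f -> vanishes f ->
  (forall x, lap f x = 0) -> forall x, f x <= 0.
Proof.
move=> sf vf f0 x; rewrite leNgt; apply/negP => fx.
pose g (y : V) : R := y 0 0 * y 0 0.
have sg : smooth g by rewrite /g; smth.
have [|d [c [d0 _ mx]]] := perturbed_max _ _ _ (smooth_cont sf) (smooth_cont sg) vf _ fx.
  by move=> y; rewrite /g -expr2 sqr_ge0.
have sdg : smooth (fun y => d * g y) by smth.
have := lap_local_max _ _ (smoothD sf sdg) mx.
have sc : smooth (fun=> d) by exact: smooth_cst.
have s0 : smooth (fun y : V => (y 0 0 : R)) by exact: smooth_coord.
rewrite (lapD _ _ _ sf sdg) f0 (lapM _ _ _ sc sg) (lapM _ _ _ s0 s0).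
rewrite /lap /dotgrad !pd_coord !pd_cst /=; clear -d0; lra.
Qed.

End maximum_principles.

Section swirl_maximum_principle.
Context {R : realType}.
Local Notation V := 'rV[R]_3.
Implicit Types (f g : V -> R) (x v : V) (i j : 'I_3).

Lemma is_derive_line f x v (df : R) :
  is_derive x v f df <-> is_derive (0 : R) (1 : R) (fun t => f (x + t *: v)) df.
Proof.
have E : (fun h : R => h^-1 *: (((fun t => f (x + t *: v)) \o shift (0 : R)) (h *: 1)
     - f (x + 0 *: v))) = (fun h : R => h^-1 *: ((f \o shift x) (h *: v) - f x)).
  apply/funext => h; congr (_ *: (_ - _)); rewrite /=; congr (f _).
    by rewrite [h%:A]mulr1 addr0 addrC.
  by rewrite scale0r addr0.
rewrite /derivable in E; split=> -[dh <-]; apply: DeriveDef;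
  rewrite /derivable /derive; (rewrite E || rewrite -E); done || reflexivity.
Qed.

Lemma pd_comp (F F' : R -> R) n f i :
  (forall t : R, is_derive t (1 : R) F (F' t)) -> Cn n f ->
  forall x, is_derive x (delta_mx 0 i) (fun y => F (f y)) (F' (f x) * pd i f x).
Proof.
move=> dF cf x; apply/is_derive_line.
have := line_derive i f x 0 (Cn_derivable cf i); rewrite scale0r addr0.
set g := fun s => _ => dg.
have := @is_derive1_comp R F g 0 _ _ (dF (g 0)) dg.
by rewrite {2}/g scale0r addr0.
Qed.

Lemma is_derive_expR_coord (k s : R) i j x :
  is_derive x (delta_mx 0 i) (fun y : V => s * expR (k * y 0 j))
    ((s * ((i == j)%:R * k)) * expR (k * x 0 j)).
Proof.
have h : smooth (fun y : V => k * y 0 j) by smth.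
have dE (t : R) : is_derive t (1 : R) (fun t => s * expR t) (s * expR t).
  by apply: is_derive_eq; rewrite /GRing.scale /=; ring.
have := pd_comp _ _ 0 _ i dE (smooth_Cn 0 h) x.
rewrite pdZ; last exact: smooth_coord.
rewrite pd_coord => D; apply: is_derive_eq D _; ring.
Qed.

Lemma pd_expR_coord (k s : R) i j : pd i (fun y : V => s * expR (k * y 0 j)) =
  fun y => (s * ((i == j)%:R * k)) * expR (k * y 0 j).
Proof.
apply/funext => x; rewrite pdE.
by have [_ <-] := is_derive_expR_coord k s i j x.
Qed.

Lemma smooth_expR_coord (k s : R) j : smooth (fun y : V => s * expR (k * y 0 j)).
Proof.
have h : smooth (fun y : V => k * y 0 j) by smth.
have ce t : continuous (fun y : V => t * expR (k * y 0 j)).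
  move=> x; apply: (continuousM (@cst_continuous V R t x)).
  apply: (@continuous_comp _ _ _ (fun y : V => k * y 0 j) (@expR R)).
    exact: (smooth_cont h x).
  exact: continuous_expR.
have de t i x : derivable (fun y : V => t * expR (k * y 0 j)) x (delta_mx 0 i).
  by case: (is_derive_expR_coord k t i j x).
apply/smoothP => n; elim: n s => [|n IH] s; split => // i.
by rewrite pd_expR_coord.
Qed.

(* The drift is bounded, so [expR (k * x_3)] with [k] large is a strict
   subsolution. *)
Lemma swirl_max_principle (a b c f w : V -> R) : smooth f -> vanishes f ->
  continuous c -> vanishes c ->
  (forall x, lap f x - 2 * w x = advect a b c f x) ->
  (forall x, (x 0 0 ^+ 2 + x 0 1 ^+ 2) * w x
     = x 0 0 * pd 0 f x + x 0 1 * pd 1 f x) ->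
  (forall x, x 0 0 = 0 -> x 0 1 = 0 -> f x = 0) ->
  forall x, f x <= 0.
Proof.
move=> sf vf cc vc eqf eqw f0 x0; rewrite leNgt; apply/negP => fx0.
have [U U0 cU] := vanishing_bounded _ cc vc.
pose k := U + 1; pose g (y : V) := 1 * expR (k * y 0 2).
have sg : smooth g := smooth_expR_coord _ _ _.
have [|d [x [d0 fx mx]]] := perturbed_max _ _ _ (smooth_cont sf) (smooth_cont sg) vf _ fx0.
  by move=> y; rewrite /g mul1r expR_ge0.
have sdg : smooth (fun y => d * g y) by smth.
have sV := smoothD sf sdg.
have L := lap_local_max _ _ sV mx.
have D i : pd i f x + d * pd i g x = 0.
  have [<- _] := local_max _ _ sV mx i.
  by rewrite (pdD _ sf sdg) (pdZ _ _ sg).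
have := D 0; have := D 1; have := D 2.
rewrite /g !pd_expR_coord /= !mul1r !mul0r !mulr0 !addr0 -/(g _) => D2 D1 D0.
(* The barrier depends on x_3 alone, so the horizontal derivatives of [f] vanish at the maximum and
   with them the singular term. The axis is excluded because [f] is zero there and positive at
   [x]. *)
have w0 : w x = 0.
  have := eqw x; rewrite D0 D1 !mulr0 addr0 => /eqP; rewrite mulf_eq0.
  case/orP => [|/eqP//]; rewrite paddr_eq0 ?sqr_ge0// !sqrf_eq0.
  move=> /andP[/eqP y0 /eqP y1]; move: fx; rewrite f0// ltxx //.
have E := eqf x; rewrite w0 mulr0 subr0 /advect D0 D1 in E.
move: L; rewrite (lapD _ _ _ sf sdg) E /lap !(pdZ _ _ sg) !(pdZ _ _ (smooth_pd sg)).
rewrite /g !pd_expR_coord /= !mul1r !mul0r !mulr0 !addr0 !add0r.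
have e0 : 0 < expR (k * x 0 2) by exact: expR_gt0.
have := cU x; rewrite ler_norml => /andP[c1 c2].
have k0 : 0 < k by rewrite addr_gt0.
have -> : pd 2 f x = - (d * (k * expR (k * x 0 2))) by apply: subr0_eq; rewrite opprK.
rewrite leNgt => /negP; apply.
rewrite (_ : _ + _ = d * expR (k * x 0 2) * k * (k - c x)); last by ring.
rewrite !mulr_gt0// subr_gt0 (le_lt_trans c2)// ltrDl//.
Qed.

End swirl_maximum_principle.

(** * Decay of the vorticity *)

Section bernstein_scalar.
Context {R : realType}.

Lemma young (t p q : R) : 0 < t -> p * q <= t * p ^+ 2 + q ^+ 2 / (4 * t).
Proof.
move=> t0; rewrite -subr_ge0.
have tN0 := lt0r_neq0 t0.
rewrite (_ : _ - _ = (2 * t * p - q) ^+ 2 / (4 * t)); last by field.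
by rewrite divr_ge0 ?sqr_ge0// ltW// mulr_gt0.
Qed.

Lemma young_le (t p q B : R) : 0 < t -> q ^+ 2 <= B ->
  `|p * q| <= t * p ^+ 2 + B / (4 * t).
Proof.
move=> t0 qB; have tt : 0 < 4 * t by rewrite mulr_gt0.
rewrite ler_norml; apply/andP; split.
  rewrite lerNl -mulrN (le_trans (young t p (- q) t0))// sqrrN lerD2l.
  by rewrite ler_pM2r// invr_gt0.
by rewrite (le_trans (young t p q t0))// lerD2l ler_pM2r// invr_gt0.
Qed.

(* Here [h] is the cut-off, [w_i] the vorticity, [s_i] the stretching term,
   [n_i = |grad w_i|^2], [d_i = grad h . grad w_i], [l_i] the Laplacian, [t_i] the
   convection and [m_i = |grad u_i|^2] for the velocity [a_i], and
   [f_i = grad h . grad u_i]. *)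
Lemma bernstein_scalar (h w0 w1 s0 s1 n0 n1 d0 d1 a0 a1 a2 l0 l1 l2 t0 t1 t2
    m0 m1 m2 f0 f1 f2 ph g2 e M : R) :
  2128 <= M -> 0 <= h <= 1 -> 0 < e <= 1 -> a0 ^+ 2 + a1 ^+ 2 + a2 ^+ 2 <= e ->
  s0 ^+ 2 + s1 ^+ 2 <= n0 + n1 -> d0 ^+ 2 <= 4 * n0 -> d1 ^+ 2 <= 4 * n1 ->
  l0 ^+ 2 <= n1 -> l1 ^+ 2 <= n0 -> l2 ^+ 2 <= 2 * (n0 + n1) ->
  t0 ^+ 2 <= m0 -> t1 ^+ 2 <= m1 -> t2 ^+ 2 <= m2 ->
  f0 ^+ 2 <= 4 * m0 -> f1 ^+ 2 <= 4 * m1 -> f2 ^+ 2 <= 4 * m2 ->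
  w0 ^+ 2 + w1 ^+ 2 <= 2 * (m0 + m1 + m2) ->
  - 8 <= ph <= - 4 -> 0 <= g2 <= 4 ->
  0 < h ^+ 4 * (2 * (n0 + n1) - 2 * (w0 * s0 + w1 * s1))
    + (w0 ^+ 2 + w1 ^+ 2) * (4 * h ^+ 3 * ph + 12 * h ^+ 2 * g2)
    + 16 * h ^+ 3 * (w0 * d0 + w1 * d1)
    + M * (h ^+ 2 * (2 * (m0 + m1 + m2) + 2 * (a0 * l0 + a1 * l1 + a2 * l2)
        - 2 * (a0 * t0 + a1 * t1 + a2 * t2))
      + (a0 ^+ 2 + a1 ^+ 2 + a2 ^+ 2) * (2 * h * ph + 2 * g2)
      + 8 * h * (a0 * f0 + a1 * f1 + a2 * f2))
    - (M ^+ 2 + 100 * M) * e * ph.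
Proof.
move=> M1 /andP[h0 h1] /andP[e0 e1] Qe S D0 D1 L0 L1 L2 T0 T1 T2 F0 F1 F2 Wm
  /andP[p1 p2] /andP[g0 g1].
have n00 : 0 <= n0 by have := sqr_ge0 d0; lra.
have n10 : 0 <= n1 by have := sqr_ge0 d1; lra.
have m00 : 0 <= m0 by have := sqr_ge0 t0; lra.
have m10 : 0 <= m1 by have := sqr_ge0 t1; lra.
have m20 : 0 <= m2 by have := sqr_ge0 t2; lra.
have h2 : 0 <= h ^+ 2 <= 1 by rewrite sqr_ge0 expr_le1.
have h4 : 0 <= h ^+ 4 <= h ^+ 2.
  by rewrite exprn_ge0//= ler_wiXn2l//; apply/andP.
have h3 : 0 <= h ^+ 3 <= h ^+ 2.
  by rewrite exprn_ge0//= ler_wiXn2l//; apply/andP.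
have X (p q t B : R) : 0 < t -> q ^+ 2 <= B -> - (t * p ^+ 2 + B / (4 * t)) <= p * q <= t * p ^+ 2 + B / (4 * t).
  by move=> ? ?; rewrite -ler_norml; exact: young_le.
set W := w0 ^+ 2 + w1 ^+ 2 in Wm *.
set Q := a0 ^+ 2 + a1 ^+ 2 + a2 ^+ 2 in Qe *.
have W0 : 0 <= W by rewrite addr_ge0 ?sqr_ge0.
have Q0 : 0 <= Q by rewrite !addr_ge0 ?sqr_ge0.
(* The multiples of h^2 [W] lost here and in [B2], [B3] are 8, 1024 and 32. Since [W] is at most
   twice m0 + m1 + m2, their sum 1064 costs 2128 times h^2 (m0 + m1 + m2), which [M] covers. *)
have B1 : w0 * s0 + w1 * s1 <= 4 * W + (n0 + n1) / 16.
  have := X w0 s0 4 _ (ltr0n _ _) (lexx _); have := X w1 s1 4 _ (ltr0n _ _) (lexx _).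
  by rewrite /W => /andP[_ ?] /andP[_ ?]; lra.
have B2 : - (1024 * h ^+ 2 * W + h ^+ 4 * (n0 + n1) / 4) <= 16 * h ^+ 3 * (w0 * d0 + w1 * d1).
  have q d n : d ^+ 2 <= 4 * n -> (h ^+ 2 * d) ^+ 2 <= h ^+ 4 * (4 * n).
    by move=> dn; rewrite exprMn -exprM ler_wpM2l//; case/andP: h4.
  have := X (h * w0) (h ^+ 2 * d0) 64 _ (ltr0n _ _) (q _ _ D0).
  have := X (h * w1) (h ^+ 2 * d1) 64 _ (ltr0n _ _) (q _ _ D1).
  by rewrite /W => /andP[? _] /andP[? _]; lra.
have B3 : - (32 * h ^+ 2 * W) <= W * (4 * h ^+ 3 * ph + 12 * h ^+ 2 * g2).
  have Y1 : 0 <= h ^+ 2 * g2 by rewrite mulr_ge0//; case/andP: h2.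
  have Y2 : 0 <= h ^+ 3 * (ph + 8) by rewrite mulr_ge0//; [case/andP: h3|clear -p1; lra].
  have : 0 <= W * (4 * (h ^+ 3 * (ph + 8)) + 12 * (h ^+ 2 * g2)
      + 32 * (h ^+ 2 - h ^+ 3)).
    by rewrite mulr_ge0//; case/andP: h3 => _ h32; clear -Y1 Y2 h32; lra.
  clear; lra.
set n := n0 + n1 in S L2 B1 B2 *; set m := m0 + m1 + m2 in Wm *.
(* In [B4] to [B7] at most 4 M^2 Q + 276 M Q is lost, with Q <= e, while the last term of the sum is
   at least 4 M^2 e + 400 M e by [ph <= - 4]. *)
have B4 : - (4 * M ^+ 2 * Q + h ^+ 4 * n) <= 2 * M * h ^+ 2 * (a0 * l0 + a1 * l1 + a2 * l2).
  have q d k : d ^+ 2 <= k -> (h ^+ 2 * d) ^+ 2 <= h ^+ 4 * k.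
    by move=> dn; rewrite exprMn -exprM ler_wpM2l//; case/andP: h4.
  have := X (2 * M * a0) (h ^+ 2 * l0) 1 _ ltr01 (q _ _ L0).
  have := X (2 * M * a1) (h ^+ 2 * l1) 1 _ ltr01 (q _ _ L1).
  have := X (2 * M * a2) (h ^+ 2 * l2) 1 _ ltr01 (q _ _ L2).
  have : 0 <= h ^+ 4 * n by rewrite mulr_ge0 ?addr_ge0//; case/andP: h4.
  rewrite /Q /n; clear; move=> ? /andP[? _] /andP[? _] /andP[? _]; lra.
have B5 : a0 * t0 + a1 * t1 + a2 * t2 <= 2 * Q + m / 8.
  have := X a0 t0 2 _ (ltr0n _ _) T0.
  have := X a1 t1 2 _ (ltr0n _ _) T1.
  have := X a2 t2 2 _ (ltr0n _ _) T2.
  rewrite /Q /m; clear; move=> /andP[_ ?] /andP[_ ?] /andP[_ ?]; lra.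
have B6 : - (16 * Q) <= Q * (2 * h * ph + 2 * g2).
  have Y1 : 0 <= h * (ph + 8) by rewrite mulr_ge0//; clear -p1; lra.
  have : 0 <= Q * (2 * (h * (ph + 8)) + 2 * g2 + 16 * (1 - h)).
    by rewrite mulr_ge0//; clear -Y1 g0 h1; lra.
  clear; lra.
have B7 : - (256 * Q + h ^+ 2 * m / 4) <= 8 * h * (a0 * f0 + a1 * f1 + a2 * f2).
  have q d k : d ^+ 2 <= 4 * k -> (h * d) ^+ 2 <= h ^+ 2 * (4 * k).
    by move=> dn; rewrite exprMn ler_wpM2l//; case/andP: h2.
  have := X (8 * a0) (h * f0) 4 _ (ltr0n _ _) (q _ _ F0).
  have := X (8 * a1) (h * f1) 4 _ (ltr0n _ _) (q _ _ F1).
  have := X (8 * a2) (h * f2) 4 _ (ltr0n _ _) (q _ _ F2).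
  rewrite /Q /m; clear; move=> /andP[? _] /andP[? _] /andP[? _]; lra.
have h40 : 0 <= h ^+ 4 by case/andP: h4.
have h20 : 0 <= h ^+ 2 by case/andP: h2.
have M0 : 0 <= M by clear -M1; lra.
have B8 : 0 <= (M ^+ 2 + 100 * M) * e * (- ph - 4).
  apply: mulr_ge0; last by clear -p2; lra.
  by rewrite mulr_ge0 ?(ltW e0)// addr_ge0 ?sqr_ge0// mulr_ge0.
have C1 := ler_wpM2l h40 B1.
have C2 : h ^+ 4 * W <= h ^+ 2 * W by rewrite ler_wpM2r//; case/andP: h4.
have C3 := ler_wpM2l h20 Wm.
have C6 : 0 <= h ^+ 4 * n by rewrite mulr_ge0// addr_ge0.
have C7 : 0 <= h ^+ 2 * m by rewrite mulr_ge0// !addr_ge0.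
have C8 := ler_wpM2r C7 M1.
have C4 := ler_wpM2l (mulr_ge0 M0 h20) B5.
have C5 : h ^+ 2 * Q <= Q by rewrite ler_piMl//; case/andP: h2.
have {}C5 := ler_wpM2l M0 C5.
have C9 := ler_wpM2l M0 Qe.
have C10 := ler_wpM2l (sqr_ge0 M) Qe.
have C11 := mulr_gt0 (lt_le_trans (ltr0n R 2128) M1) e0.
have {}B6 := ler_wpM2l M0 B6.
have {}B7 := ler_wpM2l M0 B7.
clearbody W Q n m.
clear -B2 B3 B4 B6 B7 B8 C1 C2 C3 C4 C5 C6 C7 C8 C9 C10 C11.
move: B2 B3 B4 B6 B7 B8 C1 C2 C3 C4 C5 C6 C7 C8 C9 C10 C11.
set z := w0 * s0 + _; set z1 := w0 * d0 + _; set z2 := a0 * l0 + _ + _.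
set z3 := a0 * t0 + _ + _; set z4 := a0 * f0 + _ + _.
clearbody z z1 z2 z3 z4.
move=> *; lra.
Qed.

End bernstein_scalar.

Section bernstein.
Context {R : realType}.
Local Notation V := 'rV[R]_3.
Implicit Types (f g h : V -> R) (x : V) (i j : 'I_3).
Variables a b c p : V -> R.
Hypothesis H : axiflow a b c p.
Hypothesis S0 : forall x, swirl a b x = 0.
Local Notation conv := (advect a b c).
Local Notation v0 := (vort0 b c).
Local Notation v1 := (vort1 a c).

Definition transport f x : R := lap f x - conv f x.

Lemma advectD f g x : smooth f -> smooth g ->
  conv (fun y => f y + g y) x = conv f x + conv g x.
Proof. by move=> sf sg; rewrite /advect !(pdD _ sf sg); ring. Qed.

Lemma advectM f g x : smooth f -> smooth g ->
  conv (fun y => f y * g y) x = conv f x * g x + f x * conv g x.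
Proof. by move=> sf sg; rewrite /advect !(pdM _ sf sg); ring. Qed.

Lemma transportD f g x : smooth f -> smooth g ->
  transport (fun y => f y + g y) x = transport f x + transport g x.
Proof.
by move=> sf sg; rewrite /transport (lapD _ _ _ sf sg) (advectD _ _ _ sf sg); ring.
Qed.

Lemma transportM f g x : smooth f -> smooth g ->
  transport (fun y => f y * g y) x =
  transport f x * g x + 2 * dotgrad f g x + f x * transport g x.
Proof.
by move=> sf sg; rewrite /transport (lapM _ _ _ sf sg) (advectM _ _ _ sf sg); ring.
Qed.

Lemma transport_cst k x : transport (fun=> k) x = 0.
Proof. by rewrite /transport /lap /advect !pd_cst; ring. Qed.

Lemma transportZ k f x : smooth f ->
  transport (fun y => k * f y) x = k * transport f x.
Proof.
move=> sf; rewrite (transportM _ _ _ (smooth_cst k) sf) transport_cst.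
by rewrite /dotgrad !pd_cst; ring.
Qed.

Lemma dotgradMl f g h x : smooth f -> smooth g ->
  dotgrad (fun y => f y * g y) h x = dotgrad f h x * g x + f x * dotgrad g h x.
Proof. by move=> sf sg; rewrite /dotgrad !(pdM _ sf sg); ring. Qed.

Lemma dotgradDl f g h x : smooth f -> smooth g ->
  dotgrad (fun y => f y + g y) h x = dotgrad f h x + dotgrad g h x.
Proof. by move=> sf sg; rewrite /dotgrad !(pdD _ sf sg); ring. Qed.

Lemma dotgradC f g x : dotgrad f g x = dotgrad g f x.
Proof. by rewrite /dotgrad; ring. Qed.

Lemma dotgrad_ge0 f x : 0 <= dotgrad f f x.
Proof. by rewrite /dotgrad -!expr2 !addr_ge0 ?sqr_ge0. Qed.

Lemma cauchy3 (p0 p1 p2 q0 q1 q2 : R) :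
  (p0 * q0 + p1 * q1 + p2 * q2) ^+ 2 <=
  (p0 ^+ 2 + p1 ^+ 2 + p2 ^+ 2) * (q0 ^+ 2 + q1 ^+ 2 + q2 ^+ 2).
Proof.
rewrite -subr_ge0 (_ : _ - _ = (p0 * q1 - p1 * q0) ^+ 2 + (p0 * q2 - p2 * q0) ^+ 2
  + (p1 * q2 - p2 * q1) ^+ 2); last by ring.
by rewrite !addr_ge0 ?sqr_ge0.
Qed.

Lemma dotgrad_sqr f g x : dotgrad f g x ^+ 2 <= dotgrad f f x * dotgrad g g x.
Proof. by rewrite /dotgrad (le_trans (cauchy3 _ _ _ _ _ _))// !expr2. Qed.

Lemma advect_sqr f x :
  conv f x ^+ 2 <= (a x ^+ 2 + b x ^+ 2 + c x ^+ 2) * dotgrad f f x.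
Proof. by rewrite /advect (le_trans (cauchy3 _ _ _ _ _ _))// /dotgrad !expr2. Qed.

(** The powers 4 and 2 of the cut-off let the cross terms h^3 |omega| |grad omega| split into h^4
    |grad omega|^2 and h^2 |omega|^2, the latter below 2 h^2 |grad u|^2. The barrier C (1 - h) is
    zero at the centre, where h = 1, and pushes the maximum to the sphere h = 0. *)
Definition auxG (h : V -> R) (M C : R) x : R :=
  h x * h x * (h x * h x) * (v0 x * v0 x + v1 x * v1 x)
  + (M * (h x * h x * (a x * a x + b x * b x + c x * c x)) + C * (1 - h x)).

Lemma transport_auxG h M C x : smooth h -> transport (auxG h M C) x =
  h x ^+ 4 * (2 * (dotgrad v0 v0 x + dotgrad v1 v1 x)
    - 2 * (v0 x * stretch0 a b c x + v1 x * stretch1 a b c x))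
  + (v0 x ^+ 2 + v1 x ^+ 2) *
    (4 * h x ^+ 3 * transport h x + 12 * h x ^+ 2 * dotgrad h h x)
  + 16 * h x ^+ 3 * (v0 x * dotgrad h v0 x + v1 x * dotgrad h v1 x)
  + M * (h x ^+ 2 * (2 * (dotgrad a a x + dotgrad b b x + dotgrad c c x)
      + 2 * (a x * lap a x + b x * lap b x + c x * lap c x)
      - 2 * (a x * conv a x + b x * conv b x + c x * conv c x))
    + (a x ^+ 2 + b x ^+ 2 + c x ^+ 2) * (2 * h x * transport h x + 2 * dotgrad h h x)
    + 8 * h x * (a x * dotgrad h a x + b x * dotgrad h b x + c x * dotgrad h c x))
  - C * transport h x.
Proof.
move=> sh; have [[sa sb sc _] _ _ _] := H.
have [s0 s1 _] := smooth_vort _ _ _ _ H.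
have [E0 E1] := no_swirl_vort_eq _ _ _ _ H S0 x.
have P0 : transport v0 x = - stretch0 a b c x by rewrite /transport E0; ring.
have P1 : transport v1 x = - stretch1 a b c x by rewrite /transport E1; ring.
have sq f : smooth f -> smooth (fun y => f y * f y) by move=> sf; exact: smoothM.
have Tq f : smooth f -> transport (fun y => f y * f y) x
    = 2 * f x * transport f x + 2 * dotgrad f f x.
  by move=> sf; rewrite (transportM _ _ _ sf sf); ring.
have Dq f g : smooth f -> dotgrad (fun y => f y * f y) g x = 2 * f x * dotgrad f g x.
  by move=> sf; rewrite (dotgradMl _ _ _ _ sf sf); ring.
have sW := smoothD (sq _ s0) (sq _ s1).
have sab := smoothD (sq _ sa) (sq _ sb).
have sQ := smoothD sab (sq _ sc).
have sh2 := sq _ sh; have sh4 := sq _ sh2.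
have sA := smoothM sh4 sW; have sB := smoothM sh2 sQ.
have sMB := smoothM (smooth_cst M) sB.
have s1h := smoothB (smooth_cst 1) sh.
have sC := smoothM (smooth_cst C) s1h.
rewrite /auxG (transportD _ _ _ sA (smoothD sMB sC)) (transportD _ _ _ sMB sC).
rewrite (transportZ _ _ _ sB) (transportZ _ _ _ s1h).
rewrite (transportM _ _ _ sh4 sW) (transportM _ _ _ sh2 sQ).
rewrite (transportD _ _ _ (smooth_cst 1) (smoothN sh)) transport_cst.
have -> : transport (fun y => - h y) x = - transport h x.
  rewrite -mulN1r -(transportZ _ _ _ sh); congr (transport _ x).
  by apply/funext => y; rewrite mulN1r.
rewrite (Tq _ sh2) (Tq _ sh) (Dq _ _ sh2) !(Dq _ _ sh).
rewrite (dotgradC h (fun y => h y * h y)) (Dq _ _ sh).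
rewrite !(dotgradC h (fun y => _ + _)).
rewrite (dotgradDl _ _ _ _ (sq _ s0) (sq _ s1)) (dotgradDl _ _ _ _ sab (sq _ sc)).
rewrite (dotgradDl _ _ _ _ (sq _ sa) (sq _ sb)).
rewrite (Dq _ _ s0) (Dq _ _ s1) (Dq _ _ sa) (Dq _ _ sb) (Dq _ _ sc).
rewrite (transportD _ _ _ (sq _ s0) (sq _ s1)) (transportD _ _ _ sab (sq _ sc)).
rewrite (transportD _ _ _ (sq _ sa) (sq _ sb)).
rewrite (Tq _ s0) (Tq _ s1) (Tq _ sa) (Tq _ sb) (Tq _ sc) P0 P1.
rewrite !(dotgradC _ h).
have T f : transport f x = lap f x - conv f x by [].
rewrite (T a) (T b) (T c).
move: (transport h x) (dotgrad h h x) (dotgrad h a x) (dotgrad h b x) (dotgrad h c x)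
 (dotgrad h v0 x) (dotgrad h v1 x) (dotgrad v0 v0 x) (dotgrad v1 v1 x)
 (dotgrad a a x) (dotgrad b b x) (dotgrad c c x) (stretch0 a b c x) (stretch1 a b c x)
 (lap a x) (lap b x) (lap c x) (conv a x) (conv b x) (conv c x) (h x) (v0 x) (v1 x)
 (a x) (b x) (c x).
clear => *; ring.
Qed.
End bernstein.

Section bernstein_estimate.
Context {R : realType}.
Local Notation V := 'rV[R]_3.
Implicit Types (f g h : V -> R) (x : V) (i j : 'I_3).

Definition sqd (y x : V) : R :=
  (x 0 0 - y 0 0) ^+ 2 + (x 0 1 - y 0 1) ^+ 2 + (x 0 2 - y 0 2) ^+ 2.

Lemma smooth_sqd y : smooth (sqd y).
Proof. by rewrite /sqd; smth. Qed.

Lemma sqd_ge0 y x : 0 <= sqd y x.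
Proof. by rewrite !addr_ge0 ?sqr_ge0. Qed.

Lemma sqdxx y : sqd y y = 0.
Proof. by rewrite /sqd !subrr expr0n !addr0. Qed.

Lemma sqd_near y x : sqn y <= 2 * sqn x + 2 * sqd y x.
Proof.
have h (s t : R) : t ^+ 2 <= 2 * s ^+ 2 + 2 * (s - t) ^+ 2.
  rewrite -subr_ge0 (_ : _ - _ = (2 * s - t) ^+ 2) ?sqr_ge0//; ring.
have := h (x 0 0) (y 0 0); have := h (x 0 1) (y 0 1); have := h (x 0 2) (y 0 2).
rewrite /sqn /sqd; move: (x 0 0) (x 0 1) (x 0 2) (y 0 0) (y 0 1) (y 0 2).
clear => *; lra.
Qed.

Lemma sqdC y x : sqd y x = sqd x y.
Proof. by rewrite /sqd; ring. Qed.

Lemma pd_sqd y i : pd i (sqd y) = fun x => 2 * (x 0 i - y 0 i).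
Proof.
have sk k : smooth (fun x : V => x 0 k - y 0 k) by smth.
have dk k : pd i (fun x : V => x 0 k - y 0 k) = fun=> (i == k)%:R.
  rewrite pdB; [|smth|smth]; rewrite pd_coord pd_cst.
  by apply/funext => x; rewrite subr0.
have sq k : smooth (fun x : V => (x 0 k - y 0 k) ^+ 2) by smth.
have dq k : pd i (fun x : V => (x 0 k - y 0 k) ^+ 2)
    = fun x => 2 * (i == k)%:R * (x 0 k - y 0 k).
  rewrite (pdM i (sk k) (sk k)) dk; apply/funext => x; ring.
rewrite /sqd (pdD i (smoothD (sq 0) (sq 1)) (sq 2)) (pdD i (sq 0) (sq 1)) !dq.
by apply/funext => x; have [->|->|->] := ord3E i; rewrite /=; ring.
Qed.

(** [auxG] is maximised over the unit ball around [y]. An interior maximum is excluded by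
    [bernstein_scalar]; on the sphere h = 0 only the barrier is left, with value C; at [y], where h
    = 1, [auxG] dominates |omega|^2. *)
Lemma bernstein_estimate (a b c p : V -> R) (H : axiflow a b c p)
  (S0 : forall x, swirl a b x = 0) y (e M : R) : 0 < e <= 1 -> 2128 <= M ->
  (forall x, sqd y x <= 1 -> a x ^+ 2 + b x ^+ 2 + c x ^+ 2 <= e) ->
  (vort0 b c) y ^+ 2 + (vort1 a c) y ^+ 2 <= (M ^+ 2 + 100 * M) * e.
Proof.
move=> /andP[e0 e1] M1 ue; have M0 : 0 <= M by clear -M1; lra.
have [[sa sb sc _] _ _ _] := H.
have [s0 s1 _] := smooth_vort _ _ _ _ H.
have ssd := smooth_sqd y.
pose h x : R := 1 - sqd y x.
have sh : smooth h by rewrite /h; smth.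
set C := (M ^+ 2 + 100 * M) * e.
pose G := auxG a b c h M C.
have sG : smooth G by rewrite /G /auxG; smth.
have cK : compact [set x | sqd y x <= 1].
  apply: (subclosed_compact _ (compact_sqn (2 * sqn y + 2))).
    by apply: closed_sublevel; exact: smooth_cont ssd.
  move=> x /= xy; rewrite (le_trans (sqd_near x y))// lerD2l.
  by rewrite sqdC -[leRHS]mulr1 ler_pM2l.
have yK : sqd y y <= 1 by rewrite sqdxx.
have [x xK Gx] := compact_max G _ y cK yK (fun z _ => smooth_cont sG z).
have Gy : (vort0 b c) y ^+ 2 + (vort1 a c) y ^+ 2 <= G y.
  rewrite /G /auxG /h sqdxx subr0 subrr mulr0 addr0 !mul1r -!expr2 lerDl.
  by rewrite mulr_ge0// !addr_ge0// sqr_ge0.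
have [x1|x1] := leP 1 (sqd y x).
  rewrite (le_trans Gy)// (le_trans (Gx _ yK))// /G /auxG /h.
  have -> : sqd y x = 1 by apply/eqP; rewrite eq_le xK.
  by rewrite subrr subr0; clear; lra.
exfalso.
have N : \forall z \near x, sqd y z < 1.
  exact: (cvgr_lt _ (smooth_cont ssd x) _ x1).
have mx : \forall z \near x, G z <= G x by apply: filterS N => z /ltW; exact: Gx.
have LG := lap_local_max _ _ sG mx.
have DG i : pd i G x = 0 by have [] := local_max _ _ sG mx i.
have TG : transport a b c G x <= 0 by rewrite /transport /advect !DG !mulr0 !addr0 subr0.
move: TG; rewrite (transport_auxG _ _ _ _ H S0 _ _ _ _ sh); apply/negP; rewrite -ltNge.
have ux := ue _ xK.
have dh i : pd i h = fun z => - (2 * (z 0 i - y 0 i)).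
  rewrite /h (pdB i (smooth_cst 1) ssd) pd_cst pd_sqd.
  by apply/funext => z; rewrite sub0r.
have g2 : dotgrad h h x = 4 * sqd y x.
  by rewrite /dotgrad !dh /sqd; ring.
have ddh i : pd i (pd i h) x = - 2.
  rewrite dh pdN; last smth; rewrite pdZ; last smth.
  rewrite pdB; [|smth|smth].
  by rewrite pd_coord pd_cst eqxx /= ; ring.
have Th : transport a b c h x = - 6 + 2 * (a x * (x 0 0 - y 0 0)
   + b x * (x 0 1 - y 0 1) + c x * (x 0 2 - y 0 2)).
  by rewrite /transport /lap !ddh /advect !dh; ring.
have cs : (a x * (x 0 0 - y 0 0) + b x * (x 0 1 - y 0 1) + c x * (x 0 2 - y 0 2)) ^+ 2 <= 1.
  rewrite (le_trans (cauchy3 _ _ _ _ _ _))// mulr_ile1//.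
  - by rewrite !addr_ge0 ?sqr_ge0.
  - exact: sqd_ge0.
  - exact: le_trans ux e1.
(* The Laplacian of [h] is - 6, and the drift contributes at most 2 in absolute value because |u| <=
   1 and |x - y| <= 1. *)
have {cs} ph : - 8 <= transport a b c h x <= - 4.
  rewrite Th; move: cs; set z := a x * _ + _ + _; clearbody z; clear.
  move=> z1; have : `|z| <= 1 by rewrite -(@ler_pXn2r _ 2) ?nnegrE// expr1n real_normK ?num_real.
  by rewrite ler_norml => /andP[? ?]; apply/andP; split; lra.
have s2 := stretch_bound _ _ _ _ H S0 x.
have [la lb lc] := no_swirl_lap_curl _ _ _ _ H S0 x.
have dg f := dotgrad_ge0 f x.
have dgp f i : pd i f x ^+ 2 <= dotgrad f f x.
  have h' (s q r : R) : [/\ s ^+ 2 <= s * s + q * q + r * r,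
    q ^+ 2 <= s * s + q * q + r * r & r ^+ 2 <= s * s + q * q + r * r].
    have := sqr_ge0 s; have := sqr_ge0 q; have := sqr_ge0 r.
    by clear; move=> *; split; lra.
  rewrite /dotgrad; have [] := h' (pd 0 f x) (pd 1 f x) (pd 2 f x).
  by have [->|->|->] := ord3E i.
have dgh f : dotgrad h f x ^+ 2 <= 4 * dotgrad f f x.
  rewrite (le_trans (dotgrad_sqr _ _ _))// ler_wpM2r// g2.
  by rewrite -[leRHS]mulr1 ler_pM2l.
have cf f : advect a b c f x ^+ 2 <= dotgrad f f x.
  by rewrite (le_trans (advect_sqr _ _ _ _ _))// ler_piMl// (le_trans ux e1).
apply: bernstein_scalar => //.
- by rewrite /h subr_ge0 xK lerBlDr lerDl sqd_ge0.
- by rewrite e0.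
- have ab1 : a x ^+ 2 + b x ^+ 2 <= 1.
    by rewrite (le_trans _ e1)// (le_trans _ ux)// lerDl sqr_ge0.
  by rewrite (le_trans s2)// ler_piMl// addr_ge0.
- by rewrite la.
- by rewrite lb sqrrN.
- rewrite lc; have := dgp (vort0 b c) 1; have := dgp (vort1 a c) 0.
  move: (pd 1 (vort0 b c) x) (pd 0 (vort1 a c) x) (dotgrad (vort0 b c) (vort0 b c) x) (dotgrad (vort1 a c) (vort1 a c) x) => q r A B q1 r1.
  have := sqr_ge0 (q + r); clear -q1 r1 => ?; lra.
- have q2 (q r : R) : (q - r) ^+ 2 <= 2 * (q ^+ 2 + r ^+ 2).
    by have := sqr_ge0 (q + r); clear => ?; lra.
  have := q2 (pd 1 c x) (pd 2 b x); have := q2 (pd 2 a x) (pd 0 c x).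
  have sg f i := sqr_ge0 (pd i f x).
  have := sg a 0; have := sg a 1; have := sg b 0; have := sg b 1; have := sg c 2.
  rewrite /vort0 /vort1 /dotgrad.
  move: (pd 0 a x) (pd 1 a x) (pd 2 a x) (pd 0 b x) (pd 1 b x) (pd 2 b x)
    (pd 0 c x) (pd 1 c x) (pd 2 c x); clear => *; lra.
- by rewrite g2 mulr_ge0 ?sqd_ge0//= -[leRHS]mulr1 ler_pM2l.
Qed.

Lemma vort_vanishes (a b c p : V -> R) (H : axiflow a b c p)
  (S0 : forall x, swirl a b x = 0) : vanishes a -> vanishes b -> vanishes c ->
  vanishes (vort0 b c) /\ vanishes (vort1 a c).
Proof.
move=> va vb vc.
have [C C0 BE] : exists2 C : R, 0 < C & forall y (e : R), 0 < e <= 1 ->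
    (forall x, sqd y x <= 1 -> a x ^+ 2 + b x ^+ 2 + c x ^+ 2 <= e) ->
    (vort0 b c) y ^+ 2 + (vort1 a c) y ^+ 2 <= C * e.
  have M0 := ltr0n R 2128.
  exists (2128%:R ^+ 2 + 100 * 2128%:R).
    exact: (addr_gt0 (exprn_gt0 2 M0) (mulr_gt0 (ltr0n R 100) M0)).
  by move=> y e e1 ue; exact: (bernstein_estimate _ _ _ _ H S0 y e _ e1 (lexx _) ue).
have E e : 0 < e -> exists2 N, 0 < N & forall x, N < sqn x -> (vort0 b c) x ^+ 2 + (vort1 a c) x ^+ 2 < e ^+ 2.
  move=> e0.
  have C2 : 0 < C * 2 by rewrite mulr_gt0.
  pose d := Num.min 1 (e ^+ 2 / (C * 2)).
  have d0 : 0 < d by rewrite lt_min ltr01 divr_gt0// exprn_gt0.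
  have d1 : d <= 1 by rewrite ge_min lexx.
  have Cd : C * d < e ^+ 2.
    have : C * d <= C * (e ^+ 2 / (C * 2)) by rewrite ler_pM2l// ge_min lexx orbT.
    rewrite invfM mulrCA mulVKf ?lt0r_neq0// => /le_lt_trans; apply.
    by rewrite ltr_pdivrMr// ltr_pMr ?exprn_gt0// ltr1n.
  have d3 : 0 < d / 3 by rewrite divr_gt0.
  have [s s0 sE] : exists2 s : R, 0 < s & s ^+ 2 <= d / 3.
    exists (d / 3); first by [].
    by rewrite expr2 ler_piMl ?ltW//; clear -d1 d0; lra.
  have [Na Na0 aN] := va _ s0; have [Nb Nb0 bN] := vb _ s0; have [Nc Nc0 cN] := vc _ s0.
  pose N := Na + Nb + Nc.
  (* By [sqd_near], the unit ball around such a [y] lies in the region [N < sqn x], where all three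
     components are small. *)
  exists (2 * N + 2); first by rewrite addr_gt0// mulr_gt0// !addr_gt0.
  move=> y yN; rewrite (le_lt_trans _ Cd)//.
  apply: BE; first by rewrite d0.
  move=> x xy; have := sqd_near y x.
  have xN : N < sqn x by have := sqd_near y x; clear -xy yN => ?; lra.
  have sq (t : R) : `|t| < s -> t ^+ 2 <= d / 3.
    move=> ts; rewrite (le_trans _ sE)// -real_normK ?num_real//.
    by rewrite ler_pXn2r ?nnegrE ?(ltW s0)// ltW.
  have /sq A : `|a x| < s by apply: aN; rewrite (le_lt_trans _ xN)// /N -addrA lerDl addr_ge0 ?ltW.
  have /sq B : `|b x| < s by apply: bN; rewrite (le_lt_trans _ xN)// /N; clear -Na0 Nb0 Nc0; lra.
  have /sq C' : `|c x| < s by apply: cN; rewrite (le_lt_trans _ xN)// /N; clear -Na0 Nb0 Nc0; lra.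
  by move=> _; clear -A B C'; lra.
by split=> e e0; have [N N0 NP] := E e e0; exists N => // x /NP ve;
  rewrite -(@ltr_pXn2r _ 2) ?nnegrE ?(ltW e0)// real_normK ?num_real//;
  rewrite (le_lt_trans _ ve)// ?lerDl ?lerDr sqr_ge0.
Qed.

End bernstein_estimate.

(** * Liouville theorem without swirl *)

Section halfplane.
Context {R : realType}.
Local Notation V := 'rV[R]_3.
Implicit Types (f g h : V -> R) (x y q : V) (i j : 'I_3).

(** These are the conditions at the maximum point of [halfplane_bound], with [X] the distance to the
    axis and [e] the exponential. With z = k X the cubic terms cancel and the equation yields 1 - z
    + 3 z^2 e <= 0, impossible for e >= 1 since 1 - z + 3 z^2 has discriminant 1 - 12. *)
Lemma halfplane_scalar (X k u e eta lam f f0 f00 f22 : R) : 0 < X -> 0 < k ->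
  u <= k -> 1 <= e -> 0 < eta ->
  f = lam * X + eta * (1 - k * X * e) -> f0 = lam - eta * k * (e + X * (k * e)) ->
  f00 <= - (eta * k * (2 * (k * e) + X * (k * (k * e)))) -> f22 <= 0 ->
  X ^+ 2 * (f00 + f22) = (f - X * f0) * (1 - X * u) -> False.
Proof.
move=> X0 k0 uk e1 eta0 -> -> F0 F2.
have -> : lam * X + eta * (1 - k * X * e) - X * (lam - eta * k * (e + X * (k * e)))
  = eta * (1 + (k * X) ^+ 2 * e) by ring.
have A : X ^+ 2 * (f00 + f22) <= - (eta * ((k * X) ^+ 2 * (2 + k * X) * e)).
  have -> : - (eta * ((k * X) ^+ 2 * (2 + k * X) * e))
    = X ^+ 2 * - (eta * k * (2 * (k * e) + X * (k * (k * e)))) by ring.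
  by rewrite ler_wpM2l ?sqr_ge0// -[leRHS]addr0 lerD.
have B : 1 - k * X <= 1 - X * u by rewrite lerD2l lerN2 [k * X]mulrC ler_wpM2l// ltW.
have z0 : 0 < k * X by rewrite mulr_gt0.
have C : eta * (1 + (k * X) ^+ 2 * e) * (1 - k * X) <= eta * (1 + (k * X) ^+ 2 * e) * (1 - X * u).
  rewrite ler_wpM2l// mulr_ge0 ?ltW// addr_gt0// mulr_gt0 ?exprn_gt0//.
  exact: lt_le_trans ltr01 e1.
move=> E; rewrite -{}E in C; move: (le_trans C A).
rewrite -subr_le0 (_ : _ - _ = eta * ((1 + (k * X) ^+ 2 * e) * (1 - k * X)
  + (k * X) ^+ 2 * (2 + k * X) * e)); last by ring.
rewrite pmulr_rle0//; move: z0; move: (k * X) => z z0; clear -z0 e1.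
have D : z ^+ 2 <= z ^+ 2 * e by rewrite ler_peMr ?sqr_ge0.
have G : 0 < 1 - z + 3 * z ^+ 2.
  have := sqr_ge0 (6 * z - 1); clear; move=> ?; lra.
move=> L; lra.
Qed.

(** If f > m x_1 at some point, the perturbed quotient [W] has a maximum above m. Subtracting [eta]
    from [f] keeps that maximum away from the axis and from infinity; the exponential makes the
    differential inequality there strict whatever the bounded drift. *)
Lemma halfplane_bound (f a c : V -> R) (m : R) : smooth f -> continuous a ->
  vanishes a -> vanishes f ->
  (forall x, x 0 0 = 0 -> x 0 1 = 0 -> f x = 0) ->
  (forall x, x 0 1 = 0 -> 0 < x 0 0 ->
    x 0 0 ^+ 2 * (pd 0 (pd 0 f) x + pd 2 (pd 2 f) x) =
    (f x - x 0 0 * pd 0 f x) * (1 - x 0 0 * a x)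
    + x 0 0 ^+ 2 * (c x * pd 2 f x)) -> 0 < m ->
  forall x, x 0 1 = 0 -> 0 < x 0 0 -> f x <= m * x 0 0.
Proof.
move=> sf ca va vf fax feq m0 p py px; rewrite leNgt; apply/negP => fp.
have [U U0 aU] := vanishing_bounded _ ca va.
pose k := U + 1; have k0 : 0 < k by rewrite addr_gt0.
have m2 : 0 < m / 2 by rewrite divr_gt0.
have [N1 N10 fN1] := vf _ m2.
(* Past [rho], [f] is below m/2, and [rho >= 1] turns this into f <= (m/2) x_1: the maximum cannot
   sit at x_1 = [rho]. *)
pose rho := N1 + 1; have rho1 : 1 <= rho by rewrite lerDr ltW.
have far x : rho <= x 0 0 -> `|f x| < m / 2.
  move=> xr; apply: fN1; rewrite (lt_le_trans _ (coord_sqn x 0))//.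
  have : rho <= x 0 0 ^+ 2.
    by rewrite expr2 (le_trans xr)// ler_peMr ?(le_trans rho1)// (le_trans _ xr)// (le_trans ler01).
  by apply: lt_le_trans; rewrite ltrDl.
pose E := expR (k * rho); have E0 : 0 < E by exact: expR_gt0.
(* The first bound keeps the barrier at most m/4 for x_1 <= [rho]; the second gives [m < W p]. *)
pose eta := Num.min (m / 4 / (k * E)) ((f p - m * p 0 0) / 2).
have eta0 : 0 < eta.
  by rewrite lt_min !divr_gt0 ?mulr_gt0// subr_gt0.
have etaE : eta * k * E <= m / 4.
  by rewrite -mulrA -ler_pdivlMr ?mulr_gt0// ge_min lexx.
have etap : eta <= (f p - m * p 0 0) / 2 by rewrite ge_min lexx orbT.
have [N2 N20 fN2] := vf _ eta0.
have mp : 0 < m * p 0 0 by rewrite mulr_gt0.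
have prho : p 0 0 <= rho.
  rewrite leNgt; apply/negP => /ltW pr; have := far _ pr.
  have : m <= m * p 0 0 by rewrite ler_peMr ?(ltW m0)// (le_trans rho1).
  move=> h1 /(le_lt_trans (ler_norm _)) h2; clear -h1 h2 fp m0; lra.
pose ex x := 1 * expR (k * x 0 0).
have sex : smooth ex := smooth_expR_coord _ _ _.
pose W x := (f x - eta) / x 0 0 + eta * k * ex x.
(* The part of the half-plane where f >= [eta] and x_1 <= [rho]. It is bounded since [f] vanishes at
   infinity, and it avoids the axis since [f] is zero there. *)
pose K := [set x : V | f p - f p <= 0 /\ (x 0 0 <= rho /\ (- x 0 0 <= 0 /\ (x 0 1 <= 0 /\ (- x 0 1 <= 0 /\ - f x <= - eta))))].
have c0 : smooth (fun x : V => (x 0 0 : R)) by smth.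
have c1 : smooth (fun x : V => (x 0 1 : R)) by smth.
have cK : compact K.
  apply: (subclosed_compact _ (compact_sqn N2)).
    apply: closedI; first by apply: closed_sublevel; exact: cst_continuous.
    apply: closedI; first by apply: closed_sublevel; exact: smooth_cont c0.
    apply: closedI; first by apply: closed_sublevel; exact: smooth_cont (smoothN c0).
    apply: closedI; first by apply: closed_sublevel; exact: smooth_cont c1.
    apply: closedI; first by apply: closed_sublevel; exact: smooth_cont (smoothN c1).
    by apply: closed_sublevel; exact: smooth_cont (smoothN sf).
  move=> x [_ [_ [_ [_ [_]]]]]; rewrite lerN2 /= => fx.
  rewrite leNgt; apply/negP => /fN2; rewrite ltNge => /negP; apply.
  by rewrite (le_trans fx)// ler_norm.
have Kp x : K x -> 0 < x 0 0 /\ x 0 1 = 0.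
  move=> [_ [_ [x0 [x1 [x1']]]]]; rewrite lerN2 => fx.
  have xy : x 0 1 = 0 by apply/eqP; rewrite eq_le x1 -oppr_le0.
  split => //; rewrite lt0r -oppr_le0 x0 andbT; apply/eqP => xx.
  by move: fx; rewrite fax// leNgt eta0.
have pK : K p.
  rewrite /K /= subrr py !oppr0 lexx prho oppr_le0 (ltW px) lerN2; do 5?split => //.
  by clear -etap fp mp; lra.
have cW x : K x -> {for x, continuous W}.
  move=> /Kp[x0 _].
  have A := continuousB (smooth_cont sf x) (@cst_continuous V R eta x).
  have B := continuousV (lt0r_neq0 x0) (smooth_cont c0 x).
  exact: (continuousD (continuousM A B)
    (continuousM (@cst_continuous V R (eta * k) x) (smooth_cont sex x))).
have [q qK Wq] := compact_max W K p cK pK cW.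
have [q0 q1] := Kp _ qK.
have exE x : 0 < x 0 0 -> x 0 0 <= rho -> 1 <= ex x <= E.
  move=> x0 xr; rewrite /ex mul1r ler_expR ler_pM2l// xr andbT.
  by rewrite -expR0 ler_expR mulr_ge0 ?ltW.
have mW : m < W q.
  apply: (lt_le_trans _ (Wq _ pK)); rewrite /W.
  have A : m < (f p - eta) / p 0 0.
    by rewrite ltr_pdivlMr//; clear -etap fp; lra.
  apply: (lt_le_trans A); rewrite lerDl.
  have ex0 : 0 <= ex p by rewrite /ex mul1r expR_ge0.
  exact: (mulr_ge0 (mulr_ge0 (ltW eta0) (ltW k0)) ex0).
have qr : q 0 0 < rho.
  rewrite ltNge; apply/negP => rq; have := far _ rq => /(le_lt_trans (ler_norm _)) fq.
  have q_rho : q 0 0 <= rho by case: qK => _ [].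
  move: mW; rewrite /W; apply/negP; rewrite -leNgt.
  have /andP[_ eE] := exE _ q0 q_rho.
  have : (f q - eta) / q 0 0 <= m / 2.
    rewrite ler_pdivrMr//.
    have : m / 2 <= m / 2 * q 0 0 by rewrite -[leLHS]mulr1 ler_pM2l// (le_trans rho1).
    by clear -fq eta0; move=> h; lra.
  have : eta * k * ex q <= m / 4 by rewrite (le_trans _ etaE)// ler_wpM2l// mulr_ge0 ?ltW.
  by move: m0; clear; move: ((f q - eta) / q 0 0) (eta * k * ex q) => A B *; lra.
pose lam := W q; have lam0 : 0 < lam by exact: lt_trans mW.
pose g x := x 0 0 * ex x.
(* T - eta = x_1 (W - lam): once the denominator is cleared, the maximum of the quotient becomes a
   maximum of a smooth function. Where f < [eta], outside [K], the inequality T <= eta holds because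
   the barrier is below [lam]. *)
pose T x := f x + (- lam * x 0 0 + eta * k * g x).
have sg : smooth g by rewrite /g; smth.
have sT : smooth T by rewrite /T; smth.
have Tq : T q = eta.
  rewrite /T /lam /W /g mulNr mulrDl divfK ?lt0r_neq0//.
  by clear; move: (f q) (q 0 0) (ex q) => *; ring.
have Tle x : x 0 1 = 0 -> 0 < x 0 0 -> x 0 0 < rho -> T x <= T q.
  move=> x1 x0 xr; rewrite Tq; have /andP[ex1 exE1] := exE _ x0 (ltW xr).
  have [fx|fx] := leP eta (f x).
    have xK : K x.
      by rewrite /K /= subrr x1 !oppr0 lexx (ltW xr) oppr_le0 (ltW x0) lerN2.
    have := Wq _ xK; rewrite -/lam /W -(ler_pM2r x0) mulrDl divfK ?lt0r_neq0//.
    rewrite /T /g; clear; move: (f x) (x 0 0) (ex x) => *; lra.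
  have h1 : eta * k * ex x <= lam.
    rewrite (le_trans (_ : _ <= eta * k * E))//.
      by rewrite ler_wpM2l// mulr_ge0 ?ltW.
    by rewrite (le_trans etaE)// (le_trans _ (ltW mW))//; clear -m0; lra.
  have : x 0 0 * (eta * k * ex x - lam) <= 0 by rewrite pmulr_rle0// subr_le0.
  rewrite /T /g; move: fx; clear; move: (f x) (x 0 0) (ex x) => *; lra.
pose d := Num.min (q 0 0) (rho - q 0 0).
have d0 : 0 < d by rewrite lt_min q0 subr_gt0.
have mx i (t : R) : (i == 1) = false -> `|t| < d -> T (q + t *: delta_mx 0 i) <= T q.
  move=> i1; rewrite lt_min !ltr_norml => /andP[/andP[t1 t2] /andP[t3 t4]].
  apply: Tle; rewrite line_coord ?i1 ?mulr0 ?addr0//.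
  - by case: (i == 0); rewrite ?mulr1 ?mulr0; clear -t1 t2 q0; lra.
  - by case: (i == 0); rewrite ?mulr1 ?mulr0; clear -t3 t4 qr; lra.
have [T0 T00] := line_max _ _ 0 _ (smooth_Cn 2 sT) d0 (fun t => mx 0 t erefl).
have [T2 T22] := line_max _ _ 2 _ (smooth_Cn 2 sT) d0 (fun t => mx 2 t erefl).
have slam : smooth (fun x : V => - lam * x 0 0) by smth.
have sg' : smooth (fun x => eta * k * g x) by smth.
have dT i : pd i T = fun x => pd i f x + (- lam * (i == 0)%:R + eta * k * pd i g x).
  rewrite /T (pdD i sf (smoothD slam sg')) (pdD i slam sg').
  by rewrite (pdZ i _ c0) (pdZ i _ sg) pd_coord.
have ddT i : pd i (pd i T) q = pd i (pd i f) q + eta * k * pd i (pd i g) q.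
  have scst : smooth (fun _ : V => - lam * (i == 0)%:R) by exact: smooth_cst.
  have sdg : smooth (fun x : V => eta * k * pd i g x) by smth.
  rewrite dT (pdD i (smooth_pd sf) (smoothD scst sdg)) (pdD i scst sdg).
  by rewrite pd_cst (pdZ i _ (smooth_pd sg)) add0r.
have dex i : pd i ex = fun x => (i == 0)%:R * k * ex x.
  by rewrite /ex pd_expR_coord; apply/funext => x; ring.
have dg i : pd i g = fun x => (i == 0)%:R * ex x + x 0 0 * ((i == 0)%:R * k * ex x).
  by rewrite /g (pdM i c0 sex) dex pd_coord.
have dg2 : pd 2 g = fun=> 0 by rewrite dg; apply/funext => x; rewrite /=; ring.
have dg0 : pd 0 g = fun x => ex x + k * g x.
  by rewrite dg; apply/funext => x; rewrite /g /=; ring.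
have dg00 : pd 0 (pd 0 g) q = 2 * (k * ex q) + q 0 0 * (k * (k * ex q)).
  have skg : smooth (fun x => k * g x) by smth.
  rewrite dg0 (pdD 0 sex skg) dex (pdZ 0 _ sg) dg0 /g /=; ring.
have f2 : pd 2 f q = 0 by rewrite -T2 dT dg2 /=; ring.
have := feq q q1 q0; rewrite f2 !mulr0 addr0.
have /andP[e1 _] := exE _ q0 (ltW qr).
have aq : a q <= k.
  by rewrite (le_trans (ler_norm _))// (le_trans (aU q))// lerDl.
have Ef : f q = lam * q 0 0 + eta * (1 - k * q 0 0 * ex q).
  move: Tq; rewrite /T /g; clearbody lam eta k.
  by clear; move: (f q) (q 0 0) (ex q) => *; lra.
have Ef0 : pd 0 f q = lam - eta * k * (ex q + q 0 0 * (k * ex q)).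
  move: T0; rewrite dT dg0 /g /=; clearbody lam eta k.
  by clear; move: (pd 0 f q) (q 0 0) (ex q) => *; lra.
have Ef00 : pd 0 (pd 0 f) q <= - (eta * k * (2 * (k * ex q) + q 0 0 * (k * (k * ex q)))).
  move: T00; rewrite ddT dg00; clearbody lam eta k.
  by clear; move: (pd 0 (pd 0 f) q) (q 0 0) (ex q) => *; lra.
have Ef22 : pd 2 (pd 2 f) q <= 0.
  by move: T22; rewrite ddT dg2 pd_cst mulr0 addr0.
exact: (halfplane_scalar _ _ _ _ _ _ _ _ _ _ q0 k0 aq e1 eta0 Ef Ef0 Ef00 Ef22).
Qed.

(* [f / x_1] solves a transport equation for the five-dimensional Laplacian. *)
Lemma halfplane_max_principle (f a c : V -> R) : smooth f -> continuous a ->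
  vanishes a -> vanishes f ->
  (forall x, x 0 0 = 0 -> x 0 1 = 0 -> f x = 0) ->
  (forall x, x 0 1 = 0 -> 0 < x 0 0 ->
    x 0 0 ^+ 2 * (pd 0 (pd 0 f) x + pd 2 (pd 2 f) x) =
    (f x - x 0 0 * pd 0 f x) * (1 - x 0 0 * a x)
    + x 0 0 ^+ 2 * (c x * pd 2 f x)) ->
  forall x, x 0 1 = 0 -> 0 < x 0 0 -> f x <= 0.
Proof.
move=> sf ca va vf fax feq x x1 x0; apply/ler_addgt0Pl => e e0; rewrite addr0.
have m0 : 0 < e / x 0 0 by rewrite divr_gt0.
have := halfplane_bound _ _ _ _ sf ca va vf fax feq m0 _ x1 x0.
by rewrite divfK// lt0r_neq0.
Qed.

End halfplane.

Section no_swirl_liouville.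
Context {R : realType}.
Local Notation V := 'rV[R]_3.
Local Notation radius := Defs.radius.

Lemma no_swirl_liouville (a b c p : V -> R) : axiflow a b c p ->
  (forall x, swirl a b x = 0) -> vanishes a -> vanishes b -> vanishes c ->
  forall x, [/\ a x = 0, b x = 0 & c x = 0].
Proof.
move=> H S0 va vb vc.
have [[sa sb sc _] _ _ _] := H.
have [s0 s1 _] := smooth_vort _ _ _ _ H.
have [_ v1v] := vort_vanishes _ _ _ _ H S0 va vb vc.
have ax (x : V) : x 0 0 = 0 -> x 0 1 = 0 -> vort1 a c x = 0.
  move=> x0 x1; have [] := rot_vort _ _ _ _ H x.
  by rewrite /rot x0 x1 !mul0r subrr => /esym/eqP; rewrite oppr_eq0 => /eqP.
have eq1 := halfplane_eq _ _ _ _ H S0.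
have ca := smooth_cont sa.
have le0 := halfplane_max_principle _ _ _ s1 ca va v1v ax eq1.
have ge0 (x : V) : x 0 1 = 0 -> 0 < x 0 0 -> - vort1 a c x <= 0.
  apply: (halfplane_max_principle (fun y => - vort1 a c y) a c _ ca va).
  - exact: smoothN.
  - exact: vanishesN.
  - by move=> y y0 y1; rewrite ax// oppr0.
  move=> y y1 y0; rewrite !(pdN _ s1) !(pdN _ (smooth_pd s1)).
  rewrite -opprD mulrN eq1//; ring.
have half (x : V) : x 0 1 = 0 -> 0 < x 0 0 -> vort0 b c x = 0 /\ vort1 a c x = 0.
  move=> x1 x0; split; last first.
    by apply/eqP; rewrite eq_le le0//= -oppr_le0 ge0.
  have := vort_tangential _ _ _ _ H S0 x; rewrite x1 mul0r addr0 => /eqP.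
  by rewrite mulf_eq0 gt_eqF//= => /eqP.
(* The two components turn into each other under rotations, but |omega|^2 is invariant and carries
   the vanishing from the half-plane to every point off the axis. *)
pose W y := vort0 b c y * vort0 b c y + vort1 a c y * vort1 a c y.
have sW : smooth W by rewrite /W; smth.
have rW x : rot W x = 0.
  have [r0 r1] := rot_vort _ _ _ _ H x.
  rewrite /W (rotD _ _ _ (smoothM s0 s0) (smoothM s1 s1)).
  by rewrite (rotM _ _ _ s0 s0) (rotM _ _ _ s1 s1) r0 r1; ring.
have W0 x : W x = 0.
  apply: (off_axis_eq0 W (smooth_cont sW)) => {}x r0.
  have [th ->] := polar x r0.
  rewrite (rot_eq0_indep _ (smooth_Cn 1 sW) rW _ _ 0) /W /cyl cos0 sin0 mulr1 mulr0.
  have [y0 y1 _] := vec3E (radius x) 0 (x 0 2).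
  have [|-> ->] := half _ y1; first by rewrite y0.
  by rewrite !mul0r addr0.
have w0 x : vort0 b c x = 0 /\ vort1 a c x = 0.
  move: (W0 x) => /eqP; rewrite /W -!expr2 paddr_eq0 ?sqr_ge0// !sqrf_eq0.
  by move=> /andP[/eqP-> /eqP->].
have E0 : vort0 b c = fun=> 0 by apply/funext => x; have [] := w0 x.
have E1 : vort1 a c = fun=> 0 by apply/funext => x; have [] := w0 x.
have L x : [/\ lap a x = 0, lap b x = 0 & lap c x = 0].
  have [-> -> ->] := no_swirl_lap_curl _ _ _ _ H S0 x.
  by rewrite E0 E1 !pd_cst oppr0 addr0.
have harm f : smooth f -> vanishes f -> (forall x, lap f x = 0) -> forall x, f x = 0.
  move=> sf vf lf x; apply/eqP; rewrite eq_le -[X in _ && X]oppr_le0.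
  rewrite (harmonic_vanishing _ sf vf lf)/=.
  apply: (harmonic_vanishing (fun y => - f y) (smoothN sf) (vanishesN _ vf)).
  by move=> y; rewrite (lapN _ _ sf) lf oppr0.
by move=> x; split; apply: harm => // y; have [] := L y.
Qed.

Lemma decaying_swirl_eq0 (a b c p : V -> R) : axiflow a b c p ->
  vanishes c -> vanishes (swirl a b) -> forall x, swirl a b x = 0.
Proof.
move=> H vc vs x; have [[_ _ sc _] _ _ _] := H.
have ss := smooth_swirl _ _ _ _ H; have cc := smooth_cont sc.
have ax (y : V) : y 0 0 = 0 -> y 0 1 = 0 -> swirl a b y = 0.
  by move=> y0 y1; rewrite /swirl y0 y1 !mul0r subrr.
have E1 := swirl_eq _ _ _ _ H; have E2 := swirl_vort2 _ _ _ _ H.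
apply/eqP; rewrite eq_le -[X in _ && X]oppr_le0.
rewrite (swirl_max_principle _ _ _ _ _ ss vs cc vc E1 E2 ax)/=.
apply: (swirl_max_principle a b c (fun y => - swirl a b y)
  (fun y => - vort2 a b y) (smoothN ss) (vanishesN _ vs) cc vc).
- move=> y; rewrite (lapN _ _ ss) /advect !(pdN _ ss).
  transitivity (- (lap (swirl a b) y - 2 * vort2 a b y)); first by ring.
  by rewrite E1 /advect; ring.
- by move=> y; rewrite !(pdN _ ss) mulrN E2; ring.
- by move=> y y0 y1; rewrite ax// oppr0.
Qed.

(** The products r u_r = x_1 u_1 + x_2 u_2 and r u_theta = x_1 u_2 - x_2 u_1 are smooth across the
    axis and annihilated by [rot]. This is a linear system of determinant r^2 for rot u_1 + u_2 and
    rot u_2 - u_1, solved off the axis and extended by continuity. *)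
Lemma axisymmetric_axiflow (u : V -> V) (p : V -> R) : smooth_field u ->
  smooth p -> axisymmetric u -> steady_NS u p ->
  axiflow (component u 0) (component u 1) (component u 2) p.
Proof.
move=> su sp [ur ut uz] NS.
have [s0 s1 s2] := And3 (su 0) (su 1) (su 2).
split => //.
- by move=> x; have [_] := NS x; rewrite /divergence sum3 !pdE.
- move=> x; have [+ _] := NS x.
  move=> E; have F i : convection u x 0 i + gradient p x 0 i = laplacian u x 0 i.
    by rewrite -E !mxE.
  by split; [have := F 0|have := F 1|have := F 2];
    rewrite !mxE !sum3 /advect /lap !pdE.
pose f (x : V) := x 0 0 * component u 0 x + x 0 1 * component u 1 x.
have sf : smooth f by rewrite /f; smth.
have sg : smooth (swirl (component u 0) (component u 1)) by rewrite /swirl; smth.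
have fE x : 0 < radius x -> f x = radius x * u_r u x.
  move=> r0; have rN0 := lt0r_neq0 r0.
  rewrite /u_r /dot3 sum3 !mxE /= /f /component; move: rN0; clear.
  by move: (radius x) (x 0 0) (x 0 1) (u x 0 0) (u x 0 1) (u x 0 2) => *; field.
have gE x : 0 < radius x ->
    swirl (component u 0) (component u 1) x = radius x * u_theta u x.
  move=> r0; have rN0 := lt0r_neq0 r0.
  rewrite /u_theta /dot3 sum3 !mxE /= /swirl /component; move: rN0; clear.
  by move: (radius x) (x 0 0) (x 0 1) (u x 0 0) (u x 0 1) (u x 0 2) => *; field.
have cE x : component u 2 x = u_z u x.
  by rewrite /u_z /dot3 sum3 !mxE /= !mulr0 mulr1 !add0r.
have rot0 h : smooth h -> indep_theta h -> forall x, rot h x = 0.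
  move=> sh ih; apply: off_axis_eq0; first exact: smooth_cont (smooth_rot _ sh).
  by move=> x r0; exact: indep_theta_rot (smooth_Cn 1 sh) ih r0.
have rf : forall x, rot f x = 0.
  apply: rot0 => // r th th' z r0.
  by rewrite !fE ?radius_cyl//; congr (_ * _); exact: ur.
have rg : forall x, rot (swirl (component u 0) (component u 1)) x = 0.
  apply: rot0 => // r th th' z r0.
  by rewrite !gE ?radius_cyl//; congr (_ * _); exact: ut.
have rc : forall x, rot (component u 2) x = 0.
  by apply: rot0 => // r th th' z r0; rewrite !cE; exact: uz.
have c0 : smooth (fun x : V => (x 0 0 : R)) by smth.
have c1 : smooth (fun x : V => (x 0 1 : R)) by smth.
have A0 x : rot (component u 0) x + component u 1 x = 0 /\
    rot (component u 1) x - component u 0 x = 0.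
  have sA : smooth (fun x => rot (component u 0) x + component u 1 x).
    by have := smooth_rot _ s0 => ?; smth.
  have sB : smooth (fun x => rot (component u 1) x - component u 0 x).
    by have := smooth_rot _ s1 => ?; smth.
  suff K y : 0 < radius y -> rot (component u 0) y + component u 1 y = 0 /\
      rot (component u 1) y - component u 0 y = 0.
    split.
      by apply: (off_axis_eq0 _ (smooth_cont sA)) => y /K[].
    by apply: (off_axis_eq0 _ (smooth_cont sB)) => y /K[].
  rewrite radius_gt0 => r0.
  have c0r : rot (fun x : V => (x 0 0 : R)) y = - y 0 1.
    by rewrite /rot !pd_coord /=; ring.
  have c1r : rot (fun x : V => (x 0 1 : R)) y = y 0 0.
    by rewrite /rot !pd_coord /=; ring.
  have := rf y; rewrite /f (rotD _ _ _ (smoothM c0 s0) (smoothM c1 s1)).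
  rewrite (rotM _ _ _ c0 s0) (rotM _ _ _ c1 s1) c0r c1r.
  have := rg y; rewrite /swirl (rotD _ _ _ (smoothM c0 s1) (smoothN (smoothM c1 s0))).
  rewrite (rotN _ _ (smoothM c1 s0)) (rotM _ _ _ c0 s1) (rotM _ _ _ c1 s0) c0r c1r.
  move: r0; clear.
  move: (y 0 0) (y 0 1) (rot (component u 0) y) (rot (component u 1) y)
    (component u 0 y) (component u 1 y) => s t a b c d r0 e1 e2.
  split; apply: (mulfI r0); rewrite mulr0.
    transitivity (s * (- t * c + s * a + (s * d + t * b))
      - t * (- t * d + s * b - (s * c + t * a))); first by ring.
    by rewrite e1 e2 !mulr0 subr0.
  transitivity (t * (- t * c + s * a + (s * d + t * b))
      + s * (- t * d + s * b - (s * c + t * a))); first by ring.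
  by rewrite e1 e2 !mulr0 addr0.
move=> x; have [e0 e1] := A0 x; split => //.
  by apply/eqP; rewrite -addr_eq0 e0.
exact: subr0_eq.
Qed.

Lemma GammaE (u : V -> V) x :
  Gamma u x = swirl (component u 0) (component u 1) x.
Proof.
rewrite /Gamma /u_theta /dot3 sum3 !mxE /= /swirl /component.
have [r0|] := boolP (0 < radius x).
  have rN0 := lt0r_neq0 r0; move: rN0; clear.
  by move: (radius x) (x 0 0) (x 0 1) (u x 0 0) (u x 0 1) (u x 0 2) => *; field.
rewrite radius_gt0 negbK paddr_eq0 ?sqr_ge0// !sqrf_eq0 => /andP[/eqP x0 /eqP x1].
by rewrite x0 x1 !mul0r oppr0 !mulr0 !addr0 ?mulr0 ?subrr ?subr0 ?oppr0 ?addr0.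
Qed.

Lemma component_vanishes (u : V -> V) i :
  u x @[x --> at_infty R] --> (0 : V) -> vanishes (component u i).
Proof.
move=> u0; apply: cvg_vanishes; rewrite /component.
apply: (@cvg_comp _ _ _ u (fun v : V => v 0 i)) u0 _.
by have := @coord_continuous R 1 3 0 i 0; rewrite /continuous_at mxE.
Qed.

End no_swirl_liouville.

(** * Integration over R^3 *)

Section integration.
Context {R : realType}.
Local Notation mu := (@lebesgue_measure R).

(* Approximate [f (x, y)] by [f (x, floor (n y) / n)]. *)
Lemma caratheodory_measurable d (T : measurableType d) (f : T * R -> R) :
  (forall y, measurable_fun setT (fun x => f (x, y))) ->
  (forall x, continuous (fun y => f (x, y))) -> measurable_fun setT f.
Proof.
move=> mf cf.
pose a (n : nat) (k : int) : R := k%:~R / n.+1%:R.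
pose h (n : nat) (z : T * R) := f (z.1, a n (Num.floor (n.+1%:R * z.2))).
apply: (@measurable_fun_cvg _ _ _ setT h).
  move=> n _ Y mY; rewrite setTI.
  have -> : h n @^-1` Y = \bigcup_(k : int)
     ([set x | Y (f (x, a n k))] `*` [set y | n.+1%:R * y \in `[k%:~R, (k + 1)%:~R[]).
    apply/seteqP; split => [[x y] /= Yh|[x y] [k _] [/= Yk]].
      exists (Num.floor (n.+1%:R * y)) => //=; split => //=.
      by rewrite in_itv /= real_floor_le ?num_real// real_floorD1_gt ?num_real.
    rewrite in_itv /= => /floor_def fk.
    by rewrite /h /= fk.
  apply: countable_bigcupT_measurable; first exact: countableP.
  move=> k; apply: measurableX.
    by have := mf (a n k) measurableT _ mY; rewrite setTI.
  have -> : [set y : R | n.+1%:R * y \in `[k%:~R, (k + 1)%:~R[] =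
    `[k%:~R / n.+1%:R, (k + 1)%:~R / n.+1%:R[%classic.
    apply/seteqP; split => y; rewrite /= !in_itv /=.
      by move=> /andP[? ?]; rewrite ler_pdivrMr// ltr_pdivlMr// ![y * _]mulrC; apply/andP.
    by rewrite ler_pdivrMr// ltr_pdivlMr// ![y * _]mulrC.
  exact: measurable_itv.
move=> [x y] _; rewrite /h /=.
apply: (@cvg_comp _ _ _ (fun n => a n (Num.floor (n.+1%:R * y))) (fun y => f (x, y))); last exact: cf.
apply/cvgrPdist_lt => e e0; near=> n.
have n0 : 0 < n.+1%:R :> R by rewrite ltr0n.
have -> : y - a n (Num.floor (n.+1%:R * y)) =
  (n.+1%:R * y - (Num.floor (n.+1%:R * y))%:~R) / n.+1%:R.
  by rewrite mulrBl [n.+1%:R * y]mulrC mulfK// lt0r_neq0.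
have f1 := real_floor_le (num_real (n.+1%:R * y)).
have f2 := real_floorD1_gt (num_real (n.+1%:R * y)).
rewrite normrM [X in _ * X]gtr0_norm ?invr_gt0// ltr_pdivrMr//.
rewrite ger0_norm ?subr_ge0//.
apply: (@lt_trans _ _ 1); first by rewrite ltrBlDl -(intrD _ _ 1).
rewrite -ltr_pdivrMr// mul1r.
near: n; exact: near_infty_natSinv_lt (PosNum e0).
Unshelve. all: by end_near. Qed.

Lemma is_derive_compact_int (g Z : R -> R) (N : R) : 0 < N -> continuous g ->
  (forall t : R, is_derive t (1 : R) Z (g t)) ->
  (forall t, N <= `|t| -> Z t = 0 /\ g t = 0) ->
  (\int[mu]_t (g t)%:E = 0)%E.
Proof.
move=> N0 cg dZ z0.
have NN : - N < N by rewrite (lt_trans _ N0)// oppr_lt0.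
have -> : (\int[mu]_t (g t)%:E = \int[mu]_(t in `[(- N)%R, N]) (g t)%:E)%E.
  rewrite [RHS]integral_mkcond; apply: eq_integral => t _.
  rewrite patchE; case: ifPn => //; rewrite notin_setE /= in_itv /= -ler_norml => /negP.
  by rewrite -ltNge => /ltW/z0[_ ->].
have cZ : continuous Z.
  by move=> t; have [/derivable1_diffP/differentiable_continuous] := dZ t.
rewrite (@continuous_FTC2 _ g Z)//.
- by rewrite (z0 N _).1 ?(z0 (- N) _).1 ?normrN ?gtr0_norm// subee.
- exact: continuous_subspaceT.
- split.
  + by move=> t _; have [] := dZ t.
  + exact: cvg_at_right_filter (cZ _).
  + exact: cvg_at_left_filter (cZ _).
- by move=> t _; rewrite derive1E; have [_ ->] := dZ t.
Qed.
End integration.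

(* An alias of the product measure: the library does not infer that a product of
   $\sigma$-finite measures is $\sigma$-finite. *)
Definition area (R : realType) :=
  (@lebesgue_measure R \x @lebesgue_measure R)%E.
Arguments area R : clear implicits.

Section area_sigma_finite.
Context {R : realType}.

HB.instance Definition _ := Measure.on (area R).

Let area_sigma_finite : sigma_finite setT (area R).
Proof.
have /sigma_finiteP[F [TF ndF Foo]] := sigma_finiteT (@lebesgue_measure R).
exists (fun n => F n `*` F n).
  rewrite -setXTT TF predeqE => -[x y]; split.
    move=> [/= [n _ Fnx] [k _ Fky]]; exists (maxn n k) => //; split.
    - by move: x Fnx; exact/subsetPset/ndF/leq_maxl.
    - by move: y Fky; exact/subsetPset/ndF/leq_maxr.
  by move=> [n _ []/= ? ?]; split; exists n.
move=> k; have [mF fF] := Foo k; split; first exact: measurableX.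
rewrite /area [ltLHS](product_measure1E lebesgue_measure lebesgue_measure mF mF).
by rewrite lte_mul_pinfty// ge0_fin_numE.
Qed.

HB.instance Definition _ := Measure_isSigmaFinite.Build _ _ _ (area R)
  area_sigma_finite.

End area_sigma_finite.

Section integration3.
Context {R : realType}.
Local Notation V := 'rV[R]_3.
Local Notation mu := (@lebesgue_measure R).
Implicit Types (f g : V -> R).

Definition pack (t : R * R * R) : V := vec3 t.1.1 t.1.2 t.2.

Lemma vec3_line0 (s a b : R) : vec3 s a b = vec3 0 a b + s *: delta_mx 0 0.
Proof.
by apply/rowP => -[[|[|[|//]]] hi]; rewrite !mxE /= ?mulr0 ?mulr1 ?addr0 ?add0r.
Qed.

Lemma vec3_line1 (s a b : R) : vec3 a s b = vec3 a 0 b + s *: delta_mx 0 1.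
Proof.
by apply/rowP => -[[|[|[|//]]] hi]; rewrite !mxE /= ?mulr0 ?mulr1 ?addr0 ?add0r.
Qed.

Lemma vec3_line2 (s a b : R) : vec3 a b s = vec3 a b 0 + s *: delta_mx 0 2.
Proof.
by apply/rowP => -[[|[|[|//]]] hi]; rewrite !mxE /= ?mulr0 ?mulr1 ?addr0 ?add0r.
Qed.

Lemma cont_measurable1 f a b : continuous f ->
  measurable_fun setT (fun s : R => f (vec3 s a b)).
Proof.
move=> cf; apply: continuous_measurable_fun.
by under eq_fun do rewrite vec3_line0; exact: line_cont.
Qed.

Lemma cont_measurable2 f c : continuous f ->
  measurable_fun setT (fun t : R * R => f (vec3 t.1 t.2 c)).
Proof.
move=> cf; apply: caratheodory_measurable => [y|x] /=.
  exact: cont_measurable1.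
by under eq_fun do rewrite vec3_line1; exact: line_cont.
Qed.

Lemma cont_measurable3 f : continuous f -> measurable_fun setT (f \o pack).
Proof.
move=> cf; apply: caratheodory_measurable => [y|x] /=.
  exact: cont_measurable2.
by rewrite /pack /=; under eq_fun do rewrite vec3_line2; exact: line_cont.
Qed.

Lemma integrable_supported d (T : measurableType d)
    (m : {measure set T -> \bar R}) (A : set T) (h : T -> R) (M : R) :
  measurable A -> (m A < +oo)%E -> measurable_fun setT h ->
  (forall t, `|h t| <= M) -> (forall t, ~ A t -> h t = 0) ->
  m.-integrable setT (EFin \o h).
Proof.
move=> mA fA mh hM h0.
have -> : EFin \o h = (EFin \o h) \_ A.
  apply/funext => t; rewrite patchE; case: ifPn => //.
  by rewrite notin_setE => /h0 /= ->.
apply/(integrable_mkcond _ mA); apply: measurable_bounded_integrable => //.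
  exact: measurable_funS mh.
exists M; split; first exact: num_real.
by move=> N MN t _; rewrite /= (le_trans (hM t))// ltW.
Qed.

Definition boxed (N : R) f : Prop :=
  forall (x : V) i, N <= `|x 0 i| -> f x = 0.

Lemma boxed_bounded N f : continuous f -> boxed N f ->
  exists M, forall x, `|f x| <= M.
Proof.
move=> cf bf.
have [|y _|c Kc fc] := compact_max (fun x => `|f x|) _ 0 (compact_sqn (3 * N ^+ 2)).
- by rewrite /= /sqn !mxE expr0n !addr0 mulr_ge0// sqr_ge0.
- apply: (@continuous_comp _ _ _ f); [exact: cf|exact: norm_continuous].
exists `|f c| => x; have [xM|xM] := leP (sqn x) (3 * N ^+ 2); first exact: fc.
suff [i xi] : exists i, N <= `|x 0 i| by rewrite (bf _ _ xi) normr0.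
apply/not_existsP => h; move: xM; apply/negP; rewrite -leNgt.
have hi i : x 0 i ^+ 2 <= N ^+ 2.
  have /negP := h i; rewrite -ltNge => /ltW xi.
  rewrite -real_normK ?num_real// ler_pXn2r ?nnegrE//.
  exact: le_trans (normr_ge0 _) xi.
have := hi 0; have := hi 1; have := hi 2; rewrite /sqn.
by move: (x 0 0) (x 0 1) (x 0 2); clear => *; lra.
Qed.

Lemma integrable_boxed3 N f : continuous f -> boxed N f ->
  (lebesgue3 R).-integrable setT (EFin \o (f \o pack)).
Proof.
move=> cf bf; have [M fM] := boxed_bounded _ _ cf bf.
pose I := `[- N, N]%classic : set R.
have mI : measurable I by exact: measurable_itv.
have fI : (mu I < +oo)%E by rewrite /I lebesgue_measure_itv /=; case: ifP => _; rewrite ltry.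
refine (@integrable_supported _ _ ((mu \x mu) \x mu)%E ((I `*` I) `*` I)
  (f \o pack) M _ _ _ _ _).
- by apply: measurableX => //; exact: measurableX.
- have mII := measurableX mI mI.
  rewrite [ltLHS](product_measure1E (mu \x mu)%E mu mII mI) [X in (X * _)%E](product_measure1E mu mu mI mI).
  rewrite lte_mul_pinfty ?mule_ge0// fin_numM// ge0_fin_numE//.
- exact: cont_measurable3.
- by move=> t; exact: fM.
- move=> t tI; apply/eqP/negPn/negP => /eqP ft; apply: tI.
  have h (i : 'I_3) : pack t 0 i \in `[- N, N].
    rewrite in_itv /= -ler_norml leNgt; apply/negP => /ltW /(bf _ i).
    exact: ft.
  have [e0 e1 e2] := And3 (h 0) (h 1) (h 2).
  by rewrite /pack !mxE /= in e0 e1 e2.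
Qed.

Lemma integrable_boxed2 N f z : continuous f -> boxed N f ->
  (mu \x mu)%E.-integrable setT (fun t : R * R => (f (vec3 t.1 t.2 z))%:E).
Proof.
move=> cf bf; have [M fM] := boxed_bounded _ _ cf bf.
pose I := `[- N, N]%classic : set R.
have mI : measurable I by exact: measurable_itv.
have fI : (mu I < +oo)%E by rewrite /I lebesgue_measure_itv /=; case: ifP => _; rewrite ltry.
refine (@integrable_supported _ _ (mu \x mu)%E (I `*` I)
  (fun t : R * R => f (vec3 t.1 t.2 z)) M _ _ _ _ _).
- exact: measurableX.
- rewrite [ltLHS](product_measure1E mu mu mI mI).
  by rewrite lte_mul_pinfty// ge0_fin_numE.
- exact: cont_measurable2.
- by move=> t; exact: fM.
- move=> t tI; apply/eqP/negPn/negP => /eqP ft; apply: tI.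
  have h (i : 'I_3) : vec3 t.1 t.2 z 0 i \in `[- N, N].
    rewrite in_itv /= -ler_norml leNgt; apply/negP => /ltW /(bf _ i).
    exact: ft.
  have [e0 e1] := conj (h 0) (h 1).
  by rewrite !mxE /= in e0 e1.
Qed.

Lemma integral_prod_eq0 d1 d2 (T1 : measurableType d1) (T2 : measurableType d2)
    (m1 : {sigma_finite_measure set T1 -> \bar R})
    (m2 : {sigma_finite_measure set T2 -> \bar R}) (h : T1 * T2 -> R) :
  (m1 \x m2)%E.-integrable setT (EFin \o h) ->
  (forall y, \int[m1]_x (h (x, y))%:E = 0)%E \/
  (forall x, \int[m2]_y (h (x, y))%:E = 0)%E ->
  (\int[m1 \x m2]_t (h t)%:E = 0)%E.
Proof.
move=> ih [h0|h0].
  by rewrite -(integral21_prod_meas1 ih); apply: integral0_eq => y _; exact: h0.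
by rewrite -(integral12_prod_meas1 ih); apply: integral0_eq => x _; exact: h0.
Qed.

(** Divergence theorem without boundary: by Fubini the integral reduces to lines in direction [i],
    on each of which the fundamental theorem of calculus gives zero. *)
Lemma integral_pd (N : R) f i : 0 < N -> Cn 0 f -> continuous (pd i f) ->
  boxed N f -> boxed N (pd i f) ->
  (\int[lebesgue3 R]_t (pd i f (pack t))%:E = 0)%E.
Proof.
move=> N0 cf cg bf bg; have ig := integrable_boxed3 _ _ cg bg.
have line (v : V) : v 0 i = 0 ->
    (\int[mu]_s (pd i f (v + s *: delta_mx 0 i))%:E = 0)%E.
  move=> v0; apply: (is_derive_compact_int _ (fun s => f (v + s *: delta_mx 0 i)) N) => //.
  - exact: line_cont.
  - by move=> t; exact: line_derive (Cn_derivable cf i).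
  - move=> t Nt; have Nv : N <= `|(v + t *: delta_mx 0 i) 0 i|.
      by rewrite line_coord v0 eqxx mulr1 add0r.
    by split; [exact: bf Nv|exact: bg Nv].
have [iE|iE|iE] := ord3E i; rewrite iE in line cf cg bf bg ig *.
- apply: (@integral_prod_eq0 _ _ _ _ (area R) mu (pd 0 f \o pack) ig); left=> z.
  apply: (integral_prod_eq0 _ _ _ _ _ _ _ (integrable_boxed2 _ _ z cg bg)).
  left=> y /=; rewrite /pack /=; under eq_integral do rewrite vec3_line0.
  by apply: line; rewrite !mxE.
- apply: (@integral_prod_eq0 _ _ _ _ (area R) mu (pd 1 f \o pack) ig); left=> z.
  apply: (integral_prod_eq0 _ _ _ _ _ _ _ (integrable_boxed2 _ _ z cg bg)).
  right=> y /=; rewrite /pack /=; under eq_integral do rewrite vec3_line1.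
  by apply: line; rewrite !mxE.
- apply: (@integral_prod_eq0 _ _ _ _ (area R) mu (pd 2 f \o pack) ig); right=> z.
  rewrite /= /pack /=; under eq_integral do rewrite vec3_line2.
  by apply: line; rewrite !mxE.
Qed.

End integration3.

(** * Truncation and the tested equation *)

Section truncation.
Context {R : realType}.
Local Notation V := 'rV[R]_3.
Implicit Types (f g : V -> R) (x : V) (i j : 'I_3).

Definition pos (s : R) : R := Num.max s 0.

Lemma pos_ge0 s : 0 <= pos s.
Proof. by rewrite le_max lexx orbT. Qed.

Lemma pos_gt0E s : 0 < s -> pos s = s.
Proof. by move=> /ltW s0; rewrite /pos max_l. Qed.

Lemma pos_le0E s : s <= 0 -> pos s = 0.
Proof. by move=> s0; rewrite /pos max_r. Qed.

(** At 0 the difference quotient of the truncated function is dominated by that of [G], which tends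
    to [G' 0 = 0]. *)
Lemma is_derive_pos (G G' : R -> R) :
  (forall t : R, 0 <= t -> is_derive t (1 : R) G (G' t)) -> G 0 = 0 -> G' 0 = 0 ->
  forall s : R, is_derive s (1 : R) (fun t => G (pos t)) (G' (pos s)).
Proof.
move=> dG G0 G'0 s; have [s0|s0|s0] := ltgtP s 0.
- rewrite pos_le0E ?ltW// G'0.
  apply: (@near_eq_is_derive _ _ _ (cst (0 : R))).
  by near=> t; rewrite /= pos_le0E ?G0// ltW//; near: t; exact: lt_nbhsl.
- rewrite pos_gt0E//.
  apply: (@near_eq_is_derive _ _ _ G); last exact: dG _ (ltW s0).
  by near=> t; rewrite /= pos_gt0E//; near: t; exact: lt_nbhsr.
rewrite s0 pos_le0E// G'0.
have [+ E] := dG 0 (lexx 0); rewrite G'0 in E.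
move=> dg; have L : (fun h : R => h^-1 *: ((G \o shift 0) (h *: 1) - G 0)) @ (0 : R)^' --> (0 : R).
  by rewrite -[X in _ --> X]E; exact: dg.
have L' : (fun h : R => h^-1 *: (((fun t => G (pos t)) \o shift 0) (h *: 1)
     - G (pos 0))) @ (0 : R)^' --> (0 : R).
  apply/norm_cvg0P.
  apply: (@squeeze_cvgr _ _ _ _ (fun=> 0)
    (fun h : R => `|h^-1 *: ((G \o shift 0) (h *: 1) - G 0)|)); last 2 first.
  - exact: cvg_cst.
  - exact/norm_cvg0P.
  near=> h; rewrite normr_ge0 /= addr0 [h *: 1]mulr1 (pos_le0E 0)//.
  have [h0|h0] := ltP 0 h; first by rewrite pos_gt0E.
  by rewrite pos_le0E// subrr scaler0 normr0.
by apply: DeriveDef; [apply/cvg_ex; eexists; exact: L'|exact: (cvg_lim _ L')].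
Unshelve. all: by end_near. Qed.

Lemma is_derive_cont (F F' : R -> R) :
  (forall s : R, is_derive s (1 : R) F (F' s)) -> continuous F.
Proof.
by move=> dF s; have [/derivable1_diffP/differentiable_continuous] := dF s.
Qed.

(** The third power is the lowest integer power whose truncation is C^2; the cut-offs built from it
    are differentiated twice. *)
Definition cube (s : R) : R := pos s ^+ 3.
Definition cube1 (s : R) : R := 3 * pos s ^+ 2.
Definition cube2 (s : R) : R := 6 * pos s.

Lemma is_derive_cube s : is_derive s (1 : R) cube (cube1 s).
Proof.
apply: (is_derive_pos (fun t => t ^+ 3) (fun t => 3 * t ^+ 2)).
- by move=> t _; apply: is_derive_eq; rewrite /GRing.scale /=; ring.
- by rewrite expr0n.
- by rewrite expr0n mulr0.
Qed.

Lemma is_derive_cube1 s : is_derive s (1 : R) cube1 (cube2 s).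
Proof.
apply: (is_derive_pos (fun t => 3 * t ^+ 2) (fun t => 6 * t)).
- by move=> t _; apply: is_derive_eq; rewrite /GRing.scale /=; ring.
- by rewrite expr0n mulr0.
- by rewrite mulr0.
Qed.

Lemma continuous_pos : continuous pos.
Proof.
move=> s; apply: (@continuous_max _ _ (fun t : R => t) (fun=> 0)).
  exact: cvg_id.
exact: cvg_cst.
Qed.

(* [conv0 s = t ^ 3 / (1 + t)] at [t = pos s]: convex, C^2 at 0 and at most
   quadratic; [conv1] and [conv2] are its derivatives. *)
Definition conv0 (s : R) : R := (fun t => t ^+ 2 - t + 1 - (1 + t)^-1) (pos s).
Definition conv1 (s : R) : R := (fun t => 2 * t - 1 + (1 + t) ^- 2) (pos s).
Definition conv2 (s : R) : R := (fun t => 2 - 2 * (1 + t) ^- 3) (pos s).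

Lemma is_derive_conv0 s : is_derive s (1 : R) conv0 (conv1 s).
Proof.
apply: (is_derive_pos (fun t => t ^+ 2 - t + 1 - (1 + t)^-1)
  (fun t => 2 * t - 1 + (1 + t) ^- 2)).
- move=> t t0; have t1 : 1 + t != 0 by rewrite lt0r_neq0// ltr_wpDr.
  have dV : is_derive t (1 : R) (fun t : R => (1 + t)^-1) (- (1 + t) ^- 2).
    have d1 : is_derive t (1 : R) (fun t : R => 1 + t) (0 + 1) by apply: is_deriveD.
    have [d e] := d1; apply: DeriveDef; first exact: derivableV.
    by rewrite deriveV// e /GRing.scale /=; ring.
  by apply: is_derive_eq; rewrite /GRing.scale /=; ring.
- by rewrite expr0n /= addr0 invr1; ring.
- by rewrite addr0 expr1n invr1; ring.
Qed.

Lemma is_derive_conv1 s : is_derive s (1 : R) conv1 (conv2 s).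
Proof.
apply: (is_derive_pos (fun t => 2 * t - 1 + (1 + t) ^- 2)
  (fun t => 2 - 2 * (1 + t) ^- 3)).
- move=> t t0; have t1 : 1 + t != 0 by rewrite lt0r_neq0// ltr_wpDr.
  have t2 : (1 + t) ^+ 2 != 0 by rewrite expf_neq0.
  have dV : is_derive t (1 : R) (fun t : R => ((1 + t) ^+ 2)^-1) (- (2 * (1 + t) ^- 3)).
    have d1 : is_derive t (1 : R) (fun t : R => (1 + t) ^+ 2) (2 * (1 + t)).
      by apply: is_derive_eq; rewrite /GRing.scale /=; ring.
    have [d e] := d1; apply: DeriveDef; first exact: derivableV.
    by rewrite deriveV// e /GRing.scale /=; field.
  by apply: is_derive_eq; rewrite /GRing.scale /=; ring.
- by rewrite addr0 expr1n invr1; ring.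
- by rewrite addr0 expr1n invr1; ring.
Qed.

Lemma conv0_bounds s : 0 <= conv0 s <= pos s ^+ 2.
Proof.
rewrite /conv0; have := pos_ge0 s; move: (pos s) => t t0.
have t1 : 0 < 1 + t by rewrite ltr_wpDr.
have -> : t ^+ 2 - t + 1 - (1 + t)^-1 = t ^+ 2 * (t / (1 + t)).
  by field; rewrite lt0r_neq0.
apply/andP; split.
  by rewrite mulr_ge0 ?sqr_ge0 ?divr_ge0// ltW.
by rewrite ler_piMr ?sqr_ge0// ler_pdivrMr// mul1r lerDr.
Qed.

Lemma conv2_ge0 s : 0 <= conv2 s.
Proof.
rewrite /conv2; have := pos_ge0 s; move: (pos s) => t t0.
rewrite subr_ge0 ler_piMr// invf_le1 ?exprn_gt0// ?ltr_wpDr//.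
by rewrite exprn_ege1// lerDl.
Qed.

Lemma conv2_eq0 s : conv2 s = 0 -> pos s = 0.
Proof.
rewrite /conv2; have := pos_ge0 s; move: (pos s) => t; rewrite le_eqVlt.
case/predU1P => [<-//|t0] /eqP; rewrite subr_eq0 => /eqP E.
have : (1 + t) ^- 3 < 1.
  by rewrite invf_lt1 ?exprn_gt0 ?addr_gt0// exprn_egt1// ltrDl.
by rewrite -(@ltr_pM2l _ 2)// -E mulr1 ltxx.
Qed.

Lemma continuous_conv2 : continuous conv2.
Proof.
move=> s; rewrite /conv2.
have c1 : {for s, continuous (fun t => (1 + pos t) ^+ 3)}.
  apply: (@continuous_comp _ _ _ pos (fun t => (1 + t) ^+ 3)); first exact: continuous_pos.
  apply: (is_derive_cont (fun t => (1 + t) ^+ 3) (fun t => 3 * (1 + t) ^+ 2)).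
  by move=> t; apply: is_derive_eq; rewrite /GRing.scale /=; ring.
have n0 : (1 + pos s) ^+ 3 != 0.
  by rewrite expf_neq0// lt0r_neq0// ltr_wpDr// pos_ge0.
have cV := @continuousV R R (fun t => (1 + pos t) ^+ 3) s n0 c1.
exact: (continuousB (@cst_continuous R R (2 : R) s)
  (continuousM (@cst_continuous R R (2 : R) s) cV)).
Qed.

Lemma conv_le0 s : s <= 0 -> [/\ conv0 s = 0, conv1 s = 0 & conv2 s = 0].
Proof.
move=> s0; rewrite /conv0 /conv1 /conv2 pos_le0E// addr0 !expr1n invr1.
by rewrite expr0n /=; split; ring.
Qed.

End truncation.

Section C1_functions.
Context {R : realType}.
Local Notation V := 'rV[R]_3.
Implicit Types (f g : V -> R) (x : V) (i j : 'I_3).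

Definition C1 f : Prop := Cn 0 f /\ forall i, continuous (pd i f).

Lemma smooth_C1 {f} : smooth f -> C1 f.
Proof.
move=> sf; split; first exact: smooth_Cn 0 sf.
by move=> i; exact: smooth_cont (smooth_pd sf).
Qed.

Lemma C1_pdD {f g} i : C1 f -> C1 g ->
  pd i (fun x => f x + g x) = fun x => pd i f x + pd i g x.
Proof. by move=> [cf _] [cg _]; exact: pdD_Cn i cf cg. Qed.

Lemma C1_pdM {f g} i : C1 f -> C1 g ->
  pd i (fun x => f x * g x) = fun x => pd i f x * g x + f x * pd i g x.
Proof. by move=> [cf _] [cg _]; exact: pdM_Cn i cf cg. Qed.

Lemma C1D {f g} : C1 f -> C1 g -> C1 (fun x => f x + g x).
Proof.
move=> [cf pf] [cg pg]; split; first exact: CnD.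
move=> i; rewrite (pdD_Cn i cf cg) => x.
exact: (continuousD (pf i x) (pg i x)).
Qed.

Lemma C1M {f g} : C1 f -> C1 g -> C1 (fun x => f x * g x).
Proof.
move=> [cf pf] [cg pg]; split; first exact: CnM.
move=> i; rewrite (pdM_Cn i cf cg) => x.
exact: (continuousD (continuousM (pf i x) (Cn_cont cg x))
  (continuousM (Cn_cont cf x) (pg i x))).
Qed.

Lemma C1N {f} : C1 f -> C1 (fun x => - f x).
Proof.
move=> cf; rewrite (_ : (fun x => - f x) = fun x => -1 * f x).
  exact: C1M (smooth_C1 (smooth_cst _)) cf.
by apply/funext => x; rewrite mulN1r.
Qed.

Lemma C1_pdN {f} i : C1 f -> pd i (fun x => - f x) = fun x => - pd i f x.
Proof.
move=> cf; rewrite (_ : (fun x => - f x) = fun x => -1 * f x).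
  rewrite (C1_pdM i (smooth_C1 (smooth_cst (-1))) cf) pd_cst.
  by apply/funext => x; rewrite mul0r add0r mulN1r.
by apply/funext => x; rewrite mulN1r.
Qed.

Lemma pd_compE (F F' : R -> R) n f i :
  (forall t : R, is_derive t (1 : R) F (F' t)) -> Cn n f ->
  pd i (fun y => F (f y)) = fun x => F' (f x) * pd i f x.
Proof.
move=> dF cf; apply/funext => x.
by have [_ <-] := pd_comp _ _ _ _ i dF cf x; rewrite pdE.
Qed.

Lemma C1_comp (F F' : R -> R) f :
  (forall t : R, is_derive t (1 : R) F (F' t)) -> continuous F' -> C1 f ->
  C1 (fun y => F (f y)).
Proof.
move=> dF cF' [cf pf]; split.
  split => //.
    move=> x; apply: (@continuous_comp _ _ _ f F); first exact: (Cn_cont cf x).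
    exact: (is_derive_cont _ _ dF).
  by move=> i x; have [] := pd_comp _ _ _ _ i dF cf x.
move=> i; rewrite (pd_compE _ _ _ _ i dF cf) => x.
apply: (continuousM _ (pf i x)).
by apply: (@continuous_comp _ _ _ f F'); [exact: (Cn_cont cf x)|exact: cF'].
Qed.

Lemma pd_inv f n i : Cn n f -> (forall x, f x != 0) ->
  pd i (fun x => (f x)^-1) = fun x => - (f x) ^- 2 * pd i f x.
Proof.
move=> cf f0; apply/funext => x; rewrite !pdE /partial.
by rewrite (deriveV (f0 x) (Cn_derivable cf i x)).
Qed.

Lemma C1V f : C1 f -> (forall x, f x != 0) -> C1 (fun x => (f x)^-1).
Proof.
move=> [cf pf] f0; split.
  split => //.
    by move=> x; exact: (@continuousV _ _ f x (f0 x) (Cn_cont cf x)).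
  by move=> i x; exact: derivableV (f0 x) (Cn_derivable cf i x).
move=> i; rewrite (pd_inv _ _ i cf f0) => x.
have c2 : {for x, continuous (fun y => f y * f y)}.
  exact: (continuousM (Cn_cont cf x) (Cn_cont cf x)).
have n2 : f x * f x != 0 by rewrite mulf_neq0.
have cV := @continuousV R V (fun y => f y * f y) x n2 c2.
exact: (continuousM (continuousN cV) (pf i x)).
Qed.

Lemma cont_cube2 : continuous (@cube2 R).
Proof.
move=> s.
exact: (continuousM (@cst_continuous R R (6 : R) s) (continuous_pos s)).
Qed.

Lemma cont_cube1 : continuous (@cube1 R).
Proof. exact: is_derive_cont is_derive_cube1. Qed.

End C1_functions.

Ltac c1 := cbv beta; lazymatch goal with
  | |- C1 (fun x => GRing.add (@?f x) (@?g x)) => refine (C1D (f:=f) (g:=g) _ _); c1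
  | |- C1 (fun x => GRing.mul (@?f x) (@?g x)) => refine (C1M (f:=f) (g:=g) _ _); c1
  | |- C1 (fun x => GRing.opp (@?f x)) => refine (C1N (f:=f) _); c1
  | H : C1 ?f |- C1 ?f => exact H
  | H : smooth ?f |- C1 ?f => exact (smooth_C1 H)
  | |- C1 (fun x => fun_of_matrix x _ _) => exact: (smooth_C1 (smooth_coord _))
  | |- C1 (fun _ => ?a) => exact: (smooth_C1 (smooth_cst a))
  | |- C1 (fun x => pd ?i ?f x) => refine (smooth_C1 (smooth_pd (i:=i) (f:=f) _)); smth
  | |- C1 (fun x => ?f x) => change (C1 f); c1
  | |- _ => idtac
  end.

(** * Cut-offs and the flux of the tested equation *)

Section cutoffs.
Context {R : realType}.
Local Notation V := 'rV[R]_3.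
Implicit Types (f g : V -> R) (x : V) (i j : 'I_3).

(** On the face of the box [f] may be nonzero on the inner side; one unit further out it is zero in
    a whole neighbourhood. *)
Lemma boxed_pd (N : R) f i : Cn 0 f -> boxed N f -> boxed (N + 1) (pd i f).
Proof.
move=> cf bf x j xj.
have D := line_derive i f x 0 (Cn_derivable cf i).
rewrite scale0r addr0 in D.
have D0 : is_derive (0 : R) (1 : R) (fun s => f (x + s *: delta_mx 0 i)) 0.
  apply: (@near_eq_is_derive _ _ _ (cst (0 : R))).
  near=> s; rewrite /=; apply/esym/(bf _ j).
  rewrite line_coord -(@lerD2r _ 1) (le_trans xj)//.
  rewrite -{1}[x 0 j](addrK (s * (i == j)%:R)) (le_trans (ler_normB _ _))// lerD2l.
  have s1 : `|s| <= 1.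
    by near: s; exists 1 => //= z /=; rewrite sub0r normrN => /ltW.
  by case: (i == j); rewrite ?mulr1 ?mulr0 ?normr0.
by have [_ <-] := D; have [_ ->] := D0.
Unshelve. all: by end_near. Qed.

(** With k = s^2 the support is |x_i| <= 1/s, so that s is the inverse of the truncation distance. A
    product of such factors has its support in a box, which suits integration one coordinate at a
    time. *)
Definition cutoff (k : R) i x : R := cube (1 - k * (x 0 i * x 0 i)).
Definition cutoff1 (k : R) i x : R :=
  cube1 (1 - k * (x 0 i * x 0 i)) * (- (2 * k * x 0 i)).
Definition cutoff2 (k : R) i x : R :=
  cube2 (1 - k * (x 0 i * x 0 i)) * (2 * k * x 0 i) ^+ 2
  - 2 * k * cube1 (1 - k * (x 0 i * x 0 i)).

Lemma C1_cutoff k i : C1 (cutoff k i).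
Proof.
apply: (C1_comp cube cube1 (fun x => 1 - k * (x 0 i * x 0 i)) is_derive_cube cont_cube1).
c1.
Qed.

Lemma C1_cutoff1 k i : C1 (cutoff1 k i).
Proof.
have h : C1 (fun x => cube1 (1 - k * (x 0 i * x 0 i))).
  apply: (C1_comp cube1 cube2 (fun x => 1 - k * (x 0 i * x 0 i)) is_derive_cube1 cont_cube2).
  c1.
rewrite /cutoff1; c1.
Qed.

Lemma pd_bump k i j : pd j (fun x : V => 1 - k * (x 0 i * x 0 i))
  = fun x => - (2 * k * x 0 i) * (j == i)%:R.
Proof.
have s : smooth (fun x : V => (x 0 i : R)) by exact: smooth_coord.
rewrite pdB; [|smth|smth]; rewrite pdZ; last smth.
by rewrite (pdM j s s) pd_cst pd_coord; apply/funext => x; ring.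
Qed.

Lemma pd_cutoff k i j : pd j (cutoff k i) = fun x => cutoff1 k i x * (j == i)%:R.
Proof.
have s : smooth (fun x : V => 1 - k * (x 0 i * x 0 i)) by smth.
rewrite (pd_compE _ _ _ _ j is_derive_cube (smooth_Cn 0 s)) pd_bump.
by apply/funext => x; rewrite /cutoff1; ring.
Qed.

Lemma pd_cutoff1 k i : pd i (cutoff1 k i) = cutoff2 k i.
Proof.
have s : smooth (fun x : V => 1 - k * (x 0 i * x 0 i)) by smth.
have h : C1 (fun x => cube1 (1 - k * (x 0 i * x 0 i))).
  by apply: (C1_comp cube1 cube2 (fun x => 1 - k * (x 0 i * x 0 i)) is_derive_cube1 cont_cube2);
    c1.
have sx : smooth (fun x : V => 2 * k * x 0 i) by smth.
have E : pd i (fun x : V => - (2 * k * x 0 i)) = fun x => - (2 * k).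
  by rewrite (pdN i sx) (pdZ i _ (smooth_coord i)) pd_coord eqxx mulr1.
rewrite (C1_pdM i h (smooth_C1 (smoothN sx))).
rewrite (pd_compE _ _ _ _ i is_derive_cube1 (smooth_Cn 0 s)) pd_bump E.
by apply/funext => x; rewrite eqxx /cutoff2 /=; ring.
Qed.

End cutoffs.

Section flux_field.
Context {R : realType}.
Local Notation V := 'rV[R]_3.
Implicit Types (f g : V -> R) (x : V) (i j : 'I_3).

Definition bump (k : R) x : R := cutoff k 0 x * cutoff k 1 x * cutoff k 2 x.
Definition bump1 (k : R) i x : R :=
  (if i == 0 then cutoff1 k 0 x else cutoff k 0 x) *
  (if i == 1 then cutoff1 k 1 x else cutoff k 1 x) *
  (if i == 2 then cutoff1 k 2 x else cutoff k 2 x).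
Definition bump2 (k : R) i x : R :=
  (if i == 0 then cutoff2 k 0 x else cutoff k 0 x) *
  (if i == 1 then cutoff2 k 1 x else cutoff k 1 x) *
  (if i == 2 then cutoff2 k 2 x else cutoff k 2 x).

Lemma C1_bump k : C1 (bump k).
Proof. by have h i := C1_cutoff k i; rewrite /bump; apply: C1M => //; apply: C1M. Qed.

Lemma C1_bump1 k i : C1 (bump1 k i).
Proof.
have h j := C1_cutoff k j; have h1 j := C1_cutoff1 k j.
rewrite /bump1; have [->|->|->] := ord3E i; rewrite /=;
  by apply: C1M => //; apply: C1M.
Qed.

Lemma pd_bumpE k i : pd i (bump k) = bump1 k i.
Proof.
have h j := C1_cutoff k j.
rewrite /bump (C1_pdM i (C1M (h 0) (h 1)) (h 2)) (C1_pdM i (h 0) (h 1)) !pd_cutoff.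
by apply/funext => x; rewrite /bump1; have [->|->|->] := ord3E i; rewrite /=; ring.
Qed.

Lemma pd_bump1 k i : pd i (bump1 k i) = bump2 k i.
Proof.
have h j := C1_cutoff k j; have h1 j := C1_cutoff1 k j.
rewrite /bump1; have [->|->|->] := ord3E i; rewrite /=.
- rewrite (C1_pdM 0 (C1M (h1 0) (h 1)) (h 2)) (C1_pdM 0 (h1 0) (h 1)) !pd_cutoff pd_cutoff1.
  by apply/funext => x; rewrite /bump2 /=; ring.
- rewrite (C1_pdM 1 (C1M (h 0) (h1 1)) (h 2)) (C1_pdM 1 (h 0) (h1 1)) !pd_cutoff pd_cutoff1.
  by apply/funext => x; rewrite /bump2 /=; ring.
- rewrite (C1_pdM 2 (C1M (h 0) (h 1)) (h1 2)) (C1_pdM 2 (h 0) (h 1)) !pd_cutoff pd_cutoff1.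
  by apply/funext => x; rewrite /bump2 /=; ring.
Qed.

(** Equal to 1/r^2 where f >= d. The truncated cube keeps the denominator positive on the axis,
    where f = 0 < d, and the function stays C^1 on the whole space. *)
Definition invden f (d : R) x : R :=
  (x 0 0 * x 0 0 + x 0 1 * x 0 1 + cube (d - f x))^-1.

Lemma invden_neq0 f (d : R) x : 0 < d -> (forall y : V, y 0 0 = 0 -> y 0 1 = 0 -> f y = 0) ->
  x 0 0 * x 0 0 + x 0 1 * x 0 1 + cube (d - f x) != 0.
Proof.
move=> d0 f0; rewrite -!expr2.
have c0 : 0 <= cube (d - f x) by rewrite exprn_ge0// pos_ge0.
rewrite paddr_eq0 ?addr_ge0 ?sqr_ge0// paddr_eq0 ?sqr_ge0// !sqrf_eq0.
apply/negP => /andP[/andP[/eqP x0 /eqP x1]]; apply/negP.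
by rewrite f0// subr0 /cube pos_gt0E// expf_neq0// lt0r_neq0.
Qed.

(** Selects the two horizontal directions, those of the field e_r / r = (x_1, x_2, 0) / r^2. *)
Definition fluxJ i : R := ((i == 0) || (i == 1))%:R.

(* The divergence of this field is the tested equation; the truncation makes it
   vanish near the axis, where [invden] replaces the singular [1 / r ^ 2]. *)
Definition flux f (u : 'I_3 -> V -> R) (k d : R) i x : R :=
  bump k x * (conv1 (f x - d) * pd i f x) - conv0 (f x - d) * bump1 k i x
  - 2 * fluxJ i * (bump k x * conv0 (f x - d) * (x 0 i * invden f d x))
  - bump k x * conv0 (f x - d) * u i x.

Variables (f : V -> R) (u : 'I_3 -> V -> R) (w : V -> R) (k d : R).
Hypothesis sf : smooth f.
Hypothesis su : forall i, smooth (u i).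
Hypothesis d0 : 0 < d.
Hypothesis f0 : forall y : V, y 0 0 = 0 -> y 0 1 = 0 -> f y = 0.
Hypothesis div0 : forall x, pd 0 (u 0) x + pd 1 (u 1) x + pd 2 (u 2) x = 0.
Hypothesis eqf : forall x, lap f x - 2 * w x = advect (u 0) (u 1) (u 2) f x.
Hypothesis eqw : forall x, (x 0 0 ^+ 2 + x 0 1 ^+ 2) * w x
     = x 0 0 * pd 0 f x + x 0 1 * pd 1 f x.

Let sfd : smooth (fun x => f x - d). Proof. by smth. Qed.

Let pd_fd i : pd i (fun x => f x - d) = pd i f.
Proof.
by rewrite pdB; [|smth|smth]; rewrite pd_cst; apply/funext => x; rewrite subr0.
Qed.

Let C1_E : C1 (fun x => conv0 (f x - d)).
Proof.
exact: (C1_comp conv0 conv1 (fun x => f x - d) is_derive_conv0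
  (is_derive_cont _ _ is_derive_conv1) (smooth_C1 sfd)).
Qed.

Let C1_E1 : C1 (fun x => conv1 (f x - d)).
Proof.
exact: (C1_comp conv1 conv2 (fun x => f x - d) is_derive_conv1
  continuous_conv2 (smooth_C1 sfd)).
Qed.

Let pd_E i : pd i (fun x => conv0 (f x - d)) = fun x => conv1 (f x - d) * pd i f x.
Proof. by rewrite (pd_compE _ _ _ _ i is_derive_conv0 (smooth_Cn 0 sfd)) pd_fd. Qed.

Let pd_E1 i : pd i (fun x => conv1 (f x - d)) = fun x => conv2 (f x - d) * pd i f x.
Proof. by rewrite (pd_compE _ _ _ _ i is_derive_conv1 (smooth_Cn 0 sfd)) pd_fd. Qed.

Let C1_den : C1 (fun x => x 0 0 * x 0 0 + x 0 1 * x 0 1 + cube (d - f x)).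
Proof.
have s : smooth (fun x => d - f x) by smth.
have h := C1_comp _ _ _ is_derive_cube cont_cube1 (smooth_C1 s).
by c1.
Qed.

Lemma C1_invden : C1 (invden f d).
Proof. by apply: (C1V _ C1_den) => x; exact: invden_neq0. Qed.

Lemma pd_invden i x : d < f x ->
  pd i (invden f d) x = - (invden f d x) ^+ 2 * (2 * fluxJ i * x 0 i).
Proof.
move=> df.
have s : smooth (fun x => d - f x) by smth.
have h := C1_comp _ _ _ is_derive_cube cont_cube1 (smooth_C1 s).
have sr : smooth (fun x : V => x 0 0 * x 0 0 + x 0 1 * x 0 1) by smth.
rewrite /invden (pd_inv _ _ i C1_den.1); last by move=> y; exact: invden_neq0.
rewrite (C1_pdD i (smooth_C1 sr) h) (pd_compE _ _ _ _ i is_derive_cube (smooth_Cn 0 s)).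
have -> : cube1 (d - f x) = 0.
  by rewrite /cube1 pos_le0E ?subr_le0 ?ltW// expr0n mulr0.
have s0 : smooth (fun x : V => (x 0 0 : R)) by smth.
have s1 : smooth (fun x : V => (x 0 1 : R)) by smth.
rewrite mul0r addr0 (pdD i (smoothM s0 s0) (smoothM s1 s1)) (pdM i s0 s0) (pdM i s1 s1).
rewrite !pd_coord exprVn /fluxJ.
move: (_ ^-1) => v; have [->|->|->] := ord3E i; rewrite /=; ring.
Qed.

Lemma C1_flux i : C1 (flux f u k d i).
Proof.
have ? := C1_bump k; have ? := C1_bump1 k i; have ? := C1_invden.
have ? := C1_E; have ? := C1_E1; have ? := su i.
have ? := smooth_C1 (smooth_pd (i := i) sf).
rewrite /flux; c1.
Qed.

Lemma pd_flux i x : pd i (flux f u k d i) x =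
  bump1 k i x * (conv1 (f x - d) * pd i f x)
  + bump k x * (conv2 (f x - d) * pd i f x * pd i f x + conv1 (f x - d) * pd i (pd i f) x)
  - (conv1 (f x - d) * pd i f x * bump1 k i x + conv0 (f x - d) * bump2 k i x)
  - 2 * fluxJ i * ((bump1 k i x * conv0 (f x - d) + bump k x * (conv1 (f x - d) * pd i f x)) * (x 0 i * invden f d x)
     + bump k x * conv0 (f x - d) * (invden f d x + x 0 i * pd i (invden f d) x))
  - ((bump1 k i x * conv0 (f x - d) + bump k x * (conv1 (f x - d) * pd i f x)) * u i x
     + bump k x * conv0 (f x - d) * pd i (u i) x).
Proof.
have c1 := C1_bump k; have c2 := C1_bump1 k i; have c3 := C1_invden.
have c4 := C1_E; have c5 := C1_E1; have c6 := smooth_C1 (su i).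
have c7 := smooth_C1 (smooth_pd (i := i) sf).
have c8 := smooth_C1 (smooth_coord (R := R) i).
have A := C1M c1 (C1M c5 c7). have B := C1M c4 c2.
have C' := C1M c1 c4. have D := C1M C' (C1M c8 c3).
have F := C1M C' c6. have G := C1M (smooth_C1 (smooth_cst (2 * fluxJ i))) D.
have AB := C1D A (C1N B).
rewrite /flux (C1_pdD i (C1D AB (C1N G)) (C1N F)) (C1_pdD i AB (C1N G)).
rewrite (C1_pdD i A (C1N B)) (C1_pdN i B) (C1_pdN i G) (C1_pdN i F).
rewrite (C1_pdM i c1 (C1M c5 c7)) (C1_pdM i c5 c7) (C1_pdM i c4 c2).
rewrite (C1_pdM i (smooth_C1 (smooth_cst (2 * fluxJ i))) D) pd_cst.
rewrite (C1_pdM i C' (C1M c8 c3)) (C1_pdM i c8 c3) (C1_pdM i C' c6) (C1_pdM i c1 c4).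
by rewrite pd_E pd_E1 pd_bumpE pd_bump1 pd_coord eqxx /=; ring.
Qed.

Definition source x : R := bump k x * (conv2 (f x - d) * dotgrad f f x).

Definition remainder x : R := conv0 (f x - d) *
  (bump2 k 0 x + bump2 k 1 x + bump2 k 2 x
   + 2 * invden f d x * (x 0 0 * bump1 k 0 x + x 0 1 * bump1 k 1 x)
   + (u 0 x * bump1 k 0 x + u 1 x * bump1 k 1 x + u 2 x * bump1 k 2 x)).

Lemma div_flux x :
  pd 0 (flux f u k d 0) x + pd 1 (flux f u k d 1) x + pd 2 (flux f u k d 2) x
  = source x - remainder x.
Proof.
rewrite !pd_flux /source /remainder /dotgrad.
have [fd|fd] := leP (f x - d) 0.
  by have [-> -> ->] := conv_le0 _ fd; ring.
have df : d < f x by rewrite -subr_gt0.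
rewrite !pd_invden// /fluxJ /=.
have J1 : (x 0 0 * x 0 0 + x 0 1 * x 0 1) * invden f d x = 1.
  rewrite /invden; have := invden_neq0 f d x d0 f0.
  rewrite /cube pos_le0E ?subr_le0 ?ltW// expr0n addr0 => n0.
  by rewrite mulfV.
have e2 : w x = invden f d x * (x 0 0 * pd 0 f x + x 0 1 * pd 1 f x).
  by rewrite -eqw !expr2 mulrA [invden _ _ _ * _]mulrC J1 mul1r.
have e1 : lap f x - 2 * (invden f d x * (x 0 0 * pd 0 f x + x 0 1 * pd 1 f x))
    - advect (u 0) (u 1) (u 2) f x = 0.
  by rewrite -e2 eqf subrr.
rewrite /lap /advect in e1; have e3 := div0 x; apply: subr0_eq.
have J0 : 1 - (x 0 0 * x 0 0 + x 0 1 * x 0 1) * invden f d x = 0 by rewrite J1 subrr.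
(* The three zeros are, in order, the equation for [f], the relation r^2 [invden] = 1 and div u = 0,
   with the multipliers under which they enter the divergence. *)
transitivity (bump k x * conv1 (f x - d) * 0
   - 4 * bump k x * conv0 (f x - d) * invden f d x * 0
   - bump k x * conv0 (f x - d) * 0); last by rewrite !mulr0 !subr0.
by rewrite -{1}e1 -{1}J0 -{1}e3; ring.
Qed.
End flux_field.

(** * Bounds on the cut-offs and on the remainder *)

Section flux_estimates.
Context {R : realType}.
Local Notation V := 'rV[R]_3.
Implicit Types (x : V) (i j : 'I_3).

Lemma cutoff_bounds (s x : R) : 0 <= s ->
  [/\ 0 <= pos (1 - s ^+ 2 * (x * x)) <= 1,
    s * `|x| <= 1 \/ pos (1 - s ^+ 2 * (x * x)) = 0 &
    s ^+ 2 * (x * x) <= 1 \/ pos (1 - s ^+ 2 * (x * x)) = 0].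
Proof.
move=> s0; have p0 : 0 <= s ^+ 2 * (x * x) by rewrite mulr_ge0 ?sqr_ge0// -expr2 sqr_ge0.
have h : s ^+ 2 * (x * x) <= 1 \/ pos (1 - s ^+ 2 * (x * x)) = 0.
  have [h|h] := leP (s ^+ 2 * (x * x)) 1; first by left.
  by right; rewrite pos_le0E// subr_le0 ltW.
split => //.
  by rewrite pos_ge0 /pos ge_max ler01 andbT lerBlDr lerDl.
case: h => h; [left|by right].
rewrite -(@ler_pXn2r _ 2) ?nnegrE ?mulr_ge0// expr1n exprMn.
by rewrite real_normK ?num_real// [x ^+ 2]expr2.
Qed.

(** The third bound keeps the factor x_i^2: summed over the horizontal directions it is r^2, which
    [invden] absorbs, so the singular drift costs no negative power of r. *)
Lemma cutoff_estimates (s : R) i x : 0 <= s ->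
  [/\ 0 <= cutoff (s ^+ 2) i x <= 1, `|cutoff1 (s ^+ 2) i x| <= 6 * s,
   `|x 0 i * cutoff1 (s ^+ 2) i x| <= 6 * s ^+ 2 * (x 0 i * x 0 i) &
   `|cutoff2 (s ^+ 2) i x| <= 30 * s ^+ 2].
Proof.
move=> s0; have [] := cutoff_bounds s (x 0 i) s0.
rewrite /cutoff /cutoff1 /cutoff2 /cube /cube1 /cube2; set t := pos _.
move=> /andP[t0 t1] h1 h2; have s2 : 0 <= s ^+ 2 by rewrite sqr_ge0.
have xx : 0 <= x 0 i * x 0 i by rewrite -expr2 sqr_ge0.
have t2 : 0 <= t ^+ 2 <= 1 by rewrite sqr_ge0 expr_le1.
split.
- by rewrite exprn_ge0//= expr_le1.
- case: h1 => [h1|->]; last by rewrite expr0n mulr0 mul0r normr0 mulr_ge0.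
  have -> : 3 * t ^+ 2 * - (2 * s ^+ 2 * x 0 i) = - (6 * s * (t ^+ 2 * (s * x 0 i))) by ring.
  rewrite normrN normrM ger0_norm ?mulr_ge0// ler_piMr ?mulr_ge0//.
  case/andP: t2 => t2 t2'; rewrite normrM ger0_norm// mulr_ile1//.
  by rewrite normrM (ger0_norm s0).
- have -> : x 0 i * (3 * t ^+ 2 * - (2 * s ^+ 2 * x 0 i))
    = - (6 * s ^+ 2 * (x 0 i * x 0 i) * t ^+ 2) by ring.
  have q : 0 <= 6 * s ^+ 2 * (x 0 i * x 0 i) by exact: (mulr_ge0 (mulr_ge0 (ler0n R 6) s2) xx).
  case/andP: t2 => t2 t2'.
  by rewrite normrN (ger0_norm (mulr_ge0 q t2)) ler_piMr.
- case: h2 => [h2|->]; last first.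
    by rewrite expr0n !mulr0 mul0r subrr normr0 mulr_ge0.
  have -> : 6 * t * (2 * s ^+ 2 * x 0 i) ^+ 2 - 2 * s ^+ 2 * (3 * t ^+ 2)
    = 6 * s ^+ 2 * (4 * (t * (s ^+ 2 * (x 0 i * x 0 i))) - t ^+ 2) by ring.
  have z0 : 0 <= s ^+ 2 * (x 0 i * x 0 i) by rewrite mulr_ge0// -expr2 sqr_ge0.
  have z1 : 0 <= t * (s ^+ 2 * (x 0 i * x 0 i)) <= 1 by rewrite mulr_ge0// mulr_ile1.
  have -> : 30 * s ^+ 2 = 6 * s ^+ 2 * 5 by ring.
  rewrite normrM ger0_norm ?mulr_ge0// ler_wpM2l ?mulr_ge0//.
  move: z1 t2; move: (t * _) (t ^+ 2) => A B; clear => /andP[? ?] /andP[? ?].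
  by rewrite ler_norml; apply/andP; split; lra.
Qed.

Lemma prod3_le (A B C M : R) : `|A| <= M -> 0 <= B <= 1 -> 0 <= C <= 1 ->
  [/\ `|A * B * C| <= M, `|B * A * C| <= M & `|B * C * A| <= M].
Proof.
move=> AM /andP[B0 B1] /andP[C0 C1].
have h : `|A * (B * C)| <= M.
  rewrite normrM (le_trans _ AM)// ler_piMr// ger0_norm ?mulr_ge0// mulr_ile1//.
split; [rewrite -mulrA//|rewrite [B * A]mulrC -mulrA//|by rewrite mulrC].
Qed.

Lemma bump_estimates (s : R) x : 0 <= s ->
  [/\ 0 <= bump (s ^+ 2) x <= 1, forall i, `|bump1 (s ^+ 2) i x| <= 6 * s,
   forall i, `|x 0 i * bump1 (s ^+ 2) i x| <= 6 * s ^+ 2 * (x 0 i * x 0 i) &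
   forall i, `|bump2 (s ^+ 2) i x| <= 30 * s ^+ 2].
Proof.
move=> s0; have E i := cutoff_estimates s i x s0.
have c i : 0 <= cutoff (s ^+ 2) i x <= 1 by have [] := E i.
split.
- have /andP[a0 a1] := c 0; have /andP[b0 b1] := c 1; have /andP[c0 c1] := c 2.
  have ab0 := mulr_ge0 a0 b0; have ab1 := mulr_ile1 a0 b0 a1 b1.
  by rewrite /bump (mulr_ge0 ab0 c0) (mulr_ile1 ab0 c0 ab1 c1).
- move=> i; have [_ e _ _] := E i; rewrite /bump1; move: e.
  have [->|->|->] := ord3E i => /= e.
  + by have [] := prod3_le _ _ _ _ e (c 1) (c 2).
  + by have [] := prod3_le _ _ _ _ e (c 0) (c 2).
  + by have [] := prod3_le _ _ _ _ e (c 0) (c 1).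
- move=> i; have [_ _ e _] := E i; rewrite /bump1; move: e.
  have [->|->|->] := ord3E i => /= e.
  + have [h _ _] := prod3_le _ _ _ _ e (c 1) (c 2).
    rewrite (_ : _ * _ = x 0 0 * cutoff1 (s ^+ 2) 0 x * cutoff (s ^+ 2) 1 x * cutoff (s ^+ 2) 2 x)//; ring.
  + have [_ h _] := prod3_le _ _ _ _ e (c 0) (c 2).
    rewrite (_ : _ * _ = cutoff (s ^+ 2) 0 x * (x 0 1 * cutoff1 (s ^+ 2) 1 x) * cutoff (s ^+ 2) 2 x)//; ring.
  + have [_ _ h] := prod3_le _ _ _ _ e (c 0) (c 1).
    rewrite (_ : _ * _ = cutoff (s ^+ 2) 0 x * cutoff (s ^+ 2) 1 x * (x 0 2 * cutoff1 (s ^+ 2) 2 x))//; ring.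
- move=> i; have [_ _ _ e] := E i; rewrite /bump2; move: e.
  have [->|->|->] := ord3E i => /= e.
  + by have [] := prod3_le _ _ _ _ e (c 1) (c 2).
  + by have [] := prod3_le _ _ _ _ e (c 0) (c 2).
  + by have [] := prod3_le _ _ _ _ e (c 0) (c 1).
Qed.

Lemma invden_bound f (d : R) x :
  0 <= invden f d x /\ invden f d x * (x 0 0 * x 0 0 + x 0 1 * x 0 1) <= 1.
Proof.
have r0 : 0 <= x 0 0 * x 0 0 + x 0 1 * x 0 1 by rewrite addr_ge0// -expr2 sqr_ge0.
have c0 : 0 <= cube (d - f x) by rewrite exprn_ge0// pos_ge0.
rewrite /invden; split; first by rewrite invr_ge0 addr_ge0.
have [->|n0] := eqVneq (x 0 0 * x 0 0 + x 0 1 * x 0 1 + cube (d - f x)) 0.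
  by rewrite invr0 mul0r.
by rewrite mulrC ler_pdivrMr ?mul1r ?lerDl// lt0r n0 addr_ge0.
Qed.

(** The constants are 102 = 3 * 30 + 12, from the second derivatives of the cut-off and from the
    drift e_r / r, and 18 U = 3 * 6 U from the velocity. The first group is of order s^2, which s <=
    1 reduces to s. *)
Lemma remainder_bound f (u : 'I_3 -> V -> R) (s d U : R) x : 0 <= s <= 1 -> 0 <= U ->
  (forall i y, `|u i y| <= U) ->
  `|remainder f u (s ^+ 2) d x| <= (102 + 18 * U) * s * conv0 (f x - d).
Proof.
move=> /andP[s0 s1] U0 uU; have [_ b1 xb1 b2] := bump_estimates s x s0.
have [J0 J1] := invden_bound f d x.
have /andP[c0 _] := conv0_bounds (f x - d).
rewrite /remainder normrM (ger0_norm c0) [leRHS]mulrC ler_wpM2l//.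
have ss : s ^+ 2 <= s by rewrite expr2 ler_piMr.
have B i : `|u i x * bump1 (s ^+ 2) i x| <= U * (6 * s).
  by rewrite normrM ler_pM.
have Q : `|2 * invden f d x * (x 0 0 * bump1 (s ^+ 2) 0 x + x 0 1 * bump1 (s ^+ 2) 1 x)| <= 12 * s ^+ 2.
  rewrite normrM ger0_norm ?mulr_ge0//.
  have h : `|x 0 0 * bump1 (s ^+ 2) 0 x + x 0 1 * bump1 (s ^+ 2) 1 x|
     <= 6 * s ^+ 2 * (x 0 0 * x 0 0 + x 0 1 * x 0 1).
    by rewrite mulrDr (le_trans (ler_normD _ _))// lerD.
  have J2 : 0 <= 2 * invden f d x by rewrite mulr_ge0.
  rewrite (le_trans (ler_wpM2l J2 h))//.
  have -> : 2 * invden f d x * (6 * s ^+ 2 * (x 0 0 * x 0 0 + x 0 1 * x 0 1))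
    = 12 * s ^+ 2 * (invden f d x * (x 0 0 * x 0 0 + x 0 1 * x 0 1)) by ring.
  by rewrite ler_piMr// mulr_ge0// sqr_ge0.
have := b2 0; have := b2 1; have := b2 2; have := B 0; have := B 1; have := B 2.
move: Q ss; set z := 2 * invden _ _ _ * _.
move: (u 0 x * _) (u 1 x * _) (u 2 x * _) (bump2 _ 0 x) (bump2 _ 1 x) (bump2 _ 2 x) => q0 q1 q2 p0 p1 p2.
clearbody z; clear.
rewrite !ler_norml => /andP[? ?] ? /andP[? ?] /andP[? ?] /andP[? ?] /andP[? ?] /andP[? ?] /andP[? ?].
by apply/andP; split; lra.
Qed.

End flux_estimates.

(** * Integrable swirl *)

Section box_integrals.
Context {R : realType}.
Local Notation V := 'rV[R]_3.
Local Notation mu := (@lebesgue_measure R).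
Implicit Types (f g : V -> R) (x y : V) (i j : 'I_3).

Lemma bump_support (s : R) x i : 0 < s -> s^-1 <= `|x 0 i| ->
  bump (s ^+ 2) x = 0 /\ forall j, bump1 (s ^+ 2) j x = 0.
Proof.
move=> s0 sx.
have p0 : pos (1 - s ^+ 2 * (x 0 i * x 0 i)) = 0.
  rewrite pos_le0E// subr_le0 -(expr2 (x 0 i)) -exprMn.
  rewrite -real_normK ?num_real// normrM (gtr0_norm s0) exprn_ege1//.
  by rewrite mulrC -ler_pdivrMr// div1r.
have c0 : cutoff (s ^+ 2) i x = 0 by rewrite /cutoff /cube p0 expr0n.
have c1 : cutoff1 (s ^+ 2) i x = 0 by rewrite /cutoff1 /cube1 p0 expr0n mulr0 mul0r.
split=> [|j].
  by rewrite /bump; move: c0; have [->|->|->] := ord3E i => ->; rewrite ?mulr0 ?mul0r.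
rewrite /bump1; move: c0 c1; have [->|->|->] := ord3E i => -> ->.
- by rewrite if_same !mul0r.
- by rewrite if_same mulr0 mul0r.
- by rewrite if_same mulr0.
Qed.

(** On the box each 1 - s^2 x_i^2 is at least 1/2, so each of the three factors is at least 1/8,
    uniformly in small [s]. *)
Lemma bump_ge (s B : R) x : 0 <= s -> s ^+ 2 * B ^+ 2 <= 2^-1 ->
  (forall i, `|x 0 i| <= B) -> 8^-1 ^+ 3 <= bump (s ^+ 2) x.
Proof.
move=> s0 sB xB.
have c i : 8^-1 <= cutoff (s ^+ 2) i x.
  have h : 2^-1 <= 1 - s ^+ 2 * (x 0 i * x 0 i).
    have B0 : `|x 0 i| <= B := xB i.
    have : x 0 i * x 0 i <= B ^+ 2.
      rewrite -expr2 -real_normK ?num_real// ler_pXn2r ?nnegrE//.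
      exact: le_trans (normr_ge0 _) B0.
    move=> /(ler_wpM2l (sqr_ge0 s)) => h.
    by move: (le_trans h sB); move: (_ * _) => z; clear; lra.
  have h0 : 0 < 1 - s ^+ 2 * (x 0 i * x 0 i) by rewrite (lt_le_trans _ h)// invr_gt0.
  rewrite /cutoff /cube pos_gt0E//.
  have -> : 8^-1 = (2^-1 : R) ^+ 3 by field.
  by rewrite ler_pXn2r// nnegrE ?invr_ge0// ltW.
have e0 : 0 <= 8^-1 :> R by rewrite invr_ge0.
have -> : 8^-1 ^+ 3 = 8^-1 * 8^-1 * 8^-1 :> R by ring.
have h01 : 8^-1 * 8^-1 <= cutoff (s ^+ 2) 0 x * cutoff (s ^+ 2) 1 x by exact: ler_pM.
by rewrite /bump; apply: ler_pM => //; exact: mulr_ge0.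
Qed.

Lemma integral_box_ge g x (e c : R) : continuous g -> (forall y, 0 <= g y) ->
  0 < e -> 0 <= c -> (forall y, (forall i, `|y 0 i - x 0 i| <= e) -> c <= g y) ->
  ((c * e ^+ 3)%:E <= \int[lebesgue3 R]_t (g (pack t))%:E)%E.
Proof.
move=> cg g0 e0 c0 gc.
pose I i := `[x 0 i, x 0 i + e]%classic : set R.
have mI i : measurable (I i) by exact: measurable_itv.
have muI i : mu (I i) = e%:E.
  by rewrite /I lebesgue_measure_itv /= lte_fin ltrDl e0 -EFinB addrAC subrr add0r.
pose A := (I 0 `*` I 1) `*` I 2.
have mA2 := measurableX (mI 0) (mI 1).
have mA : measurable A := measurableX mA2 (mI 2).
have muA : (((mu \x mu) \x mu) A = (e ^+ 3)%:E)%E.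
  rewrite [LHS](product_measure1E (mu \x mu)%E mu mA2 (mI 2)).
  rewrite [X in (X * _)%E](product_measure1E mu mu (mI 0) (mI 1)).
  rewrite [X in (X * _ * _)%E](muI 0) [X in (_ * X * _)%E](muI 1) [X in (_ * X)%E](muI 2).
  by rewrite -!EFinM -expr2 -exprSr.
have mg : measurable_fun setT (EFin \o (g \o pack)).
  by apply/measurable_EFinP; exact: cont_measurable3.
have g0' t : (0 <= (g (pack t))%:E)%E by rewrite lee_fin.
apply: (@le_trans _ _ (\int[lebesgue3 R]_(t in A) (g (pack t))%:E)%E); last first.
  apply: ge0_subset_integral => //; exact: mA.
rewrite EFinM -muA -(@integral_cst _ _ _ ((mu \x mu) \x mu)%E A mA c%:E).
apply: ge0_le_integral.
- exact: mA.
- by move=> t _; rewrite lee_fin.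
- exact: measurable_cst.
- exact: (measurable_funS measurableT).
- move=> t [[/= t0 t1] t2]; rewrite lee_fin; apply: gc => i.
  have h (a b : R) : b \in `[a, a + e] -> `|b - a| <= e.
    by rewrite in_itv /= ler_norml => /andP[? ?]; apply/andP; split; lra.
  by have [->|->|->] := ord3E i; rewrite !mxE /=; exact: h.
Qed.

End box_integrals.

Section null_perturbation.
Context d (T : measurableType d) {R : realType} (m : {measure set T -> \bar R}).

(** The functions [p0], [p1], [p2] are to be the three terms of a divergence: a pointwise comparison
    modulo the divergence becomes a comparison of integrals. *)
Lemma integral_le_null (h p0 p1 p2 g : T -> R) :
  m.-integrable setT (EFin \o h) -> m.-integrable setT (EFin \o p0) ->
  m.-integrable setT (EFin \o p1) -> m.-integrable setT (EFin \o p2) ->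
  (\int[m]_t (p0 t)%:E = 0)%E -> (\int[m]_t (p1 t)%:E = 0)%E ->
  (\int[m]_t (p2 t)%:E = 0)%E -> m.-integrable setT (EFin \o g) ->
  (forall t, h t - (p0 t + p1 t + p2 t) <= g t) ->
  (\int[m]_t (h t)%:E <= \int[m]_t (g t)%:E)%E.
Proof.
move=> ih i0 i1 i2 z0 z1 z2 ig hg.
have i01 : m.-integrable setT (EFin \o (fun t => p0 t + p1 t)).
  by have := integrableD measurableT i0 i1; congr (_.-integrable _ _).
have i012 : m.-integrable setT (EFin \o (fun t => p0 t + p1 t + p2 t)).
  by have := integrableD measurableT i01 i2; congr (_.-integrable _ _).
have ihp : m.-integrable setT (EFin \o (fun t => h t - (p0 t + p1 t + p2 t))).
  by have := integrableB measurableT ih i012; congr (_.-integrable _ _).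
apply: (@le_trans _ _ (\int[m]_t (h t - (p0 t + p1 t + p2 t))%:E)%E); last first.
  by apply: le_integral => // t _; rewrite lee_fin.
have E012 : (\int[m]_t (p0 t + p1 t + p2 t)%:E = 0)%E.
  have e2 := integralD_EFin measurableT i01 i2.
  have e1 := integralD_EFin measurableT i0 i1.
  rewrite /= in e1 e2; rewrite [LHS]e2 z2 adde0.
  by rewrite [LHS]e1 z0 z1 adde0.
have e3 := integralB_EFin measurableT ih i012; rewrite /= in e3.
by rewrite e3 E012 sube0.
Qed.

End null_perturbation.

Section dissipation.
Context {R : realType}.
Local Notation V := 'rV[R]_3.
Local Notation mu := (@lebesgue_measure R).
Implicit Types (f g w : V -> R) (u : 'I_3 -> V -> R) (x y : V) (i j : 'I_3).

Lemma boxed_flux f u (s d : R) i : 0 < s -> boxed s^-1 (flux f u (s ^+ 2) d i).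
Proof.
move=> s0 x j xj; have [b0 b1] := bump_support s x j s0 xj.
by rewrite /flux b0 b1; ring.
Qed.

Definition dissipation f (d : R) x : R := conv2 (f x - d) * dotgrad f f x.

Lemma dissipation_ge0 f d x : 0 <= dissipation f d x.
Proof.
by rewrite mulr_ge0 ?conv2_ge0// /dotgrad -!expr2 !addr_ge0 ?sqr_ge0.
Qed.

Lemma continuous_dissipation f d : smooth f -> continuous (dissipation f d).
Proof.
move=> sf x; have s1 : smooth (fun x => f x - d) by smth.
have s2 : smooth (dotgrad f f) by rewrite /dotgrad; smth.
apply: continuousM (smooth_cont s2 x).
apply: (@continuous_comp _ _ _ (fun x => f x - d) conv2).
  exact: smooth_cont s1 x.
exact: continuous_conv2.
Qed.

Lemma continuous_source f k d : smooth f -> continuous (source f k d).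
Proof.
move=> sf x.
exact: (continuousM (Cn_cont (C1_bump k).1 x) (continuous_dissipation f d sf x)).
Qed.

Lemma boxed_source f (s d : R) : 0 < s -> boxed s^-1 (source f (s ^+ 2) d).
Proof.
move=> s0 x j xj; have [b0 _] := bump_support s x j s0 xj.
by rewrite /source b0 mul0r.
Qed.

Lemma boxed_le (N M : R) f : N <= M -> boxed N f -> boxed M f.
Proof. by move=> NM bf x i Mx; apply: (bf x i); exact: le_trans Mx. Qed.

Lemma integral_source_le f u w (s d U : R) :
  smooth f -> (forall i, smooth (u i)) -> 0 < d ->
  (forall y : V, y 0 0 = 0 -> y 0 1 = 0 -> f y = 0) ->
  (forall x, pd 0 (u 0) x + pd 1 (u 1) x + pd 2 (u 2) x = 0) ->
  (forall x, lap f x - 2 * w x = advect (u 0) (u 1) (u 2) f x) ->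
  (forall x, (x 0 0 ^+ 2 + x 0 1 ^+ 2) * w x
     = x 0 0 * pd 0 f x + x 0 1 * pd 1 f x) ->
  0 <= U -> (forall i y, `|u i y| <= U) -> 0 < s <= 1 ->
  (lebesgue3 R).-integrable setT (fun t => (conv0 (f (pack t) - d))%:E) ->
  (\int[lebesgue3 R]_t (source f (s ^+ 2) d (pack t))%:E <=
   ((102 + 18 * U) * s)%:E * \int[lebesgue3 R]_t (conv0 (f (pack t) - d))%:E)%E.
Proof.
move=> sf su d0 f0 div0 eqf eqw U0 uU /andP[s0 s1] ic.
(* The flux is supported in the box of size 1/s, its derivatives by [boxed_pd] in the box of size
   [N]. *)
pose N := s^-1 + 1.
have N0 : 0 < N by rewrite addr_gt0 ?invr_gt0.
have cF i := C1_flux f u (s ^+ 2) d sf su d0 f0 i.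
have bF i := boxed_flux f u s d i s0.
have sN : s^-1 <= N by rewrite lerDl.
have bF1 i := boxed_le _ _ _ sN (bF i).
have bpF i := boxed_pd _ _ i (cF i).1 (bF i).
have ip i := integrable_boxed3 _ _ ((cF i).2 i) (bpF i).
have p0 i := integral_pd N _ i N0 (cF i).1 ((cF i).2 i) (bF1 i) (bpF i).
have iS := integrable_boxed3 _ _ (continuous_source f (s ^+ 2) d sf) (boxed_source f s d s0).
have E x := div_flux f u w (s ^+ 2) d sf su d0 f0 div0 eqf eqw x.
rewrite -(integralZl measurableT ic).
refine (@integral_le_null _ _ _ ((mu \x mu) \x mu)%E
  (source f (s ^+ 2) d \o pack) _ _ _
  (fun t => (102 + 18 * U) * s * conv0 (f (pack t) - d))
  iS (ip 0) (ip 1) (ip 2) (p0 0) (p0 1) (p0 2) _ _).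
  exact: (integrableZl measurableT ((102 + 18 * U) * s) ic).
move=> t; rewrite /= E opprB addrC subrK.
apply: le_trans (ler_norm _) _.
by apply: remainder_bound; rewrite // (ltW s0).
Qed.

End dissipation.

Section Lq_liouville.
Context {R : realType}.
Local Notation V := 'rV[R]_3.
Implicit Types (f g w : V -> R) (u : 'I_3 -> V -> R) (x y : V) (i j : 'I_3).

(** This is where q >= 2 enters. For t <= d the left side is zero; for t > d, (t - d)^2 <= d^2
    (t/d)^2 and t/d >= 1, so the exponent can be raised to q. *)
Lemma conv0_le_powR (q d t : R) : 2 <= q -> 0 < d ->
  conv0 (t - d) <= d ^+ 2 * (d^-1 `^ q * `|t| `^ q).
Proof.
move=> q2 d0; have /andP[_ h] := conv0_bounds (t - d); apply: (le_trans h).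
have [td|td] := leP (t - d) 0.
  by rewrite pos_le0E// expr0n mulr_ge0 ?sqr_ge0// mulr_ge0 ?powR_ge0.
have dt : d < t by rewrite -subr_gt0.
have t0 := lt_trans d0 dt.
rewrite pos_gt0E// -powRM ?invr_ge0 ?(ltW d0)// gtr0_norm// [_^-1 * t]mulrC.
have h1 : (t / d) ^+ 2 <= (t / d) `^ q.
  have td1 : 1 <= t / d by rewrite ler_pdivlMr// mul1r ltW.
  rewrite -powR_mulrn; last by rewrite divr_ge0// ltW.
  exact: (ler_powR td1 q2).
apply: (le_trans _ (ler_wpM2l (sqr_ge0 d) h1)).
rewrite -exprMn [d * _]mulrC divfK ?lt0r_neq0// ler_pXn2r ?nnegrE ?(ltW td) ?(ltW t0)//.
by rewrite lerBlDr lerDl ltW.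
Qed.

Lemma integrable_conv0 f (q d : R) : continuous f -> 2 <= q -> Lq3 q f -> 0 < d ->
  (lebesgue3 R).-integrable setT (fun t => (conv0 (f (pack t) - d))%:E).
Proof.
move=> cf q2 Lf d0.
have q1 : 1 <= q by rewrite (le_trans _ q2)// ler1n.
have iq := Lfun_integrable q1 Lf.
have iZ := integrableZl measurableT (d ^+ 2 * d^-1 `^ q) iq.
apply: le_integrable iZ => //.
  apply/measurable_EFinP.
  apply: (cont_measurable3 (fun x => conv0 (f x - d))) => x.
  apply: (@continuous_comp _ _ _ (fun x => f x - d) conv0).
    exact: (continuousB (cf x) (@cst_continuous V R d x)).
  exact: is_derive_cont is_derive_conv0 _.
move=> t _; rewrite -EFinM !abse_EFin lee_fin.
have /andP[h _] := conv0_bounds (f (pack t) - d).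
have := conv0_le_powR q d (f (pack t)) q2 d0; rewrite (ger0_norm h) => H.
rewrite -mulrA (le_trans H)//; exact: ler_norm.
Qed.

Lemma small_multiples_le0 (a K r : R) : 0 < r -> 0 <= K ->
  (forall s, 0 < s <= r -> a <= s * K) -> a <= 0.
Proof.
move=> r0 K0 aK; rewrite leNgt; apply/negP => a0.
have K1 : 0 < 2 * (K + 1) by rewrite mulr_gt0// ltr_wpDl.
pose s := Num.min r (a / (2 * (K + 1))).
have s0 : 0 < s by rewrite lt_min r0 divr_gt0.
have := aK s; rewrite s0 ge_min lexx => /(_ isT); apply/negP; rewrite -ltNge.
have sa : s * (2 * (K + 1)) <= a.
  by rewrite -ler_pdivlMr// ge_min lexx orbT.
have := mulr_ge0 (ltW s0) K0; move: sa s0; move: s => s; clear -a0.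
by rewrite mulrDr mulrDr => *; nra.
Qed.

(** If the dissipation were positive at [x], it would be at least half that value on a box, where
    the cut-off stays above 8^-3 for all small s; but by [integral_source_le] the integral of their
    product is at most K s. *)
Lemma dissipation_eq0 f u w (q d U : R) :
  smooth f -> (forall i, smooth (u i)) -> 0 < d ->
  (forall y : V, y 0 0 = 0 -> y 0 1 = 0 -> f y = 0) ->
  (forall x, pd 0 (u 0) x + pd 1 (u 1) x + pd 2 (u 2) x = 0) ->
  (forall x, lap f x - 2 * w x = advect (u 0) (u 1) (u 2) f x) ->
  (forall x, (x 0 0 ^+ 2 + x 0 1 ^+ 2) * w x
     = x 0 0 * pd 0 f x + x 0 1 * pd 1 f x) ->
  0 <= U -> (forall i y, `|u i y| <= U) -> 2 <= q -> Lq3 q f ->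
  forall x, dissipation f d x = 0.
Proof.
move=> sf su d0 f0 div0 eqf eqw U0 uU q2 Lf x.
have ic := integrable_conv0 f q d (smooth_cont sf) q2 Lf d0.
have cg := continuous_dissipation f d sf.
apply/eqP; rewrite eq_le dissipation_ge0 andbT leNgt; apply/negP => g0.
pose c := dissipation f d x / 2.
have c0 : 0 < c by rewrite divr_gt0.
have [e e0 eP] := cont_box _ x _ cg c0.
pose e' := e / 2.
have e'0 : 0 < e' by rewrite divr_gt0.
have ee : e' < e by rewrite /e' ltr_pdivrMr// ltr_pMr// ltr1n.
have gc y : (forall i, `|y 0 i - x 0 i| <= e') -> c <= dissipation f d y.
  move=> h; have := eP y (fun k => le_lt_trans (h k) ee).
  rewrite ltr_norml /c => /andP[+ _].
  by move: (dissipation f d x) (dissipation f d y); clear => *; lra.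
pose B := `|x 0 0| + `|x 0 1| + `|x 0 2| + e'.
have xB y : (forall i, `|y 0 i - x 0 i| <= e') -> forall i, `|y 0 i| <= B.
  move=> h i; have hi : `|y 0 i| <= `|x 0 i| + e'.
    by rewrite -[y 0 i](subrK (x 0 i)) addrC (le_trans (ler_normD _ _))// lerD2l.
  rewrite (le_trans hi)// lerD2r.
  have := normr_ge0 (x 0 0); have := normr_ge0 (x 0 1); have := normr_ge0 (x 0 2).
  have [->|->|->] := ord3E i; move: (`|x 0 0|) (`|x 0 1|) (`|x 0 2|); clear; move=> *; lra.
have B0 : 0 < B by rewrite ltr_wpDl// !addr_ge0.
pose I := fine (\int[lebesgue3 R]_t (conv0 (f (pack t) - d))%:E)%E.
have IE : (\int[lebesgue3 R]_t (conv0 (f (pack t) - d))%:E = I%:E)%E.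
  by rewrite /I fineK//; exact: (integrable_fin_num measurableT ic).
have I0 : 0 <= I.
  rewrite -lee_fin -IE; apply: integral_ge0 => t _; rewrite lee_fin.
  by have /andP[] := conv0_bounds (f (pack t) - d).
pose K := (102 + 18 * U) * I.
have K0 : 0 <= K by rewrite mulr_ge0// addr_ge0// mulr_ge0.
(* The bound 1 is required by [integral_source_le]; 1 / (2 B) gives s B <= 1/2, enough for [bump_ge]
   on the box. *)
pose r := Num.min 1 (2 * B)^-1.
have r0 : 0 < r by rewrite lt_min ltr01 invr_gt0 mulr_gt0.
suff : (8^-1 ^+ 3 * c) * e' ^+ 3 <= 0.
  apply/negP; rewrite -ltNge; apply: mulr_gt0; last exact: exprn_gt0.
  by rewrite mulr_gt0// exprn_gt0// invr_gt0.
apply: (small_multiples_le0 _ K r r0 K0) => s /andP[s0]; rewrite le_min => /andP[s1 sB].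
have sB2 : s ^+ 2 * B ^+ 2 <= 2^-1.
  have h : s * B <= 2^-1.
    have := ler_wpM2r (ltW B0) sB; rewrite invfM mulfVK ?lt0r_neq0//.
  have h0 : 0 <= s * B by rewrite mulr_ge0// ltW.
  rewrite -exprMn (@le_trans _ _ (2^-1 ^+ 2))//; first by rewrite ler_pXn2r ?nnegrE.
  by rewrite expr2 ler_piMr// invf_le1// ler1n.
have s01 : 0 < s <= 1 by rewrite s0.
have S := integral_source_le f u w s d U sf su d0 f0 div0 eqf eqw U0 uU s01 ic.
have L : ((8^-1 ^+ 3 * c * e' ^+ 3)%:E <=
    \int[lebesgue3 R]_t (source f (s ^+ 2) d (pack t))%:E)%E.
  apply: (integral_box_ge _ x) => //.
  - exact: continuous_source.
  - move=> y; have [/andP[b0 _] _ _ _] := bump_estimates s y (ltW s0).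
    exact: mulr_ge0 b0 (dissipation_ge0 _ _ _).
  - by rewrite mulr_ge0 ?(ltW c0)// exprn_ge0// invr_ge0.
  - move=> y hy; have b := bump_ge s B y (ltW s0) sB2 (xB y hy).
    by apply: (ler_pM _ (ltW c0) b (gc y hy)); rewrite exprn_ge0// invr_ge0.
have := le_trans L S; rewrite IE -EFinM lee_fin => h.
by rewrite (le_trans h)// /K [s * _]mulrCA mulrA.
Qed.

(** The positive part of f - d has a corner, so its cube is used. The gradient 3 (f - d)_+^2 grad f
    is zero wherever the dissipation is, for then (f - d)_+ or grad f vanishes. The cube is thus
    constant, and it is zero at the origin, which lies on the axis. *)
Lemma Lq_swirl_le0 f u w (q U : R) :
  smooth f -> (forall i, smooth (u i)) ->
  (forall y : V, y 0 0 = 0 -> y 0 1 = 0 -> f y = 0) ->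
  (forall x, pd 0 (u 0) x + pd 1 (u 1) x + pd 2 (u 2) x = 0) ->
  (forall x, lap f x - 2 * w x = advect (u 0) (u 1) (u 2) f x) ->
  (forall x, (x 0 0 ^+ 2 + x 0 1 ^+ 2) * w x
     = x 0 0 * pd 0 f x + x 0 1 * pd 1 f x) ->
  0 <= U -> (forall i y, `|u i y| <= U) -> 2 <= q -> Lq3 q f ->
  forall x, f x <= 0.
Proof.
move=> sf su f0 div0 eqf eqw U0 uU q2 Lf x.
apply/ler_addgt0Pl => d d0; rewrite addr0.
have D0 := dissipation_eq0 f u w q d U sf su d0 f0 div0 eqf eqw U0 uU q2 Lf.
have sd : smooth (fun x => f x - d) by smth.
have cC : C1 (fun x => cube (f x - d)).
  exact: (C1_comp cube cube1 _ is_derive_cube cont_cube1 (smooth_C1 sd)).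
have P0 i y : pd i (fun x => cube (f x - d)) y = 0.
  rewrite (pd_compE _ _ _ _ i is_derive_cube (smooth_Cn 0 sd)).
  rewrite pdB; [|smth|smth]; rewrite pd_cst subr0.
  have /eqP := D0 y; rewrite /dissipation mulf_eq0 => /orP[/eqP/conv2_eq0 p0|].
    by rewrite /cube1 p0 expr0n mulr0 mul0r.
  rewrite /dotgrad -!expr2 !paddr_eq0 ?addr_ge0 ?sqr_ge0// !sqrf_eq0.
  move=> /andP[/andP[/eqP g0 /eqP g1] /eqP g2].
  by have [->|->|->] := ord3E i; rewrite ?g0 ?g1 ?g2 mulr0.
have := partials_eq0_cst _ cC.1 P0 x.
have -> : cube (f 0 - d) = 0.
  by rewrite /cube (f0 0) ?mxE// sub0r pos_le0E ?oppr_le0 ?(ltW d0)// expr0n.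
move=> /eqP; rewrite /cube expf_eq0 /= => /eqP p0.
by rewrite -subr_le0 -[leRHS]p0 /pos le_max lexx.
Qed.

Lemma Lq_swirl_eq0 (a b c p : V -> R) (q : R) : axiflow a b c p ->
  vanishes a -> vanishes b -> vanishes c -> 2 <= q -> Lq3 q (swirl a b) ->
  forall x, swirl a b x = 0.
Proof.
move=> H va vb vc q2 Ls x; have [[sa sb sc _] div0 _ _] := H.
have ss := smooth_swirl _ _ _ _ H.
have E1 := swirl_eq _ _ _ _ H; have E2 := swirl_vort2 _ _ _ _ H.
have ax (y : V) : y 0 0 = 0 -> y 0 1 = 0 -> swirl a b y = 0.
  by move=> y0 y1; rewrite /swirl y0 y1 !mul0r subrr.
have [A A0 aA] := vanishing_bounded _ (smooth_cont sa) va.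
have [B B0 bB] := vanishing_bounded _ (smooth_cont sb) vb.
have [C C0 cC] := vanishing_bounded _ (smooth_cont sc) vc.
pose u (i : 'I_3) : V -> R := if i == 0 then a else if i == 1 then b else c.
have su i : smooth (u i).
  by rewrite /u; case: ifP => _; [exact: sa|case: ifP => _; [exact: sb|exact: sc]].
pose U := A + B + C.
have U0 : 0 <= U by rewrite !addr_ge0// ltW.
have uU i y : `|u i y| <= U.
  have := aA y; have := bB y; have := cC y; move: A0 B0 C0; rewrite /u /U.
  by case: ifP => _; [|case: ifP => _];
    move: (`|_ y|) (`|_ y|) (`|_ y|); clear => *; lra.
have Ls' : Lq3 q (fun x => - swirl a b x) by exact: (Lfun_oppr_closed Ls).
apply/eqP; rewrite eq_le -[X in _ && X]oppr_le0.
rewrite (Lq_swirl_le0 _ u (vort2 a b) q U ss su ax div0 E1 E2 U0 uU q2 Ls)/=.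
apply: (Lq_swirl_le0 (fun y => - swirl a b y) u (fun y => - vort2 a b y) q U
  (smoothN ss) su _ div0 _ _ U0 uU q2 Ls').
- by move=> y y0 y1; rewrite ax// oppr0.
- move=> y; rewrite (lapN _ _ ss) /advect !(pdN _ ss).
  transitivity (- (lap (swirl a b) y - 2 * vort2 a b y)); first by ring.
  by rewrite E1 /advect /u /=; ring.
- by move=> y; rewrite !(pdN _ ss) mulrN E2; ring.
Qed.

End Lq_liouville.

Theorem theorem2p6 (R : realType) (u : 'rV[R]_3 -> 'rV[R]_3)
    (p : 'rV[R]_3 -> R)
    (u_smooth : smooth_field u) (p_smooth : smooth p)
    (u_axisymmetric : axisymmetric u)
    (u_p_NS : steady_NS u p)
    (u_vanishes : u x @[x --> at_infty R] --> (0 : 'rV[R]_3))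
    (Gamma_condition :
      Gamma u x @[x --> at_infty R] --> (0 : R) \/
      exists q : R, 2 <= q /\ Lq3 q (Gamma u)) :
  forall x : 'rV[R]_3, u x = 0.
Proof.
have H := axisymmetric_axiflow u p u_smooth p_smooth u_axisymmetric u_p_NS.
have GE : Gamma u = swirl (component u 0) (component u 1).
  by apply/funext => x; exact: GammaE.
have v i := component_vanishes u i u_vanishes.
have S0 : forall x, swirl (component u 0) (component u 1) x = 0.
  move: Gamma_condition; rewrite GE => -[/cvg_vanishes G0|[q [q2 Gq]]].
    exact: decaying_swirl_eq0 H (v 2) G0.
  exact: Lq_swirl_eq0 H (v 0) (v 1) (v 2) q2 Gq.
move=> x; have [u0 u1 u2] := no_swirl_liouville _ _ _ _ H S0 (v 0) (v 1) (v 2) x.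
by apply/rowP => i; rewrite mxE; have [->|->|->] := ord3E i.
Qed.
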